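(* Let $k\geqslant 2$ be an integer. (i) $$E_{k,0}=\frac1{(k-1)!}\sum_{j=2}^{k}(-1)^{k+j}j^{k-1}\binom{k}{j}\log j.$$ (ii) $$E_{k,1}=(-1)^{k} \frac{k}{12\,(k-2)!}\pi^2+\sum_{m=2}^{k} C_{\log}(k,m)\log m+\sum_{m=2}^{k-1} (-1)^{k-m}\frac{k\,m^{k-1}}{(k-1)!} \binom{k-1}{m} \mathrm{Li}_2 \Big(-\frac{1}{m}\Big),$$ where $$C_{\log}(k,m)=(-1)^{k-m} \binom{k}{m} \big[(k-m)\,\mathcal{C}_k(m)-m\, \mathcal{B}_k(m-1)\big].$$ (iii) $E_{k,2}=k A_k+ \binom{k}{2} B_k$, where $A_k$ and $B_k$ are absolutely convergent integrals, and for all $k\geqslant 2$ $$kA_k=(-1)^{k} \frac{3k}{2(k-2)!}\,\zeta(3)+(-1)^{k} \frac{kH_{k-1}}{6(k-2)!}\,\pi^2+\sum_{m=2}^{k-1}(-1)^{k-m}\frac{2k\,m^{k-1}}{(k-1)!}\binom{k-1}{m}\Big[\mathrm{Li}_3\Big(-\frac1m\Big)+H_{k-1}\,\mathrm{Li}_2\Big(-\frac1m\Big)\Big]+[\log]_A ,$$ where $$[\log]_A = k \sum_{j=1}^{k-1} (-1)^{k - 1 - j} \binom{k-1}{j} \big[\mathcal{C}_k^+(j) \log(j + 1) + \mathcal{C}_k^-(j) \log j\big].$$ Moreover, $B_k$ has the following explicit closed forms for $k\leqslant 4$: $$B_2=\frac{\pi^2}{6}+4\log 2, \qquad 3B_3=-\frac{5}{8}\zeta(3)-\frac{1}{2}\pi^2-33\log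 2+\frac{99}{4}\log 3-12\,\mathrm{Li}_2\Big(-\frac{1}{2}\Big),$$ $$\begin{aligned}6B_4 ={}& \frac{361}{6}\,\zeta(3)+\frac{2}{3}\pi^2+\frac{3232}{9}\log 2-222\log 3+80\,\mathrm{Li}_3\Big(-\frac{1}{2}\Big)+8\,\mathrm{Li}_3\Big(-\frac{1}{3}\Big)\\&+\Big(56+\frac{64}{3}\log 2-\frac{32}{3}\log 3\Big)\mathrm{Li}_2\Big(-\frac{1}{2}\Big)+\Big(-60-\frac{16}{3}\log 2+\frac{8}{3}\log 3\Big)\mathrm{Li}_2\Big(-\frac{1}{3}\Big)\\&-\frac{32}{9}\pi^2\log 2-\frac{8}{9}\pi^2\log 3+\frac{16}{3}(\log 2)^2\log 3.\end{aligned}$$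
   Context: For integers $k\geqslant 2$, $n\geqslant 0$, $$E_{k,n} = (-1)^{n} \int_{(0,1]^k} \frac{h_n(\log t_1, \dots, \log t_k)}{t_1 + \cdots + t_k} \, \mathrm{d}t_1\cdots\mathrm{d}t_k,$$ where $h_n(y_1,\dots,y_k)=\sum_{n_1+\cdots+n_k=n,\ n_j\geqslant 0}\prod_{j} y_j^{n_j}$ is the complete homogeneous symmetric polynomial of degree $n$ ($h_0=1$). Also $$A_k=\int_{(0,1]^k}\frac{\log^2 t_1}{t_1+\cdots+t_k}\, \mathrm{d}t_1\cdots\mathrm{d}t_k, \qquad B_k=\int_{(0,1]^k}\frac{\log t_1\,\log t_2}{t_1+\cdots+t_k}\, \mathrm{d}t_1\cdots\mathrm{d}t_k.$$ $H_m=\sum_{i\leqslant m}1/i$ (with $H_0=0$), $H_m^{(2)}=\sum_{i\leqslant m}1/i^2$, $\mathrm{Li}_s(z)=\sum_{n\geqslant1}z^n/n^s$ is the polylogarithm, and $\zeta$ is the Riemann zeta function. The polynomials in the statement are $$\mathcal{C}_k(x)=\frac{H_{k-1}}{(k-1)!}x^{k-1},\qquad \mathcal{B}_k(x)=-\frac{1}{(k-1)!}\sum_{n=1}^{k-1}c_{k,n}(x+1)^n,\qquad c_{k,n}=(-1)^{k-1-n}\binom{k-1}{n}(H_{k-1}-H_{k-n-1}),$$ $$\mathcal{C}_k^-(x) = -\frac{H_{k-1}^2 + H_{k-1}^{(2)}}{(k-1)!}\, x^{k-1},$$ and $\mathcal{C}_k^+$ is the polynomial determined recursively by $\mathcal{C}_1^+=0$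 and, for $k\geqslant 2$, $(\mathcal{C}_k^+)'(x) = \mathcal{C}_{k-1}^+(x) + \dfrac{2 H_{k-1}}{(k-1)!}\, x^{k-2}$ together with $\mathcal{C}_k^+(-1) = 0$. *)

(* Defs.v *)
From HB Require Import structures.
From mathcomp Require Import all_boot all_order all_algebra.
From mathcomp Require Import all_classical all_reals all_analysis.

Set Implicit Arguments.
Unset Strict Implicit.
Unset Printing Implicit Defensive.

Import Order.TTheory GRing.Theory Num.Theory.
Import numFieldNormedType.Exports.

Local Open Scope classical_set_scope.
Local Open Scope ring_scope.

Section LebesgueTuple.
Context {R : realType}.
Local Notation T := (measurableTypeR R).
Local Open Scope ereal_scope.

Definition tcons n (p : T * n.-tuple T) : n.+1.-tuple T :=
  [the n.+1.-tuple T of p.1 :: p.2].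

Lemma measurable_tcons n : measurable_fun setT (@tcons n).
Proof. exact: measurable_cons. Qed.

Section step.
Context (n : nat) (mu : {sigma_finite_measure set (n.-tuple T) -> \bar R}).

Definition lebesgue_tupleS : set (n.+1.-tuple T) -> \bar R :=
  pushforward (@lebesgue_measure R \x mu) (@tcons n).

Let mtcons A : measurable A -> measurable (@tcons n @^-1` A).
Proof. by move=> mA; rewrite -[X in measurable X]setTI; exact: measurable_tcons. Qed.

Let lebesgue_tupleS0 : lebesgue_tupleS set0 = 0.
Proof. by rewrite /lebesgue_tupleS /pushforward preimage_set0 measure0. Qed.

Let lebesgue_tupleS_ge0 A : 0 <= lebesgue_tupleS A.
Proof. by rewrite /lebesgue_tupleS /pushforward measure_ge0. Qed.

Let lebesgue_tupleS_sigma : semi_sigma_additive lebesgue_tupleS.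
Proof.
move=> F mF tF mUF; rewrite /lebesgue_tupleS /pushforward preimage_bigcup.
apply: measure_semi_sigma_additive.
- by move=> i; exact: mtcons.
- apply/trivIsetP => /= i j _ _ ij; rewrite -preimage_setI.
  by move/trivIsetP : tF => /(_ _ _ _ _ ij) ->//; rewrite preimage_set0.
- by rewrite -preimage_bigcup; exact: mtcons.
Qed.

HB.instance Definition _ := isMeasure.Build _ _ _ lebesgue_tupleS
  lebesgue_tupleS0 lebesgue_tupleS_ge0 lebesgue_tupleS_sigma.

Let lebesgue_tupleS_sigma_finite : sigma_finite setT lebesgue_tupleS.
Proof.
have /sigma_finiteP[F [TF ndF Foo]] := sigma_finiteT (@lebesgue_measure R).
have /sigma_finiteP[G [TG ndG Goo]] := sigma_finiteT mu.
pose u (t : n.+1.-tuple T) : T * n.-tuple T := (thead t, [tuple of behead t]).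
have mu_ : measurable_fun setT u.
  by apply/measurable_fun_pair; [exact: measurable_tnth|exact: measurable_behead].
have uK p : u (tcons p) = p.
  case: p => x t; rewrite /u /tcons; congr pair; exact/val_inj.
exists (fun i => u @^-1` (F i `*` G i)).
  rewrite -preimage_bigcup (_ : \bigcup_i _ = setT) ?preimage_setT//.
  apply/seteqP; split=> // -[x t] _.
  have [i _ Fx] : (\bigcup_i F i) x by rewrite -TF.
  have [j _ Gt] : (\bigcup_j G j) t by rewrite -TG.
  exists (maxn i j) => //; split=> /=.
    by move: x Fx; exact/subsetPset/ndF/leq_maxl.
  by move: t Gt; exact/subsetPset/ndG/leq_maxr.
move=> i; have [? ?] := Foo i; have [? ?] := Goo i.
have mFG : measurable (F i `*` G i) by exact: measurableX.
split; first by rewrite -[X in measurable X]setTI; exact: mu_.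
rewrite /lebesgue_tupleS /pushforward -comp_preimage (_ : u \o _ = id).
  by rewrite preimage_id product_measure1E// lte_mul_pinfty// ge0_fin_numE.
by apply/funext => p /=; exact: uK.
Qed.

HB.instance Definition _ := Measure_isSigmaFinite.Build _ _ _ lebesgue_tupleS
  lebesgue_tupleS_sigma_finite.
End step.

(* Lebesgue measure on R^n, on the Borel (product) sigma-algebra *)
Fixpoint lebesgue_tuple n : {sigma_finite_measure set (n.-tuple T) -> \bar R} :=
  if n is m.+1 then lebesgue_tupleS (lebesgue_tuple m)
  else [the {sigma_finite_measure set (0.-tuple T) -> \bar R}
        of \d_([tuple] : 0.-tuple T)].

Lemma lebesgue_tuple_box n (A : 'I_n -> set T) :
  (forall i, measurable (A i)) ->
  lebesgue_tuple n [set t | forall i, A i (tnth t i)] =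
  \prod_(i < n) lebesgue_measure (A i).
Proof.
elim: n A => [|n IH] A mA.
  rewrite big_ord0 /= diracE (_ : _ \in _)//.
  by rewrite inE /= => -[].
rewrite big_ord_recl /= /lebesgue_tupleS /pushforward.
rewrite (_ : _ @^-1` _ = A ord0 `*`
    [set t | forall i, A (lift ord0 i) (tnth t i)]); last first.
  apply/seteqP; split=> [[x t]/= h|[x t]/= [h0 h1] i].
    split; first by have := h ord0; rewrite tnth0.
    by move=> i; have := h (lift ord0 i); rewrite tnthS.
  case: (unliftP ord0 i) => [j ->|->]; last by rewrite tnth0.
  by rewrite tnthS; exact: h1.
rewrite product_measure1E//; last first.
  rewrite (_ : [set t | _] =
      \bigcap_(i in [set: 'I_n]) ((fun t : n.-tuple T => tnth t i) @^-1` A (lift ord0 i))).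
    apply: fin_bigcap_measurable => //= i _.
    by rewrite -[X in measurable X]setTI; exact: measurable_tnth.
  by apply/seteqP; split=> [t h i _|t h i]; [exact: h|exact: (h i I)].
by congr (_ * _); exact: (IH (fun i => A (lift ord0 i))).
Qed.
End LebesgueTuple.

Arguments lebesgue_tuple : clear implicits.

Section Integrals.
Context {R : realType}.
Local Notation T := (measurableTypeR R).

Definition cube k : set (k.-tuple T) :=
  [set t | forall i, tnth t i \in `]0, 1]].
Arguments cube : clear implicits.

Definition complete_hom k n (y : 'I_k -> R) : R :=
  \sum_(nu : {ffun 'I_k -> 'I_n.+1} | (\sum_j nu j == n)%N)
    \prod_j y j ^+ nu j.

Definition tsum k (t : k.-tuple T) : R := \sum_(i < k) (tnth t i : R).

(* The value is an extended real, so that an identity [E_int k n = x%:E] with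
   [x : R] includes the convergence of the integral. *)
Definition E_int k n : \bar R :=
  (((-1) ^+ n)%:E *
   \int[lebesgue_tuple R k]_(t in cube k)
     (complete_hom n (fun i => ln (tnth t i : R)) / tsum t)%:E)%E.

(* [nth 0 t 0] and [nth 0 t 1] are the coordinates t_1 and t_2; the default
   value is irrelevant for 2 <= k. *)
Definition A_integrand k (t : k.-tuple T) : R :=
  ln (nth (0 : R) t 0) ^+ 2 / tsum t.

Definition B_integrand k (t : k.-tuple T) : R :=
  ln (nth (0 : R) t 0) * ln (nth (0 : R) t 1) / tsum t.

Definition A_int k : R := \int[lebesgue_tuple R k]_(t in cube k) A_integrand t.

Definition B_int k : R := \int[lebesgue_tuple R k]_(t in cube k) B_integrand t.

End Integrals.

Arguments E_int : clear implicits.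
Arguments A_int : clear implicits.
Arguments B_int : clear implicits.
Arguments cube : clear implicits.
Arguments A_integrand : clear implicits.
Arguments B_integrand : clear implicits.

Section Constants.
Context {R : realType}.

Definition Harm m : R := \sum_(1 <= i < m.+1) i%:R^-1.

Definition Harm2 m : R := \sum_(1 <= i < m.+1) (i%:R ^+ 2)^-1.

(* Only used at convergent arguments: s >= 2 and |z| <= 1. *)
Definition Li (s : nat) (z : R) : R :=
  limn (fun N => \sum_(1 <= n < N) z ^+ n / n%:R ^+ s : R).

Definition zeta (s : nat) : R :=
  limn (fun N => \sum_(1 <= n < N) (n%:R ^+ s)^-1 : R).

End Constants.

Arguments Harm : clear implicits.
Arguments Harm2 : clear implicits.
Arguments zeta : clear implicits.

Section Polynomials.
Context {R : realType}.
Implicit Type p : {poly R}.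

Definition calC k : {poly R} := (Harm R k.-1 / k.-1`!%:R) *: 'X^(k.-1).

Definition cB k n : R :=
  (-1) ^+ (k - 1 - n) * 'C(k.-1, n)%:R * (Harm R k.-1 - Harm R (k - n - 1)).

Definition calB k : {poly R} :=
  - (k.-1`!%:R^-1 *: \sum_(1 <= n < k) cB k n *: ('X + 1) ^+ n).

Definition calCminus k : {poly R} :=
  - (((Harm R k.-1 ^+ 2 + Harm2 R k.-1) / k.-1`!%:R) *: 'X^(k.-1)).

(* The constant coefficient is 0, as 0^-1 = 0. *)
Definition primitive p : {poly R} := \poly_(i < (size p).+1) (p`_i.-1 / i%:R).

Definition primitive_from (a : R) p : {poly R} :=
  primitive p - (primitive p).[a]%:P.

Lemma deriv_primitive_from a p : (primitive_from a p)^`() = p.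
Proof.
rewrite derivB derivC subr0; apply/polyP => i.
rewrite coef_deriv coef_poly ltnS /=; case: ltnP => [_|pi].
  by rewrite -mulrnAr -mulr_natr mulVf ?mulr1// pnatr_eq0.
by rewrite mul0rn nth_default.
Qed.

Lemma horner_primitive_from a p : (primitive_from a p).[a] = 0.
Proof. by rewrite hornerD hornerN hornerC subrr. Qed.

Lemma eq_from_deriv a p q : p^`() = q^`() -> p.[a] = q.[a] -> p = q.
Proof.
move=> pq' pqa; apply/eqP; rewrite -subr_eq0; apply/eqP.
have /size1_polyC e : (size (p - q)%R <= 1)%N.
  apply/leq_sizeP => -[//|i] _.
  have : (p - q)^`()`_i = 0 by rewrite derivB pq' subrr coef0.
  by rewrite coef_deriv => /eqP; rewrite mulrn_eq0 /= => /eqP.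
have : (p - q).[a] = 0 by rewrite hornerD hornerN pqa subrr.
by rewrite e hornerC => ->; rewrite polyC0.
Qed.

(* [calCplus 0] is a junk value. *)
Fixpoint calCplus k : {poly R} :=
  if k is k'.+1 then
    if k' is k''.+1 then
      primitive_from (-1)
        (calCplus k' + (2 * Harm R k' / k'`!%:R) *: 'X^k'')
    else 0
  else 0.

Definition calCplus_spec (C : nat -> {poly R}) : Prop :=
  C 1%N = 0 /\ forall k, (2 <= k)%N ->
    (C k)^`() = C k.-1 + (2 * Harm R k.-1 / k.-1`!%:R) *: 'X^(k - 2) /\
    (C k).[-1] = 0.

Lemma calCplusP : calCplus_spec calCplus.
Proof.
split=> // -[//|[//|k]] _; rewrite [calCplus _]/= -/(calCplus k.+1).
by rewrite deriv_primitive_from horner_primitive_from /= subn2.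
Qed.

Lemma calCplus_unique C : calCplus_spec C ->
  forall k, (1 <= k)%N -> C k = calCplus k.
Proof.
move=> [C1 CS]; have [D1 DS] := calCplusP.
elim=> [//|[|k] IH] _; first by rewrite C1 D1.
have [//|C' C0] := CS k.+2; have [//|D' D0] := DS k.+2.
by apply: (@eq_from_deriv (-1)); rewrite ?C0 ?D0// C' D' /= IH.
Qed.

Definition Clog k m : R :=
  (-1) ^+ (k - m) * 'C(k, m)%:R *
  ((k - m)%:R * (calC k).[m%:R] - m%:R * (calB k).[m%:R - 1]).

Definition logA k : R :=
  k%:R * \sum_(1 <= j < k) (-1) ^+ (k - 1 - j) * 'C(k.-1, j)%:R *
    ((calCplus k).[j%:R] * ln (j.+1)%:R + (calCminus k).[j%:R] * ln j%:R).

End Polynomials.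

Arguments Clog : clear implicits.
Arguments logA : clear implicits.

(* Main.v *)
Require Import Defs.
From mathcomp Require Import all_boot all_order all_algebra.
From mathcomp Require Import all_classical all_reals all_analysis.
From mathcomp Require Import measurable_realfun ring lra zify.

Set Implicit Arguments.
Unset Strict Implicit.
Unset Printing Implicit Defensive.

Import Order.TTheory GRing.Theory Num.Theory.
Import numFieldNormedType.Exports.

Local Open Scope classical_set_scope.
Local Open Scope ring_scope.

(** On the cube the functions - ln t_i are nonnegative, so by Tonelli's theorem the
    integrals are iterated integrals, without any convergence being known.  Write
    S_a h (x) for the integral of (- ln t) ^ a h (x + t) over t in ]0, 1]
    ([log_integral]).  The operators S_a commute, and expanding the complete
    homogeneous polynomial gives ([weight_integral0], [weight_integral1],
    [weight_integral2]), with everything applied to 1 / x and taken at x = 0,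
      E_(k,0) = S_0^k,   E_(k,1) = k S_0^(k-1) S_1,
      E_(k,2) = k S_0^(k-1) S_2 + binomial(k, 2) S_0^(k-2) S_1^2,
    where the two terms of the last line are k A_k and binomial(k, 2) B_k.

    One logarithmic integral is a polylogarithm: S_1 (1 / x) = - Li_2 (- 1 / x) and
    S_2 (1 / x) = - 2 Li_3 (- 1 / x) ([log_integral1_kernel],
    [log_integral2_kernel]).  Unit integrals are finite differences: if G is the
    n-th derivative of F, then S_0^n G is the n-th difference of F
    ([iter_log_integral0]).  An n-th antiderivative of the polylogarithm is x ^ n
    times polylogarithms, plus B(x) ln (1 + x) + C(x) ln x, plus a polynomial of
    degree less than n, which the difference kills.  The polynomials B and C are
    found one antiderivative at a time; their recursion is the one satisfied by the
    polynomials of the statement, and the vanishing of B at - 1 and of C at 0 is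
    what keeps the remainder polynomial ([log_chain_step], [log_chain_Li2],
    [log_chain_Li3]).  Evaluation at 0 gives (i), (ii) and the formula for A_k
    ([E_int0], [E_int1], [A_closed]).

    B_k converges because S_1 (1 / x) is decreasing, so that S_0 does not increase
    it, whence B_k <= B_2 ([B_integral_bound]).  For k <= 4 it is the integral of
    - ln t times a difference of an explicit function made of Li_2 (- 1 / (t + j))
    and ln (t + j).  Integration by parts and division by t + j reduce the pieces to
    the integral of ln t (ln (t + j + 1) - ln (t + j)) / (t + j), which has an
    antiderivative in trilogarithms ([newton_ln_dlog0]).  The values that occur lie
    at rational points built from 2 and 3; Landen's relation, duplication and an
    equation of Kummer in one variable ([kummer_Li3]) at 1 / 2 and 1 / 3 reduce them
    to the constants of the statement.

    All facts on Li_2 and Li_3 come from their series and from differentiation: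
    an identity holds when the derivatives agree and one limit at an end of the
    interval does ([eq_from_derive_lim]).  The constants enter through Li_2 (1),
    evaluated by halving angles in a sum of 1 / sin ^ 2 ([sum_inv_sin2]). *)

(** * Differentiation of explicit expressions *)

Section DerivativeRules.
Context {R : realType}.
Implicit Types (f g : R -> R) (x : R).

Lemma der_eq f x (d d' : R) :
  is_derive x (1 : R) f d' -> d' = d -> is_derive x (1 : R) f d.
Proof. by move=> h <-. Qed.

Lemma der_id x : is_derive x (1 : R) (fun t : R => t) 1.
Proof. exact: is_derive_id. Qed.

Lemma der_cst (c : R) x : is_derive x (1 : R) (fun _ : R => c) 0.
Proof. exact: is_derive_cst. Qed.

Lemma der_add f g x a b :
  is_derive x (1 : R) f a -> is_derive x (1 : R) g b ->
  is_derive x (1 : R) (fun t => f t + g t) (a + b).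
Proof. by move=> fa gb; exact: is_deriveD. Qed.

Lemma der_opp f x a :
  is_derive x (1 : R) f a -> is_derive x (1 : R) (fun t => - f t) (- a).
Proof. by move=> fa; exact: is_deriveN. Qed.

Lemma der_mul f g x a b :
  is_derive x (1 : R) f a -> is_derive x (1 : R) g b ->
  is_derive x (1 : R) (fun t => f t * g t) (f x * b + a * g x).
Proof.
move=> fa gb; apply: (der_eq (is_deriveM fa gb)).
by rewrite /= /GRing.scale/= [g x * a]mulrC.
Qed.

Lemma der_exp f n x a :
  is_derive x (1 : R) f a ->
  is_derive x (1 : R) (fun t => f t ^+ n) (n%:R * f x ^+ n.-1 * a).
Proof. by move=> fa; have := is_deriveX n fa; rewrite exprfctE. Qed.

Lemma der_inv f x a : f x != 0 ->
  is_derive x (1 : R) f a ->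
  is_derive x (1 : R) (fun t => (f t)^-1) (- a / f x ^+ 2).
Proof.
move=> fx0 fa; apply: (der_eq (is_deriveV fx0 fa)).
by rewrite /= /GRing.scale/= mulNr mulNr mulrC.
Qed.

Lemma der_comp f g x a b :
  is_derive (g x) (1 : R) f a -> is_derive x (1 : R) g b ->
  is_derive x (1 : R) (fun t => f (g t)) (a * b).
Proof. by move=> fa gb; exact: is_derive1_comp. Qed.

Lemma der_ln f x a : 0 < f x ->
  is_derive x (1 : R) f a ->
  is_derive x (1 : R) (fun t => ln (f t)) (a / f x).
Proof.
move=> fx0 fa; apply: (der_eq (der_comp (is_derive1_ln fx0) fa)).
by rewrite mulrC.
Qed.

Lemma der_horner (p : {poly R}) x :
  is_derive x (1 : R) (fun t => p.[t]) (p^`()).[x].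
Proof. exact: is_derive_poly. Qed.

Lemma der_sum (I : Type) (r : seq I) (P : pred I) (F : I -> R -> R) (d : I -> R) x :
  (forall i, P i -> is_derive x (1 : R) (F i) (d i)) ->
  is_derive x (1 : R) (fun t => \sum_(i <- r | P i) F i t) (\sum_(i <- r | P i) d i).
Proof.
move=> Fd; elim: r => [|i r IH].
  under [X in is_derive _ _ X]eq_fun do rewrite big_nil.
  by rewrite big_nil; exact: der_cst.
under [X in is_derive _ _ X]eq_fun do rewrite big_cons.
rewrite big_cons; case: ifP => // Pi.
exact: (der_add (Fd _ Pi) IH).
Qed.

Lemma der_continuous f x d : is_derive x (1 : R) f d -> {for x, continuous f}.
Proof. by move=> [fd _]; exact/differentiable_continuous/derivable1_diffP. Qed.

End DerivativeRules.

(* Extended below, once special functions have been differentiated. *)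
Ltac der_special rec := fail.

(* The leaf case [eassumption] lets hypotheses supply the derivatives of
   functions that have no syntactic rule. *)
Ltac der_rules :=
  first [der_special der_rules |
  lazymatch goal with
  | |- is_derive _ _ (fun t => t) _ => apply: der_id
  | |- is_derive _ _ (fun _ => ?c) _ => apply: der_cst
  | |- is_derive _ _ (fun t => @?f t + @?g t) _ => eapply (@der_add _ f g); der_rules
  | |- is_derive _ _ (fun t => - @?f t) _ => eapply (@der_opp _ f); der_rules
  | |- is_derive _ _ (fun t => @?f t * @?g t) _ => eapply (@der_mul _ f g); der_rules
  | |- is_derive _ _ (fun t => @?f t ^+ ?n) _ => eapply (@der_exp _ f n); der_rules
  | |- is_derive _ _ (fun t => (@?f t)^-1) _ => eapply (@der_inv _ f); [|der_rules]
  | |- is_derive _ _ (fun t => ln (@?f t)) _ => eapply (@der_ln _ f); [|der_rules]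
  | |- is_derive _ _ (fun t => horner ?p t) _ => eapply (@der_horner _ p)
  | |- is_derive _ _ (fun t => ?h (@?f t)) _ =>
      first [eassumption | eapply (@der_comp _ h f); [try eassumption|der_rules]]
  | |- _ => try eassumption
  end].

(** Leaves the side conditions, then the equation between the derivative found by
    the rules and the stated one. *)
Ltac derive := eapply der_eq; [der_rules|].

Section Uniqueness.
Context {R : realType}.

Lemma eq_derive_diff_cst (I : interval R) (f g d : R -> R) :
  (forall x, x \in I -> is_derive x (1 : R) f (d x)) ->
  (forall x, x \in I -> is_derive x (1 : R) g (d x)) ->
  forall x y, x \in I -> y \in I -> f x - g x = f y - g y.
Proof.
move=> fd gd.
have main x y : x \in I -> y \in I -> x <= y -> f x - g x = f y - g y.
  move=> xI yI xy.
  have hI z : z \in `[x, y] -> z \in I.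
    by rewrite in_itv/= => zxy; apply: (interval_is_interval xI yI).
  have hd z : z \in I -> is_derive z (1 : R) (fun t => f t - g t) 0.
    move=> zI; apply: (der_eq (der_add (fd z zI) (der_opp (gd z zI)))).
    by rewrite subrr.
  have [z zxy||c _] := @MVT_segment R (fun t => f t - g t) (fun=> 0) x y xy.
  - by apply: hd; apply: hI; apply: subset_itv_oo_cc.
  - apply: derivable_within_continuous => z /hI zI.
    by have [] := hd z zI.
  - by rewrite mul0r => /subr0_eq.
move=> x y xI yI; have [xy|/ltW yx] := leP x y; first exact: main.
by rewrite (main y x).
Qed.

(** The constant of integration is read off from a limit, which may be taken at
    an end of the interval where the functions are not differentiable. *)
Lemma eq_from_derive_lim (I : interval R) (F : set_system R) (f g d : R -> R) :
  ProperFilter F -> F [set` I] ->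
  (forall x, x \in I -> is_derive x (1 : R) f (d x)) ->
  (forall x, x \in I -> is_derive x (1 : R) g (d x)) ->
  f x - g x @[x --> F] --> (0 : R) ->
  forall x, x \in I -> f x = g x.
Proof.
move=> PF FI fd gd lim0 x xI; apply/eqP; rewrite -subr_eq0; apply/eqP.
have cstx : f t - g t @[t --> F] --> f x - g x.
  apply: cvg_near_cst; apply: filterS FI => t tI.
  by have := eq_derive_diff_cst fd gd tI xI.
exact: (cvg_unique _ cstx lim0).
Qed.

End Uniqueness.

(** * The polylogarithms on [-1, 1] *)

Section PolylogSeries.
Context {R : realType}.
Implicit Types (s n N : nat) (z : R).

Definition polylog_coef s : R^nat := fun n => (n%:R ^+ s)^-1.

Lemma polylog_coef_ge0 s n : 0 <= polylog_coef s n.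
Proof. by rewrite invr_ge0 exprn_ge0. Qed.

Lemma polylog_coef_le s n : (0 < s)%N -> polylog_coef s n <= 1.
Proof.
case: s => // s _; case: n => [|n].
  by rewrite /polylog_coef expr0n /= invr0.
by rewrite /polylog_coef invf_le1 ?exprn_gt0// exprn_ege1// ler1n.
Qed.

(** The junk value 1 / 0 = 0 makes the term of index 0 vanish. *)
Lemma Li_pseries s z : (0 < s)%N -> Li s z = limn (pseries (polylog_coef s) z).
Proof.
move=> s0; rewrite /Li; congr (limn _); apply/funext => -[|N].
  by rewrite big_geq// /pseries /series/= big_geq.
rewrite /pseries /series/= [RHS]big_ltn//= {1}/polylog_coef expr0n.
rewrite eqn0Ngt s0 invr0 mul0r add0r.
by apply: eq_bigr => i _; rewrite mulrC.
Qed.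

Lemma cvg_inv_sqr : cvgn (series (polylog_coef 2)).
Proof.
apply: nondecreasing_is_cvgn.
  by apply/nondecreasing_series => n _ _; exact: polylog_coef_ge0.
exists 2 => _ [n _ <-].
have bound m : series (polylog_coef 2) m.+2 <= 2 - m.+1%:R^-1 :> R.
  elim: m => [|m IH].
    by rewrite /series/= !big_nat_recr//= big_geq// /polylog_coef expr0n/=; lra.
  rewrite /series/= big_nat_recr//=; apply: (le_trans (lerD IH (lexx _))).
  rewrite /polylog_coef -[m.+2%:R]natr1.
  have m0 : 0 < m.+1%:R :> R by [].
  rewrite -subr_ge0.
  rewrite [X in 0 <= X](_ : _ = (m.+1%:R * (m.+1%:R + 1) ^+ 2)^-1).
    by rewrite invr_ge0 mulr_ge0// ?exprn_ge0//; lra.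
  by field; rewrite gt_eqF//; lra.
have series_le : series (polylog_coef 2) n <= series (polylog_coef 2) n.+2 :> R.
  apply/nondecreasing_series; last by rewrite leqW.
  by move=> i _ _; exact: polylog_coef_ge0.
rewrite (le_trans series_le)// (le_trans (bound n))//.
by rewrite gerBl invr_ge0.
Qed.

Lemma cvg_polylog1 s : (2 <= s)%N -> cvgn (series (polylog_coef s)).
Proof.
move=> s2; apply: series_le_cvg cvg_inv_sqr => n; try exact: polylog_coef_ge0.
case: n => [|n].
  by rewrite /polylog_coef !expr0n/=; case: s s2.
by rewrite /polylog_coef lef_pV2 ?posrE ?exprn_gt0// ler_weXn2l// ler1n.
Qed.

Lemma cvg_pseries_polylog s z : (2 <= s)%N -> `|z| <= 1 ->
  cvgn (pseries (polylog_coef s) z).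
Proof.
move=> s2 z1; apply: normed_cvg; apply: series_le_cvg (cvg_polylog1 s2) => n //=.
  exact: polylog_coef_ge0.
rewrite normrM normrX ger0_norm ?polylog_coef_ge0//.
by rewrite ler_piMr ?polylog_coef_ge0// exprn_ile1.
Qed.

Lemma cvg_pseries_linear (a : R^nat) (K : R) : 0 <= K < 1 ->
  (forall n, `|a n| <= n.+1%:R) -> cvgn (pseries a K).
Proof.
move=> /andP[K0 K1] an; apply: normed_cvg.
apply: (@series_le_cvg _ _ (fun n => n.+1%:R * K ^+ n)) => [n|n|n|].
- exact: normr_ge0.
- by rewrite mulr_ge0// exprn_ge0.
- by rewrite /= normrM normrX (ger0_norm K0) ler_wpM2r ?exprn_ge0.
apply: nondecreasing_is_cvgn.
  by apply/nondecreasing_series => n _ _; rewrite mulr_ge0// exprn_ge0.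
exists ((1 - K) ^+ 2)^-1 => _ [n _ <-].
have K1' : 0 < 1 - K by rewrite subr_gt0.
rewrite -[leRHS]mul1r ler_pdivlMr ?exprn_gt0//.
have -> : series (fun n => n.+1%:R * K ^+ n) n * (1 - K) ^+ 2 =
    1 - (n.+1%:R * (1 - K) + K) * K ^+ n.
  elim: n => [|n IH]; first by rewrite /series/= big_geq// expr0; ring.
  rewrite /series/= big_nat_recr//= mulrDl IH.
  by rewrite -(natr1 n.+1) (exprS K); ring.
by rewrite gerBl mulr_ge0 ?exprn_ge0// addr_ge0// mulr_ge0// ltW.
Qed.

Lemma cvg_pseries_polylog_lt s z : (0 < s)%N -> `|z| < 1 ->
  cvgn (pseries (polylog_coef s) z).
Proof.
move=> s0 z1; apply: normed_cvg.
have /cvg_pseries_linear h : 0 <= `|z| < 1 by rewrite normr_ge0.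
have {}h : cvgn (pseries (polylog_coef s) `|z|).
  apply: h => n; rewrite ger0_norm ?polylog_coef_ge0//.
  by rewrite (le_trans (polylog_coef_le _ s0))// ler1n.
rewrite (_ : [normed _] = pseries (polylog_coef s) `|z|)//.
apply/funext => N; apply: eq_bigr => n _ /=.
by rewrite normrM normrX ger0_norm ?polylog_coef_ge0.
Qed.

Lemma derive_pseries_polylog s z : (0 < s)%N -> `|z| < 1 ->
  is_derive z (1 : R) (Li s) (limn (pseries (pseries_diffs (polylog_coef s)) z)).
Proof.
move=> s0 z1.
have -> : Li s = (fun z : R => limn (pseries (polylog_coef s) z)).
  by apply/funext => t; rewrite Li_pseries.
have K01 : 0 <= (1 + `|z|) / 2 < 1 by apply/andP; have := normr_ge0 z; lra.
have diffsE n : pseries_diffs (polylog_coef s) n = polylog_coef s.-1 n.+1 :> R.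
  rewrite /pseries_diffs /polylog_coef; case: s s0 => // s _.
  by rewrite exprS invfM mulVKf.
have coef_le1 n : polylog_coef s.-1 n.+1 <= 1 :> R.
  rewrite /polylog_coef invf_le1 ?exprn_gt0//.
  by rewrite exprn_ege1// ler1n.
apply: (@pseries_snd_diffs _ _ ((1 + `|z|) / 2)).
- apply: cvg_pseries_linear => // n; rewrite ger0_norm ?polylog_coef_ge0//.
  by rewrite (le_trans (polylog_coef_le _ s0))// ler1n.
- apply: cvg_pseries_linear => // n; rewrite diffsE ger0_norm ?polylog_coef_ge0//.
  by rewrite (le_trans (coef_le1 _))// ler1n.
- apply: cvg_pseries_linear => // n; rewrite {1}/pseries_diffs diffsE.
  rewrite ger0_norm ?mulr_ge0 ?polylog_coef_ge0//.
  by rewrite ler_piMr// coef_le1.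
- by rewrite (@ger0_norm _ ((1 + `|z|) / 2)); [lra|case/andP: K01].
Qed.

Lemma Li0 s : (0 < s)%N -> Li s (0 : R) = 0.
Proof.
move=> s0; rewrite /Li.
rewrite (_ : (fun N => _) = fun=> 0) ?lim_cst//.
apply/funext => N; rewrite big_nat big1// => i /andP[i0 _].
by rewrite expr0n eqn0Ngt i0 mul0r.
Qed.

(** Both sides vanish at 0 and have derivative 1 / (1 - z). *)
Lemma Li1E z : `|z| < 1 -> Li 1 z = - ln (1 - z).
Proof.
move=> z1.
pose I := `](-1 : R), 1[.
have IE t : (t \in I) = (`|t| < 1) by rewrite in_itv/= ltr_norml.
apply: (@eq_from_derive_lim R I (nbhs (0 : R)) (Li 1) (fun t => - ln (1 - t))
  (fun t => (1 - t)^-1)).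
- by apply: open_nbhs_nbhs; split; [exact: interval_open|rewrite /= IE normr0].
- move=> t; rewrite IE => t1; apply: (der_eq (derive_pseries_polylog _ t1)) => //.
  apply/cvg_lim => //; rewrite -[X in _ --> X]mul1r.
  rewrite (_ : pseries _ t = series (geometric 1 t)).
    exact: cvg_geometric_series.
  apply/funext => N; apply: eq_bigr => n _.
  rewrite /pseries_diffs /polylog_coef; by rewrite /= expr1 mulfV.
- move=> t; rewrite IE => t1; have /andP[_ t1'] : -1 < t < 1 by rewrite -ltr_norml.
  derive; first by rewrite subr_gt0.
  by field; rewrite gt_eqF// subr_gt0.
- have h : is_derive (0 : R) (1 : R) (fun t : R => Li 1 t - - ln (1 - t))
      (limn (pseries (pseries_diffs (polylog_coef 1)) 0) - - ((0 - 1) / (1 - 0))).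
    apply: der_add; first by apply: derive_pseries_polylog; rewrite ?normr0.
    by derive => //=; rewrite subr0.
  have : (Li 1 t - - ln (1 - t)) @[t --> (0 : R)] --> Li 1 (0 : R) - - ln (1 - 0 : R).
    exact: der_continuous h.
  by rewrite Li0// subr0 ln1 oppr0 subr0.
- by rewrite IE.
Qed.

Lemma derive_Li s z : (0 < s)%N -> z != 0 -> `|z| < 1 ->
  is_derive z (1 : R) (Li s.+1) (Li s z / z).
Proof.
move=> s0 z0 z1; apply: (der_eq (derive_pseries_polylog _ z1)) => //.
apply: (canRL (mulfK z0)).
rewrite Li_pseries//.
have cLi := cvg_pseries_polylog_lt s0 z1.
have coefS n : pseries_diffs (polylog_coef s.+1) n = polylog_coef s n.+1 :> R.
  by rewrite /pseries_diffs /polylog_coef exprS invfM mulVKf.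
have seriesE N : pseries (polylog_coef s) z N.+1 / z =
    pseries (pseries_diffs (polylog_coef s.+1)) z N.
  rewrite /pseries /series/= big_nat_recl//= {1}/polylog_coef expr0n.
  rewrite eqn0Ngt s0 invr0 mul0r add0r mulr_suml.
  by apply: eq_bigr => n _; rewrite coefS exprSr mulrA mulfK.
have : pseries (polylog_coef s) z N.+1 / z @[N --> \oo] -->
    limn (pseries (polylog_coef s) z) / z.
  by apply: cvgMr_tmp; move: cLi; rewrite -(cvg_shiftS (pseries _ _)).
by under eq_cvg do rewrite seriesE; move=> /cvg_lim ->//; rewrite divfK.
Qed.

End PolylogSeries.

(** * The value of zeta at 2 *)

Section Basel.
Context {R : realType}.
Implicit Types (x : R) (n k : nat).

Lemma sin_le x : 0 <= x -> sin x <= x.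
Proof.
move=> x0; rewrite -subr_ge0.
have hd z : is_derive z (1 : R) (fun t => t - sin t) (1 - cos z).
  by apply: der_add (der_opp _); exact: der_id.
have [|c _] := @MVT_segment R (fun t => t - sin t) (fun t => 1 - cos t) 0 x x0
    (fun z _ => hd z).
  by apply: derivable_within_continuous => z _; have [] := hd z.
rewrite sin0 !subr0 => ->.
by rewrite mulr_ge0// subr_ge0 cos_le1.
Qed.

Lemma mulr_cos_le_sin x : 0 <= x <= pi -> x * cos x <= sin x.
Proof.
move=> /andP[x0 xpi]; rewrite -subr_ge0.
have hd z : is_derive z (1 : R) (fun t => sin t - t * cos t) (z * sin z).
  have sz := is_derive_sin z; have cz := is_derive_cos z.
  by derive; ring.
have [|c] := @MVT_segment R (fun t => sin t - t * cos t) (fun t => t * sin t) 0 x x0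
    (fun z _ => hd z).
  by apply: derivable_within_continuous => z _; have [] := hd z.
rewrite in_itv/= => /andP[c0 cx].
rewrite sin0 mul0r !subr0 => ->.
by rewrite !mulr_ge0// sin_ge0_pi// c0 (le_trans cx).
Qed.

(** From sin x <= x <= tan x, as 1 / tan ^ 2 = 1 / sin ^ 2 - 1. *)
Lemma inv_sqr_between x : 0 < x < pi / 2 ->
  (sin x ^+ 2)^-1 - 1 <= (x ^+ 2)^-1 <= (sin x ^+ 2)^-1.
Proof.
move=> /andP[x0 xpi].
have pi0 := @pi_gt0 R.
have s0 : 0 < sin x by apply: sin_gt0_pihalf; rewrite x0.
apply/andP; split; last first.
  by rewrite lef_pV2 ?posrE ?exprn_gt0// lerXn2r ?nnegrE ?sin_le// ltW.
have c0 : 0 <= cos x.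
  by apply: cos_ge0_pihalf; rewrite ltW ?(ltW xpi)//; lra.
have : (x * cos x) ^+ 2 <= sin x ^+ 2.
  rewrite lerXn2r ?nnegrE ?mulr_ge0//; try exact: ltW.
  by apply: mulr_cos_le_sin; rewrite ltW//; lra.
rewrite exprMn cos2sin2 => h.
rewrite -subr_ge0.
have -> : (x ^+ 2)^-1 - ((sin x ^+ 2)^-1 - 1) =
    (sin x ^+ 2 - x ^+ 2 * (1 - sin x ^+ 2)) / (x ^+ 2 * sin x ^+ 2).
  by field; rewrite !gt_eqF.
by rewrite divr_ge0 ?subr_ge0// mulr_ge0// exprn_ge0// ltW.
Qed.

Definition odd_angle n k : R := k.*2.+1%:R * pi / 2 ^+ n.+2.

Lemma odd_angle_itv n k : (k < 2 ^ n)%N -> 0 < odd_angle n k < pi / 2.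
Proof.
move=> kn; have pi0 := @pi_gt0 R.
rewrite /odd_angle !mulr_gt0 ?invr_gt0 ?exprn_gt0//=.
rewrite ltr_pdivrMr ?exprn_gt0//.
rewrite (exprS _ n.+1) mulrA divfK// mulrC ltr_pM2l//.
by rewrite -natrX ltr_nat expnS; move: kn; rewrite -!muln2; lia.
Qed.

(** Halving the angle replaces 1 / sin^2 by a quarter of the sum of its values at
    the two half angles, so the sum over the odd multiples is known exactly. *)
Lemma sum_inv_sin2 n :
  \sum_(0 <= k < 2 ^ n) (sin (odd_angle n k) ^+ 2)^-1 = 2 * 4 ^+ n :> R.
Proof.
have halve y : sin y != 0 -> cos y != 0 ->
    (sin y ^+ 2)^-1 + (cos y ^+ 2)^-1 = 4 * (sin (y *+ 2) ^+ 2)^-1 :> R.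
  move=> sy cy; rewrite sin_mulr2n -mulr_natr.
  rewrite [LHS](_ : _ = (sin y ^+ 2 + cos y ^+ 2) / (sin y * cos y) ^+ 2); last first.
    by field; rewrite sy cy.
  by rewrite addrC cos2Dsin2; field; rewrite sy cy.
elim: n => [|n IH].
  rewrite big_nat1 /odd_angle mul1r expr0 mulr1.
  have e4 : (pi / 4) *+ 2 = pi / 2 :> R by rewrite -mulr_natr; field.
  have := halve (pi / 4); rewrite e4 sin_pihalf.
  have s4 : sin (pi / 4) = cos (pi / 4) :> R.
    rewrite -cosBpihalf -cosN; congr cos; by field.
  have c4 : cos (pi / 4) != 0 :> R.
    by have := @pi_gt0 R => pi0; rewrite gt_eqF// cos_gt0_pihalf//; apply/andP; lra.
  rewrite s4 => /(_ c4 c4).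
  rewrite (_ : 2 ^+ 2 = 4 :> R) ?s4; last by ring.
  by lra.
rewrite expnS mul2n -addnn (@big_cat_nat _ _ _ (2 ^ n)%N)//= ?leq_addr//.
have -> : \sum_(2 ^ n <= k < 2 ^ n + 2 ^ n) (sin (odd_angle n.+1 k) ^+ 2)^-1 =
    \sum_(0 <= k < 2 ^ n) (cos (odd_angle n.+1 k) ^+ 2)^-1 :> R.
  rewrite -{1}[(2 ^ n)%N]add0n big_addn addnK big_nat_rev/= add0n.
  apply: eq_big_nat => k /andP[_ kn].
  congr ((_ ^+ 2)^-1); rewrite -cosBpihalf -cosN; congr cos.
  rewrite /odd_angle.
  have -> : (2 ^ n - k.+1 + 2 ^ n).*2.+1%:R = 2 ^+ n.+2 - k.*2.+1%:R :> R.
    apply: (canRL (addrK _)); rewrite -natrD -natrX; congr (_%:R).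
    by rewrite !expnS -!muln2; lia.
  by rewrite (exprS _ n.+2); field; rewrite expf_neq0.
rewrite -big_split/=.
transitivity (\sum_(0 <= k < 2 ^ n) 4 * (sin (odd_angle n k) ^+ 2)^-1 : R).
  apply: eq_big_nat => k /andP[_ kn].
  have /odd_angle_itv/andP[k0 k1] : (k < 2 ^ n.+1)%N.
    by rewrite (leq_trans kn)// leq_exp2l.
  have pi0 := @pi_gt0 R.
  rewrite halve.
  - congr (4 * (sin _ ^+ 2)^-1); rewrite /odd_angle -mulr_natr (exprS _ n.+2).
    by field; rewrite expf_neq0.
  - by rewrite gt_eqF// sin_gt0_pihalf// k0.
  - by rewrite gt_eqF// cos_gt0_pihalf// k1 andbT; lra.
by rewrite -mulr_sumr IH exprS; ring.
Qed.

(** Replacing 1 / sin ^ 2 by the inverse square of the angle costs at most 1 in each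
    of the 2 ^ n terms, against a total of 2 * 4 ^ n. *)
Lemma cvg_odd_inv_sqr :
  \sum_(0 <= k < 2 ^ n) (k.*2.+1%:R ^+ 2)^-1 @[n --> \oo] --> (pi ^+ 2 / 8 : R).
Proof.
have pi0 := @pi_gt0 R.
pose c n : R := pi ^+ 2 / (16 * 4 ^+ n).
have cE n : \sum_(0 <= k < 2 ^ n) (k.*2.+1%:R ^+ 2)^-1 =
    c n * \sum_(0 <= k < 2 ^ n) (odd_angle n k ^+ 2)^-1.
  rewrite mulr_sumr; apply: eq_bigr => k _; rewrite /odd_angle /c.
  rewrite (_ : 16 * 4 ^+ n = (2 ^+ n.+2) ^+ 2 :> R); last first.
    by rewrite -exprM mulnC exprM (_ : 2 ^+ 2 = 4 :> R) ?exprS; ring.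
  move: (gt_eqF pi0); move: (pi) => p p0.
  field; rewrite p0 expf_neq0//= addrC natr1//.
have c0 n : 0 <= c n by rewrite divr_ge0 ?exprn_ge0 ?mulr_ge0 ?exprn_ge0// ltW.
have c4 n : c n * 4 ^+ n = pi ^+ 2 / 16 by rewrite /c; field; rewrite expf_neq0.
have c2 n : c n * 2 ^+ n = pi ^+ 2 / 16 * 2^-1 ^+ n.
  by rewrite -(c4 n) -mulrA -exprMn; congr (_ * _ ^+ _); field.
apply: (@squeeze_cvgr _ _ _ _ (fun m => pi ^+ 2 / 8 - pi ^+ 2 / 16 * 2^-1 ^+ m)
    (fun=> pi ^+ 2 / 8)).
- apply: nearW => n; rewrite cE; apply/andP; split; last first.
    rewrite [leRHS](_ : _ = c n * (2 * 4 ^+ n)); last by rewrite mulrCA c4; field.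
    rewrite -sum_inv_sin2; apply: ler_wpM2l => //.
    apply: ler_sum_nat => k /andP[_ kn].
    by have /andP[] := inv_sqr_between (odd_angle_itv kn).
  rewrite [leLHS](_ : _ = c n * (2 * 4 ^+ n - 2 ^+ n)); last first.
    by rewrite mulrBr mulrCA c4 c2; field.
  rewrite -sum_inv_sin2; apply: ler_wpM2l => //.
  rewrite [X in _ - X](_ : _ = \sum_(0 <= k < 2 ^ n) 1); last first.
    by rewrite sumr_const_nat subn0 natrX.
  rewrite -sumrB; apply: ler_sum_nat => k /andP[_ kn].
  by have /andP[] := inv_sqr_between (odd_angle_itv kn).
- rewrite -[X in _ --> X]subr0; apply: cvgB; first exact: cvg_cst.
  rewrite -(mulr0 (pi ^+ 2 / 16)); apply: cvgMl_tmp.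
  by apply: cvg_expr; rewrite ger0_norm// invf_lt1// ltr1n.
- exact: cvg_cst.
Qed.

End Basel.

(** * Special values and boundary behaviour of the polylogarithms *)

Section LiBoundary.
Context {R : realType}.
Implicit Types (s n N : nat) (z : R).

Lemma cvg_Li s z : (2 <= s)%N -> `|z| <= 1 ->
  pseries (polylog_coef s) z @ \oo --> Li s z.
Proof. by move=> s2 z1; rewrite Li_pseries ?(ltnW s2)//; exact: cvg_pseries_polylog. Qed.

Lemma Li_tail_le s N z : (2 <= s)%N -> `|z| <= 1 ->
  `|Li s z - pseries (polylog_coef s) z N| <=
    Li s 1 - pseries (polylog_coef s) 1 N.
Proof.
move=> s2 z1.
have n1 : `|1 : R| <= 1 by rewrite normr1.
have cz : `|pseries (polylog_coef s) z n - pseries (polylog_coef s) z N| @[n --> \oo]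
    --> `|Li s z - pseries (polylog_coef s) z N|.
  by apply: cvg_norm; apply: cvgB; [exact: cvg_Li|exact: cvg_cst].
have c1 : pseries (polylog_coef s) (1 : R) n - pseries (polylog_coef s) 1 N @[n --> \oo]
    --> Li s (1 : R) - pseries (polylog_coef s) 1 N.
  by apply: cvgB; [exact: cvg_Li|exact: cvg_cst].
rewrite -(cvg_lim _ cz)// -(cvg_lim _ c1)//; apply: ler_lim.
- by apply/cvg_ex; eexists; exact: cz.
- by apply/cvg_ex; eexists; exact: c1.
near=> n.
have Nn : (N <= n)%N by near: n; exact: nbhs_infty_ge.
rewrite /pseries !sub_series_geq//; apply: (le_trans (ler_norm_sum _ _ _)).
apply: ler_sum => i _; rewrite /= expr1n mulr1 normrM normrX.
by rewrite ger0_norm ?polylog_coef_ge0// ler_piMr ?polylog_coef_ge0// exprn_ile1.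
Unshelve. all: by end_near. Qed.

(** Continuity on the closed interval, by uniform convergence. *)
Lemma cvg_Li_comp (T : Type) (F : set_system T) {FF : Filter F} (f : T -> R) s z :
  (2 <= s)%N -> `|z| <= 1 ->
  (\forall t \near F, `|f t| <= 1) -> f t @[t --> F] --> z ->
  Li s (f t) @[t --> F] --> Li s z.
Proof.
move=> s2 z1 f1 fz; apply/cvgrPdist_le => e e0.
have e3 : 0 < e / 3 by rewrite divr_gt0.
have n1 : `|1 : R| <= 1 by rewrite normr1.
have /cvgrPdist_le/(_ _ e3)[N _ tN] := cvg_Li s2 n1.
have tail : Li s 1 - pseries (polylog_coef s) 1 N <= e / 3 :> R.
  exact: le_trans (ler_norm _) (tN N (leqnn _)).
have cS : pseries (polylog_coef s) (f t) N @[t --> F] --> pseries (polylog_coef s) z N.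
  have hd : is_derive z (1 : R) (fun t => \sum_(0 <= n < N) polylog_coef s n * t ^+ n)
      (\sum_(0 <= n < N) polylog_coef s n * (n%:R * z ^+ n.-1)).
    by apply: der_sum => n _; derive; ring.
  exact: continuous_cvg (der_continuous hd) fz.
have /cvgrPdist_le/(_ _ e3) cS' := cS.
near=> t.
have h1 := le_trans (Li_tail_le N s2 z1) tail.
have ft1 : `|f t| <= 1 by near: t.
have h2 := le_trans (Li_tail_le N s2 ft1) tail.
have h3 : `|pseries (polylog_coef s) z N - pseries (polylog_coef s) (f t) N| <= e / 3.
  by near: t.
move: h1 h2 h3; rewrite !ler_norml => /andP[? ?] /andP[? ?] /andP[? ?].
by apply/andP; lra.
Unshelve. all: by end_near. Qed.

Lemma cvg_doublen : n.*2 @[n --> \oo] --> \oo.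
Proof.
under eq_fun do rewrite -muln2.
exact: cvg_mulnr.
Qed.

Lemma Li_duplication s z : (2 <= s)%N -> `|z| <= 1 ->
  Li s z + Li s (- z) = 2 / 2 ^+ s * Li s (z ^+ 2).
Proof.
move=> s2 z1.
have z2 : `|z ^+ 2| <= 1 by rewrite normrX exprn_ile1.
have zN : `|- z| <= 1 by rewrite normrN.
have cL : pseries (polylog_coef s) z n.*2 + pseries (polylog_coef s) (- z) n.*2
    @[n --> \oo] --> Li s z + Li s (- z).
  by apply: cvgD; apply: (cvg_comp _ _ cvg_doublen); exact: cvg_Li.
have cR : 2 / 2 ^+ s * pseries (polylog_coef s) (z ^+ 2) n
    @[n --> \oo] --> 2 / 2 ^+ s * Li s (z ^+ 2).
  by apply: cvgMl_tmp; exact: cvg_Li.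
apply: (cvg_unique _ cL); first exact: Rhausdorff.
apply: cvg_trans cR; apply: near_eq_cvg; apply: nearW => n.
rewrite /pseries /series/=; elim: n => [|n IH]; first by rewrite !big_geq// mulr0 addr0.
have zn : z ^+ n.*2 = (z ^+ 2) ^+ n by rewrite -mul2n exprM.
have zn' : (- z) ^+ n.*2 = (z ^+ 2) ^+ n by rewrite -mul2n exprM sqrrN.
have cn : polylog_coef s n.*2 = polylog_coef s n / 2 ^+ s :> R.
  by rewrite /polylog_coef -mul2n natrM exprMn invfM mulrC.
rewrite doubleS !big_nat_recr//= mulrDr IH (exprS z n.*2) (exprS (- z) n.*2) zn zn' cn.
by ring.
Qed.

(** The odd terms make up half of Li 2 1 - Li 2 (- 1), and duplication at 1 gives
    Li 2 (- 1) = - Li 2 1 / 2. *)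
Lemma Li2_1 : Li 2 (1 : R) = pi ^+ 2 / 6.
Proof.
have n1 : `|1 : R| <= 1 by rewrite normr1.
have nN1 : `|- 1 : R| <= 1 by rewrite normrN1.
have c1 : pseries (polylog_coef 2) (1 : R) n.*2 - pseries (polylog_coef 2) (- 1) n.*2
    @[n --> \oo] --> Li 2 (1 : R) - Li 2 (- 1 : R).
  by apply: cvgB; apply: (cvg_comp _ _ cvg_doublen); exact: cvg_Li.
have odd_sum n : pseries (polylog_coef 2) (1 : R) n.*2 - pseries (polylog_coef 2) (- 1) n.*2 =
    2 * \sum_(0 <= k < n) (k.*2.+1%:R ^+ 2)^-1.
  rewrite /pseries /series/=; elim: n => [|n IH].
    by rewrite !big_geq// subr0 mulr0.
  rewrite doubleS !big_nat_recr//= mulrDr -IH /polylog_coef.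
  have e1 : (-1 : R) ^+ n.*2 = 1 by rewrite -signr_odd odd_double.
  have e2 : (-1 : R) ^+ n.*2.+1 = -1 by rewrite -signr_odd /= odd_double.
  by rewrite e1 e2 !expr1n; ring.
have pow2 : (2 ^ n)%N @[n --> \oo] --> \oo.
  apply/cvgnyPge => A; exists A => // n /= An.
  by rewrite (leq_trans An)// ltnW// ltn_expl.
have c2 := cvg_comp _ _ pow2 c1.
have c3 : 2 * \sum_(0 <= k < 2 ^ n) (k.*2.+1%:R ^+ 2)^-1 @[n --> \oo]
    --> 2 * (pi ^+ 2 / 8 : R) by apply: cvgMl_tmp; exact: cvg_odd_inv_sqr.
have : Li 2 (1 : R) - Li 2 (- 1 : R) = 2 * (pi ^+ 2 / 8).
  apply: (cvg_unique _ c2); first exact: Rhausdorff.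
  by rewrite (_ : _ \o _ = fun n => 2 * \sum_(0 <= k < 2 ^ n) (k.*2.+1%:R ^+ 2)^-1)//;
    apply/funext => n /=; rewrite odd_sum.
have := @Li_duplication 2 1 isT n1; rewrite expr1n.
by lra.
Qed.

End LiBoundary.

(** * Logarithmic limits at zero *)

Section LogLimits.
Context {R : realType}.
Implicit Types (t : R) (f g : R -> R).

Lemma cvg_at_right_continuous f (a : R) : {for a, continuous f} ->
  f t @[t --> a^'+] --> f a.
Proof. by move=> cf; apply: cvg_at_right_filter. Qed.

Lemma cvg_at_left_continuous f (a : R) : {for a, continuous f} ->
  f t @[t --> a^'-] --> f a.
Proof. by move=> cf; apply: cvg_at_left_filter. Qed.

Lemma cvg_to_at_right (T : Type) (F : set_system T) {FF : Filter F} (g : T -> R) (a : R) :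
  g t @[t --> F] --> a -> (\forall t \near F, a < g t) -> g t @[t --> F] --> a^'+.
Proof.
move=> ga gt_a A /ga gA; rewrite /nbhs/=.
by apply: filterS2 gt_a gA => t h; apply.
Qed.

Lemma cvg_sqrt_at_right0 : Num.sqrt t @[t --> (0 : R)^'+] --> (0 : R)^'+.
Proof.
apply: cvg_to_at_right.
  have := @cvg_at_right_continuous Num.sqrt 0; rewrite sqrtr0; apply.
  exact: sqrt_continuous.
near=> t; rewrite sqrtr_gt0; near: t; exact: nbhs_right_gt.
Unshelve. all: by end_near. Qed.

(** Substituting the square root of [t] halves the power of the logarithm to be
    absorbed. *)
Lemma cvg_lnX_mul_id n : ln t ^+ n * t @[t --> (0 : R)^'+] --> (0 : R).
Proof.
have lnE t : 0 < t -> ln t = 2 * ln (Num.sqrt t).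
  move=> t0; rewrite -[in LHS](sqr_sqrtr (ltW t0)) lnXn ?sqrtr_gt0//.
  by rewrite mulr_natl.
have cs : Num.sqrt t @[t --> (0 : R)^'+] --> (0 : R).
  apply: cvg_trans cvg_sqrt_at_right0 _; exact: cvg_within.
have base : ln t * t @[t --> (0 : R)^'+] --> (0 : R).
  apply: (@squeeze_cvgr _ _ _ _ (fun t => - (2 * Num.sqrt t)) (fun=> 0)).
  - near=> t.
    have t0 : 0 < t by near: t; exact: nbhs_right_gt.
    have t1 : t <= 1 by near: t; exact: nbhs_right_le.
    have s0 : 0 < Num.sqrt t by rewrite sqrtr_gt0.
    apply/andP; split; last by rewrite mulr_le0_ge0 ?ln_le0 ?ltW.
    have : ln (Num.sqrt t)^-1 < (Num.sqrt t)^-1 by apply: ln_sublinear; rewrite invr_gt0.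
    rewrite lnV ?posrE// => /ltW h.
    rewrite (lnE _ t0) -{3}(sqr_sqrtr (ltW t0)).
    have : - ln (Num.sqrt t) * Num.sqrt t <= 1.
      by rewrite -(mulVf (lt0r_neq0 s0)) ler_pM2r.
    by move: s0; nra.
  - rewrite -[X in _ --> X]oppr0; apply: cvgN.
    by rewrite -[X in _ --> X](mulr0 2); apply: cvgMl_tmp.
  - exact: cvg_cst.
elim: n => [|n IH].
  under eq_fun do rewrite expr0 mul1r.
  exact: cvg_at_right_filter.
have : 2 ^+ n.+1 * ((ln (Num.sqrt t) ^+ n * Num.sqrt t) * (ln (Num.sqrt t) * Num.sqrt t))
    @[t --> (0 : R)^'+] --> 2 ^+ n.+1 * (0 * 0 : R).
  apply: cvgMl_tmp; apply: cvgM.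
    exact: (cvg_comp _ _ cvg_sqrt_at_right0 IH).
  exact: (cvg_comp _ _ cvg_sqrt_at_right0 base).
rewrite !mulr0; apply: cvg_trans; apply: near_eq_cvg; near=> t.
have t0 : 0 < t by near: t; exact: nbhs_right_gt.
rewrite /= (lnE _ t0); move: (ln (Num.sqrt t)) (sqr_sqrtr (ltW t0)) => L; move: (Num.sqrt t) => s <-.
by rewrite exprMn (exprS L n); ring.
Unshelve. all: by end_near. Qed.

(** Near 0 the quotient g t / t is bounded. *)
Lemma cvg_lnX_mul n (g : R -> R) (d : R) :
  is_derive (0 : R) (1 : R) g d -> g 0 = 0 ->
  ln t ^+ n * g t @[t --> (0 : R)^'+] --> (0 : R).
Proof.
move=> [gd gdE] g0.
have cg : g t / t @[t --> (0 : R)^'+] --> d.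
  apply: cvg_dnbhs_at_right; rewrite -gdE.
  have /cvg_ex[l cl] := gd.
  rewrite /derive (cvg_lim _ cl)//; move: cl; apply: cvg_trans.
  apply: near_eq_cvg; near=> t.
  by rewrite /GRing.scale/= mulr1 addr0 g0 subr0 mulrC.
have : ln t ^+ n * t * (g t / t) @[t --> (0 : R)^'+] --> 0 * d.
  by apply: cvgM cg; exact: cvg_lnX_mul_id.
rewrite mul0r; apply: cvg_trans.
apply: near_eq_cvg; near=> t.
have t0 : t != 0 by rewrite gt_eqF//; near: t; exact: nbhs_right_gt.
by rewrite /=; field.
Unshelve. all: by end_near. Qed.

End LogLimits.

(** * The dilogarithm and the trilogarithm *)

Section LiDerivatives.
Context {R : realType}.
Implicit Types (f : R -> R) (x t u : R).

Lemma der_Li2 f x a : f x != 0 -> `|f x| < 1 -> is_derive x (1 : R) f a ->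
  is_derive x (1 : R) (fun t => Li 2 (f t)) (- ln (1 - f x) / f x * a).
Proof.
move=> f0 f1 fa; rewrite -(Li1E f1).
by apply: (@der_comp R (Li 2) f); exact: derive_Li.
Qed.

Lemma der_Li3 f x a : f x != 0 -> `|f x| < 1 -> is_derive x (1 : R) f a ->
  is_derive x (1 : R) (fun t => Li 3 (f t)) (Li 2 (f x) / f x * a).
Proof.
by move=> f0 f1 fa; apply: (@der_comp R (Li 3) f); exact: derive_Li.
Qed.

End LiDerivatives.

Ltac der_special rec ::=
  lazymatch goal with
  | |- is_derive _ _ (fun t => Li 2 (@?f t)) _ => eapply (@der_Li2 _ f); [| |rec]
  | |- is_derive _ _ (fun t => Li 3 (@?f t)) _ => eapply (@der_Li3 _ f); [| |rec]
  end.

Section Reflection.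
Context {R : realType}.
Implicit Types (x z u : R).

Lemma derivable_Li0 s : (0 < s)%N -> exists d : R, is_derive (0 : R) (1 : R) (Li s) d.
Proof.
by move=> s0; eexists; apply: derive_pseries_polylog; rewrite ?normr0.
Qed.

Lemma norm_lt1 z : 0 < z < 1 -> `|z| < 1.
Proof. by move=> /andP[z0 z1]; rewrite ger0_norm// ltW. Qed.

(** The derivatives cancel by the product rule; the constant is the limit at 0. *)
Lemma Li2_reflection z : 0 < z < 1 ->
  Li 2 z + Li 2 (1 - z) = pi ^+ 2 / 6 - ln z * ln (1 - z).
Proof.
move=> z01.
apply: (@eq_from_derive_lim R `]0, 1[ (0 : R)^'+
  (fun z => Li 2 z + Li 2 (1 - z)) (fun z => pi ^+ 2 / 6 - ln z * ln (1 - z))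
  (fun z => ln z / (1 - z) - ln (1 - z) / z)); last by rewrite in_itv.
- by near=> t; rewrite /= in_itv/=; apply/andP; split=> //; near: t; apply: nbhs_right_lt.
- move=> t; rewrite in_itv/= => /andP[t0 t1].
  have t1' : 0 < 1 - t by rewrite subr_gt0.
  derive.
  + by rewrite gt_eqF.
  + by rewrite norm_lt1// t0.
  + by rewrite gt_eqF.
  + by rewrite norm_lt1// t1'/=; lra.
  + rewrite subKr; field; rewrite !gt_eqF//.
- move=> t; rewrite in_itv/= => /andP[t0 t1].
  have t1' : 0 < 1 - t by rewrite subr_gt0.
  derive => //; field; rewrite !gt_eqF//.
- have c1 : Li 2 t @[t --> (0 : R)^'+] --> Li 2 (0 : R).
    have [d hd] := @derivable_Li0 2 isT.
    exact: cvg_at_right_continuous (der_continuous hd).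
  have c2 : Li 2 (1 - t) @[t --> (0 : R)^'+] --> Li 2 (1 : R).
    apply: cvg_Li_comp => //; first by rewrite normr1.
      near=> t; rewrite ler_norml; apply/andP; split.
        have : t <= 1 by near: t; exact: nbhs_right_le.
        lra.
      have : 0 < t by near: t; exact: nbhs_right_gt.
      lra.
    have h : is_derive (0 : R) (1 : R) (fun t : R => 1 - t) (0 - 1) by derive.
    have := cvg_at_right_continuous (der_continuous h); by rewrite subr0.
  have c3 : ln t ^+ 1 * ln (1 - t) @[t --> (0 : R)^'+] --> (0 : R).
    apply: (@cvg_lnX_mul R 1 (fun t => ln (1 - t)) ((0 - 1) / (1 - 0))).
      by derive => //=; rewrite subr0.
    by rewrite subr0 ln1.
  have : Li 2 t + Li 2 (1 - t) - (pi ^+ 2 / 6 - ln t ^+ 1 * ln (1 - t))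
      @[t --> (0 : R)^'+] --> Li 2 (0 : R) + Li 2 (1 : R) - (pi ^+ 2 / 6 - 0).
    by apply: cvgB; [exact: cvgD|apply: cvgB c3; exact: cvg_cst].
  by rewrite Li0// Li2_1 add0r subr0 subrr.
Unshelve. all: by end_near. Qed.

(** The continuation of Li 2 (- 1 / x) to all x > 0: the series diverges for x < 1,
    but Landen's transformation z -> z / (z - 1) sends - 1 / x to 1 / (1 + x). *)
Definition Li2inv x : R := - Li 2 (1 + x)^-1 - (ln (1 + x) - ln x) ^+ 2 / 2.

(** The continuation of Li 3 (- 1 / x), by Landen's relation, which for the
    trilogarithm has three terms. *)
Definition Li3inv x : R :=
  zeta R 3 + (ln x - ln (1 + x)) ^+ 3 / 6 + pi ^+ 2 / 6 * (ln x - ln (1 + x))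
  + (ln x - ln (1 + x)) ^+ 2 * ln (1 + x) / 2
  - Li 3 (x / (1 + x)) - Li 3 (1 + x)^-1.

Lemma derive_Li2inv x : 0 < x ->
  is_derive x (1 : R) Li2inv ((ln (1 + x) - ln x) / x).
Proof.
move=> x0; have x1 : 0 < 1 + x by rewrite addr_gt0.
rewrite /Li2inv; derive => //.
- by rewrite invr_neq0// gt_eqF.
- by rewrite norm_lt1// invr_gt0 x1/= invf_lt1//; lra.
- by rewrite gt_eqF.
have -> : 1 - (1 + x)^-1 = x / (1 + x) by field; rewrite gt_eqF.
rewrite ln_div ?posrE//.
by field; rewrite !gt_eqF.
Qed.

(** The reflection formula trades one of the two dilogarithms for the other. *)
Lemma derive_Li3inv x : 0 < x ->
  is_derive x (1 : R) Li3inv (- Li2inv x / x).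
Proof.
move=> x0; have x1 : 0 < 1 + x by rewrite addr_gt0.
have z01 : 0 < x / (1 + x) < 1.
  by rewrite divr_gt0//= ltr_pdivrMr// mul1r; lra.
have z01' : 0 < (1 + x)^-1 < 1 by rewrite invr_gt0 x1/= invf_lt1//; lra.
have refl := Li2_reflection z01'.
rewrite (_ : 1 - (1 + x)^-1 = x / (1 + x)) in refl; last by field; rewrite gt_eqF.
rewrite lnV ?posrE// ln_div ?posrE// in refl.
rewrite /Li3inv; derive => //; rewrite ?gt_eqF//.
- by case/andP: z01.
- exact: norm_lt1.
- by case/andP: z01'.
- exact: norm_lt1.
rewrite /Li2inv.
have {}refl : Li 2 (x / (1 + x)) =
  pi ^+ 2 / 6 - - ln (1 + x) * (ln x - ln (1 + x)) - Li 2 (1 + x)^-1.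
  by rewrite -refl addrAC subrr add0r.
rewrite refl /=; move: (pi) (Li 2 _) => p L.
by field; rewrite !gt_eqF.
Qed.

End Reflection.

Section LiInverse.
Context {R : realType}.
Implicit Types (f g : R -> R) (x y t u : R).

Lemma Li3_1 : Li 3 1 = zeta R 3.
Proof.
rewrite /Li /zeta; congr (limn _); apply/funext => N.
by apply: eq_bigr => n _; rewrite expr1n div1r.
Qed.

(** The series still converges at 1, but is not differentiable there. *)
Lemma eq_at1 f g : (forall y, 0 < y < 1 -> f y = g y) ->
  f y @[y --> (1 : R)^'-] --> f 1 -> g y @[y --> (1 : R)^'-] --> g 1 ->
  forall y, 0 < y <= 1 -> f y = g y.
Proof.
move=> fg cf cg y /andP[y0]; rewrite le_eqVlt => /predU1P[->|y1]; last first.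
  by apply: fg; rewrite y0.
apply: (cvg_unique _ cf); first exact: Rhausdorff.
apply: cvg_trans cg; apply: near_eq_cvg; near=> t.
by apply/esym/fg/andP; split; near: t; [exact: nbhs_left_gt|exact: nbhs_left_lt].
Unshelve. all: by end_near. Qed.

Lemma cvg_LiN_at_left1 s : (2 <= s)%N ->
  Li s (- y) @[y --> (1 : R)^'-] --> Li s (- 1 : R).
Proof.
move=> s2; apply: cvg_Li_comp => //; first by rewrite normrN1.
  near=> t; rewrite normrN ger0_norm.
    by near: t; exact: nbhs_left_le.
  by near: t; apply: nbhs_left_ge.
by apply: cvgN; exact: cvg_at_left_filter.
Unshelve. all: by end_near. Qed.

Lemma cvg_LiN_at_right0 s : (2 <= s)%N ->
  Li s (- y) @[y --> (0 : R)^'+] --> (0 : R).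
Proof.
move=> s2; suff : Li s (- y) @[y --> (0 : R)^'+] --> Li s (0 : R).
  by rewrite Li0// ltnW.
apply: cvg_Li_comp => //; first by rewrite normr0.
  near=> t; rewrite normrN ger0_norm.
    by near: t; exact: nbhs_right_le ltr01.
  by near: t; exact: nbhs_right_ge.
by rewrite -[X in _ --> X]oppr0; apply: cvgN; exact: cvg_at_right_filter.
Unshelve. all: by end_near. Qed.

Lemma cvg_ln1D_at_right0 : ln (1 + t) @[t --> (0 : R)^'+] --> (0 : R).
Proof.
have h : is_derive (0 : R) (1 : R) (fun t : R => ln (1 + t)) ((0 + 1) / (1 + 0)).
  by derive => //=; rewrite addr0.
have := cvg_at_right_continuous (der_continuous h).
by rewrite addr0 ln1.
Qed.

Lemma cvg_Li_div1D_at_right0 s : (2 <= s)%N ->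
  Li s (t / (1 + t)) @[t --> (0 : R)^'+] --> Li s (0 : R).
Proof.
move=> s2; apply: cvg_Li_comp => //; first by rewrite normr0.
  near=> t.
  have t0 : 0 < t by near: t; exact: nbhs_right_gt.
  by rewrite ger0_norm ?divr_ge0 ?addr_ge0 ?ler_pdivrMr ?mul1r ?ler_wpDl ?addr_gt0// ltW.
have h : is_derive (0 : R) (1 : R) (fun t : R => t / (1 + t))
    (0 * (- (0 + 1) / (1 + 0) ^+ 2) + 1 / (1 + 0)).
  by derive => //=; rewrite addr0 oner_neq0.
have := cvg_at_right_continuous (der_continuous h).
by rewrite mul0r.
Unshelve. all: by end_near. Qed.

Lemma cvg_Li_inv1D_at_right0 s : (2 <= s)%N ->
  Li s (1 + t)^-1 @[t --> (0 : R)^'+] --> Li s (1 : R).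
Proof.
move=> s2; apply: cvg_Li_comp => //; first by rewrite normr1.
  near=> t.
  have t0 : 0 < t by near: t; exact: nbhs_right_gt.
  by rewrite ger0_norm ?invr_ge0 ?addr_ge0 ?invf_le1 ?addr_gt0 ?ler_wpDr// ltW.
have h : is_derive (0 : R) (1 : R) (fun t : R => (1 + t)^-1) (- (0 + 1) / (1 + 0) ^+ 2).
  by derive => //=; rewrite addr0 oner_neq0.
have := cvg_at_right_continuous (der_continuous h).
by rewrite addr0 invr1.
Unshelve. all: by end_near. Qed.

Lemma inv1D y : 0 < y -> (1 + y^-1)^-1 = y / (1 + y).
Proof. by move=> y0; field; rewrite !gt_eqF// addr_gt0. Qed.

Lemma ln1DV y : 0 < y -> ln (1 + y^-1) - ln y^-1 = ln (1 + y).
Proof.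
move=> y0; have y1 : 0 < 1 + y by rewrite addr_gt0.
rewrite (_ : 1 + y^-1 = (1 + y) / y); last by field; rewrite gt_eqF.
by rewrite ln_div ?posrE// lnV ?posrE// opprK subrK.
Qed.

Lemma derive_LiN2 y : 0 < y < 1 ->
  is_derive y (1 : R) (fun t => Li 2 (- t)) (- ln (1 + y) / y).
Proof.
move=> /andP[y0 y1]; derive.
- by rewrite oppr_eq0 gt_eqF.
- by rewrite normrN norm_lt1// y0 y1.
by rewrite opprK; field; rewrite gt_eqF.
Qed.

Lemma Li2invE y : 0 < y <= 1 -> Li2inv y^-1 = Li 2 (- y).
Proof.
apply: (@eq_at1 (fun y => Li2inv y^-1) (fun y => Li 2 (- y))); last exact: cvg_LiN_at_left1; last first.
  have h : is_derive (1 : R)^-1 (1 : R) Li2inv ((ln (1 + 1^-1) - ln 1^-1) / 1^-1).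
    by apply: derive_Li2inv; rewrite invr1.
  have {}h : is_derive (1 : R) (1 : R) (fun y => Li2inv y^-1)
      ((ln (1 + 1^-1) - ln 1^-1) / 1^-1 * (- 1 / 1 ^+ 2)).
    by derive => //; rewrite oner_neq0.
  exact: cvg_at_left_continuous (der_continuous h).
move=> {}y y01; apply: (@eq_from_derive_lim R `]0, 1[ (0 : R)^'+
  (fun y => Li2inv y^-1) (fun y => Li 2 (- y))
  (fun y => - ln (1 + y) / y)); last by rewrite in_itv.
- by near=> t; rewrite /= in_itv/=; apply/andP; split=> //; near: t; apply: nbhs_right_lt.
- move=> t; rewrite in_itv/= => /andP[t0 t1].
  have tV : 0 < t^-1 by rewrite invr_gt0.
  have h := derive_Li2inv tV.
  derive; first by rewrite gt_eqF.
  by rewrite ln1DV//; field; rewrite gt_eqF.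
- by move=> t; rewrite in_itv/= => t01; exact: derive_LiN2.
rewrite -[X in _ --> X](subr0 0); apply: cvgB; last exact: cvg_LiN_at_right0.
have cln : ln (1 + t) @[t --> (0 : R)^'+] --> (0 : R) by exact: cvg_ln1D_at_right0.
have : - Li 2 (t / (1 + t)) - ln (1 + t) ^+ 2 / 2 @[t --> (0 : R)^'+]
    --> - Li 2 (0 : R) - 0 ^+ 2 / 2.
  apply: cvgB; first by apply: cvgN; exact: cvg_Li_div1D_at_right0.
  by apply: cvgMr_tmp; exact: continuous_cvg (@exprn_continuous R 2 _) cln.
rewrite Li0// expr0n/= mul0r subr0 oppr0; apply: cvg_trans.
apply: near_eq_cvg; near=> t.
have t0 : 0 < t by near: t; exact: nbhs_right_gt.
by rewrite /Li2inv ln1DV// inv1D.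
Unshelve. all: by end_near. Qed.

Lemma derive_LiN3 y : 0 < y < 1 ->
  is_derive y (1 : R) (fun t => Li 3 (- t)) (Li 2 (- y) / y).
Proof.
move=> /andP[y0 y1]; derive.
- by rewrite oppr_eq0 gt_eqF.
- by rewrite normrN norm_lt1// y0 y1.
by move: (Li 2 _) => L; field; rewrite gt_eqF.
Qed.

(** By definition [Li3inv] satisfies the three-term relation of Landen between
    z, 1 - z and 1 - 1 / z; this identifies it with the series. *)
Lemma Li3invE y : 0 < y <= 1 -> Li3inv y^-1 = Li 3 (- y).
Proof.
apply: (@eq_at1 (fun y => Li3inv y^-1) (fun y => Li 3 (- y))); last exact: cvg_LiN_at_left1; last first.
  have h : is_derive (1 : R)^-1 (1 : R) Li3inv (- Li2inv 1^-1 / 1^-1).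
    by apply: derive_Li3inv; rewrite invr1.
  have {}h : is_derive (1 : R) (1 : R) (fun y => Li3inv y^-1)
      (- Li2inv 1^-1 / 1^-1 * (- 1 / 1 ^+ 2)).
    by derive => //; rewrite oner_neq0.
  exact: cvg_at_left_continuous (der_continuous h).
move=> {}y y01; apply: (@eq_from_derive_lim R `]0, 1[ (0 : R)^'+
  (fun y => Li3inv y^-1) (fun y => Li 3 (- y))
  (fun y => Li 2 (- y) / y)); last by rewrite in_itv.
- by near=> t; rewrite /= in_itv/=; apply/andP; split=> //; near: t; apply: nbhs_right_lt.
- move=> t; rewrite in_itv/= => /andP[t0 t1].
  have tV : 0 < t^-1 by rewrite invr_gt0.
  have h := derive_Li3inv tV.
  derive; first by rewrite gt_eqF.
  rewrite Li2invE ?t0 ?ltW//; move: (Li 2 _) => L; by field; rewrite gt_eqF.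
- by move=> t; rewrite in_itv/= => t01; exact: derive_LiN3.
rewrite -[X in _ --> X](subr0 0); apply: cvgB; last exact: cvg_LiN_at_right0.
have cln : ln (1 + t) @[t --> (0 : R)^'+] --> (0 : R) by exact: cvg_ln1D_at_right0.
have cln2 : ln t ^+ 1 * ln (1 + t) @[t --> (0 : R)^'+] --> (0 : R).
  apply: (@cvg_lnX_mul R 1 (fun t => ln (1 + t)) ((0 + 1) / (1 + 0))).
    by derive => //=; rewrite addr0.
  by rewrite addr0 ln1.
have : zeta R 3 + (- ln (1 + t)) ^+ 3 / 6 + pi ^+ 2 / 6 * (- ln (1 + t))
    + (ln (1 + t) * ln (1 + t) * ln (1 + t) - ln (1 + t) * (ln t ^+ 1 * ln (1 + t))) / 2
    - Li 3 (1 + t)^-1 - Li 3 (t / (1 + t)) @[t --> (0 : R)^'+]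
    --> zeta R 3 + (- 0) ^+ 3 / 6 + pi ^+ 2 / 6 * (- 0)
    + (0 * 0 * 0 - 0 * 0) / 2 - Li 3 1 - Li 3 (0 : R).
  apply: cvgB; last exact: cvg_Li_div1D_at_right0.
  apply: cvgB; last exact: cvg_Li_inv1D_at_right0.
  apply: cvgD; last first.
    by apply: cvgMr_tmp; apply: cvgB; apply: cvgM => //; exact: cvgM.
  apply: cvgD; last by apply: cvgMl_tmp; exact: cvgN.
  apply: cvgD; first exact: cvg_cst.
  by apply: cvgMr_tmp; apply: continuous_cvg (@exprn_continuous R 3 _) _; exact: cvgN.
rewrite Li0// Li3_1.
have -> : zeta R 3 + (- 0) ^+ 3 / 6 + pi ^+ 2 / 6 * (- 0)
    + (0 * 0 * 0 - 0 * 0) / 2 - zeta R 3 - 0 = 0.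
  by move: (pi) (zeta R 3) => p q; ring.
apply: cvg_trans; apply: near_eq_cvg; near=> t.
have t0 : 0 < t by near: t; exact: nbhs_right_gt.
have t1 : 0 < 1 + t by rewrite addr_gt0.
rewrite /Li3inv inv1D//.
have -> : t^-1 * (t / (1 + t)) = (1 + t)^-1 by field; rewrite !gt_eqF// addr_gt0.
have -> : ln (1 + t^-1) = ln (1 + t) - ln t by rewrite -(ln1DV t0) lnV ?posrE// opprK addrK.
rewrite lnV ?posrE// expr1.
move: (pi) (zeta R 3) (Li 3 _) (Li 3 _) => p q L M; by field.
Unshelve. all: by end_near. Qed.

End LiInverse.

(** * A three-term family of trilogarithm relations *)

Section KummerRelation.
Context {R : realType}.
Implicit Types (u t : R).

Lemma kummer_args u : 0 < u < 1 ->
  [/\ 0 < 4 * u / (1 + u) ^+ 2 < 1, 0 < 2 * u / (1 + u) < 1 & 0 < (1 + u) / 2 < 1].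
Proof.
move=> /andP[u0 u1]; have v0 : 0 < 1 + u by rewrite addr_gt0.
have v2 : 0 < (1 + u) ^+ 2 by rewrite exprn_gt0.
split; apply/andP; split; try by rewrite !(divr_gt0, mulr_gt0).
- by rewrite ltr_pdivrMr// mul1r; nra.
- by rewrite ltr_pdivrMr// mul1r; lra.
- lra.
Qed.

Lemma ln_kummer1 u : 0 < u < 1 ->
  ln (1 - 4 * u / (1 + u) ^+ 2) = 2 * (ln (1 - u) - ln (1 + u)).
Proof.
move=> /andP[u0 u1]; have v0 : 0 < 1 + u by rewrite addr_gt0.
have w0 : 0 < 1 - u by rewrite subr_gt0.
have -> : 1 - 4 * u / (1 + u) ^+ 2 = ((1 - u) / (1 + u)) ^+ 2.
  by field; rewrite gt_eqF.
by rewrite lnXn ?divr_gt0// ln_div ?posrE// mulr_natl.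
Qed.

Lemma ln_kummer2 u : 0 < u < 1 ->
  ln (1 - 2 * u / (1 + u)) = ln (1 - u) - ln (1 + u).
Proof.
move=> /andP[u0 u1]; have v0 : 0 < 1 + u by rewrite addr_gt0.
have w0 : 0 < 1 - u by rewrite subr_gt0.
have -> : 1 - 2 * u / (1 + u) = (1 - u) / (1 + u) by field; rewrite gt_eqF.
by rewrite ln_div ?posrE.
Qed.

Lemma ln_kummer3 u : 0 < u < 1 -> ln (1 - (1 + u) / 2) = ln (1 - u) - ln 2.
Proof.
move=> /andP[u0 u1]; have w0 : 0 < 1 - u by rewrite subr_gt0.
have -> : 1 - (1 + u) / 2 = (1 - u) / 2 by field.
by rewrite ln_div ?posrE.
Qed.

Lemma cvg_Li_right (f : R -> R) (s : nat) d : (2 <= s)%N ->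
  is_derive (0 : R) (1 : R) f d -> f 0 = 0 -> (forall u, 0 < u < 1 -> `|f u| < 1) ->
  Li s (f u) @[u --> (0 : R)^'+] --> (0 : R).
Proof.
move=> s2 fd f0 f1; suff : Li s (f u) @[u --> (0 : R)^'+] --> Li s (f 0).
  by rewrite f0 Li0// ltnW.
apply: cvg_Li_comp => //; first by rewrite f0 normr0.
  near=> t; rewrite ltW// f1//; apply/andP; split; near: t.
    exact: nbhs_right_gt.
  exact: nbhs_right_lt.
exact: cvg_at_right_continuous (der_continuous fd).
Unshelve. all: by end_near. Qed.

Lemma cvg_Li_left (f : R -> R) (s : nat) d : (2 <= s)%N ->
  is_derive (1 : R) (1 : R) f d -> `|f 1| <= 1 -> (forall u, 0 < u < 1 -> `|f u| < 1) ->
  Li s (f u) @[u --> (1 : R)^'-] --> Li s (f 1).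
Proof.
move=> s2 fd f11 f1; apply: cvg_Li_comp => //.
  near=> t; rewrite ltW// f1//; apply/andP; split; near: t.
    exact: nbhs_left_gt.
  exact: nbhs_left_lt.
exact: cvg_at_left_continuous (der_continuous fd).
Unshelve. all: by end_near. Qed.

Lemma kummer_Li2_left u : 0 < u < 1 ->
  Li 2 (4 * u / (1 + u) ^+ 2) + 2 * Li 2 u - 2 * Li 2 (- u)
    - 4 * Li 2 (2 * u / (1 + u)) = 0.
Proof.
move=> u01; apply: (@eq_from_derive_lim R `]0, 1[ (0 : R)^'+
  (fun u => Li 2 (4 * u / (1 + u) ^+ 2) + 2 * Li 2 u - 2 * Li 2 (- u)
    - 4 * Li 2 (2 * u / (1 + u))) (fun=> 0) (fun=> 0)); last by rewrite in_itv.
- by near=> t; rewrite /= in_itv/=; apply/andP; split=> //; near: t; apply: nbhs_right_lt.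
- move=> t; rewrite in_itv/= => t01; have [h1 h2 h3] := kummer_args t01.
  have /andP[t0 t1] := t01; have v0 : 0 < 1 + t by rewrite addr_gt0.
  derive.
  + by case/andP: h1 => ? _; rewrite gt_eqF.
  + exact: norm_lt1.
  + by rewrite expf_neq0// gt_eqF.
  + by rewrite gt_eqF.
  + exact: norm_lt1.
  + by rewrite oppr_eq0 gt_eqF.
  + by rewrite normrN norm_lt1.
  + by case/andP: h2 => ? _; rewrite gt_eqF.
  + exact: norm_lt1.
  + by rewrite gt_eqF.
  rewrite ln_kummer1// ln_kummer2// opprK.
  by field; rewrite !gt_eqF.
have z1 : (1 + 0 : R) != 0 by rewrite addr0 oner_neq0.
have c1 : Li 2 (4 * u / (1 + u) ^+ 2) @[u --> (0 : R)^'+] --> (0 : R).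
  have [d hd] : exists d : R, is_derive (0 : R) (1 : R) (fun u => 4 * u / (1 + u) ^+ 2) d.
    by eexists; der_rules; rewrite ?expf_neq0.
  apply: (@cvg_Li_right _ _ _ _ hd) => //.
  + by rewrite mulr0 mul0r.
  + by move=> t /kummer_args[/norm_lt1].
have c2 : Li 2 u @[u --> (0 : R)^'+] --> (0 : R).
  have [d hd] : exists d : R, is_derive (0 : R) (1 : R) (fun u => u) d.
    by eexists; der_rules; rewrite ?expf_neq0.
  apply: (@cvg_Li_right _ _ _ _ hd) => //.
  by move=> t /norm_lt1.
have c3 : Li 2 (- u) @[u --> (0 : R)^'+] --> (0 : R).
  exact: cvg_LiN_at_right0.
have c4 : Li 2 (2 * u / (1 + u)) @[u --> (0 : R)^'+] --> (0 : R).
  have [d hd] : exists d : R, is_derive (0 : R) (1 : R) (fun u => 2 * u / (1 + u)) d.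
    by eexists; der_rules; rewrite ?expf_neq0.
  apply: (@cvg_Li_right _ _ _ _ hd) => //.
  + by rewrite mulr0 mul0r.
  + by move=> t /kummer_args[_ /norm_lt1].
suff : Li 2 (4 * u / (1 + u) ^+ 2) + 2 * Li 2 u - 2 * Li 2 (- u)
    - 4 * Li 2 (2 * u / (1 + u)) - 0 @[u --> (0 : R)^'+] -->
      (0 + 2 * 0 - 2 * 0 - 4 * 0 - 0 : R).
  by rewrite !mulr0 !subr0 addr0.
apply: cvgB; last exact: cvg_cst.
apply: cvgB; last exact: cvgMl_tmp.
apply: cvgB; last exact: cvgMl_tmp.
by apply: cvgD => //; exact: cvgMl_tmp.
Unshelve. all: by end_near. Qed.

Lemma kummer_Li2_right u : 0 < u < 1 ->
  2 * Li 2 (2 * u / (1 + u)) - Li 2 (4 * u / (1 + u) ^+ 2) - 2 * Li 2 ((1 + u) / 2) =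
  (ln (1 + u) - ln 2) ^+ 2 - pi ^+ 2 / 6.
Proof.
move=> u01; apply: (@eq_from_derive_lim R `]0, 1[ (1 : R)^'-
  (fun u => 2 * Li 2 (2 * u / (1 + u)) - Li 2 (4 * u / (1 + u) ^+ 2)
    - 2 * Li 2 ((1 + u) / 2)) (fun u => (ln (1 + u) - ln 2) ^+ 2 - pi ^+ 2 / 6)
  (fun u => 2 * (ln (1 + u) - ln 2) / (1 + u))); last by rewrite in_itv.
- by near=> t; rewrite /= in_itv/=; apply/andP; split=> //; near: t; apply: nbhs_left_gt.
- move=> t; rewrite in_itv/= => t01; have [h1 h2 h3] := kummer_args t01.
  have /andP[t0 t1] := t01; have v0 : 0 < 1 + t by rewrite addr_gt0.
  derive.
  + by case/andP: h2 => ? _; rewrite gt_eqF.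
  + exact: norm_lt1.
  + by rewrite gt_eqF.
  + by case/andP: h1 => ? _; rewrite gt_eqF.
  + exact: norm_lt1.
  + by rewrite expf_neq0// gt_eqF.
  + by case/andP: h3 => ? _; rewrite gt_eqF.
  + exact: norm_lt1.
  rewrite ln_kummer1// ln_kummer2// ln_kummer3//.
  by field; rewrite !gt_eqF.
- move=> t; rewrite in_itv/= => /andP[t0 t1].
  have v0 : 0 < 1 + t by rewrite addr_gt0.
  derive => //; by field; rewrite gt_eqF.
have z1 : (1 + 1 : R) != 0 by rewrite gt_eqF.
have c1 : Li 2 (4 * u / (1 + u) ^+ 2) @[u --> (1 : R)^'-] --> Li 2 (1 : R).
  have e : 4 * 1 / (1 + 1) ^+ 2 = 1 :> R by field.
  rewrite -[X in _ --> Li 2 X]e.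
  have [d hd] : exists d : R, is_derive (1 : R) (1 : R) (fun u => 4 * u / (1 + u) ^+ 2) d.
    by eexists; der_rules; rewrite ?expf_neq0.
  apply: (@cvg_Li_left _ _ _ _ hd) => //.
  + by rewrite e normr1.
  + by move=> t /kummer_args[/norm_lt1].
have c2 : Li 2 (2 * u / (1 + u)) @[u --> (1 : R)^'-] --> Li 2 (1 : R).
  have e : 2 * 1 / (1 + 1) = 1 :> R by field.
  rewrite -[X in _ --> Li 2 X]e.
  have [d hd] : exists d : R, is_derive (1 : R) (1 : R) (fun u => 2 * u / (1 + u)) d.
    by eexists; der_rules; rewrite ?expf_neq0.
  apply: (@cvg_Li_left _ _ _ _ hd) => //.
  + by rewrite e normr1.
  + by move=> t /kummer_args[_ /norm_lt1].
have c3 : Li 2 ((1 + u) / 2) @[u --> (1 : R)^'-] --> Li 2 (1 : R).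
  have e : (1 + 1) / 2 = 1 :> R by field.
  rewrite -[X in _ --> Li 2 X]e.
  have [d hd] : exists d : R, is_derive (1 : R) (1 : R) (fun u => (1 + u) / 2) d.
    by eexists; der_rules; rewrite ?expf_neq0.
  apply: (@cvg_Li_left _ _ _ _ hd) => //.
  + by rewrite e normr1.
  + by move=> t /kummer_args[_ _ /norm_lt1].
have cln : ln (1 + u) @[u --> (1 : R)^'-] --> ln (1 + 1 : R).
  apply: (@cvg_at_left_continuous R (fun u => ln (1 + u)) 1).
  by eapply der_continuous; der_rules.
have -> : (0 : R) = 2 * Li 2 1 - Li 2 1 - 2 * Li 2 1 - ((ln (1 + 1) - ln 2) ^+ 2 - pi ^+ 2 / 6).
  rewrite Li2_1 subrr expr0n/= sub0r; move: (pi) => p; by field.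
apply: cvgB.
  by apply: cvgB; [apply: cvgB => //; exact: cvgMl_tmp|exact: cvgMl_tmp].
apply: cvgB; last exact: cvg_cst.
have {}cln : ln (1 + u) - ln 2 @[u --> (1 : R)^'-] --> ln (1 + 1 : R) - ln 2.
  by apply: cvgB => //; exact: cvg_cst.
exact: continuous_cvg (@exprn_continuous R 2 _) cln.
Unshelve. all: by end_near. Qed.

(** One variable of the two-variable functional equation of Spence and Kummer set
    to -1.  The two dilogarithm relations above evaluate the coefficients of du / u
    and of du / (1 + u) in the differential of the left-hand side. *)
Lemma kummer_Li3 u : 0 < u < 1 ->
  Li 3 (4 * u / (1 + u) ^+ 2) + 2 * Li 3 u - 2 * Li 3 (- u)
    - 4 * Li 3 (2 * u / (1 + u)) - 4 * Li 3 ((1 + u) / 2) =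
  2 / 3 * (ln (1 + u) - ln 2) ^+ 3 - pi ^+ 2 / 3 * (ln (1 + u) - ln 2)
    - 7 / 2 * zeta R 3.
Proof.
move=> u01; apply: (@eq_from_derive_lim R `]0, 1[ (1 : R)^'-
  (fun u => Li 3 (4 * u / (1 + u) ^+ 2) + 2 * Li 3 u - 2 * Li 3 (- u)
    - 4 * Li 3 (2 * u / (1 + u)) - 4 * Li 3 ((1 + u) / 2))
  (fun u => 2 / 3 * (ln (1 + u) - ln 2) ^+ 3 - pi ^+ 2 / 3 * (ln (1 + u) - ln 2)
    - 7 / 2 * zeta R 3)
  (fun u => (2 * (ln (1 + u) - ln 2) ^+ 2 - pi ^+ 2 / 3) / (1 + u)));
  last by rewrite in_itv.
- by near=> t; rewrite /= in_itv/=; apply/andP; split=> //; near: t; apply: nbhs_left_gt.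
- move=> t; rewrite in_itv/= => t01; have [h1 h2 h3] := kummer_args t01.
  have /andP[t0 t1] := t01; have v0 : 0 < 1 + t by rewrite addr_gt0.
  have left := kummer_Li2_left t01; have right := kummer_Li2_right t01.
  derive.
  + by case/andP: h1 => ? _; rewrite gt_eqF.
  + exact: norm_lt1.
  + by rewrite expf_neq0// gt_eqF.
  + by rewrite gt_eqF.
  + exact: norm_lt1.
  + by rewrite oppr_eq0 gt_eqF.
  + by rewrite normrN norm_lt1.
  + by case/andP: h2 => ? _; rewrite gt_eqF.
  + exact: norm_lt1.
  + by rewrite gt_eqF.
  + by case/andP: h3 => ? _; rewrite gt_eqF.
  + exact: norm_lt1.
  move: left right; move: (Li 2 (4 * t / (1 + t) ^+ 2)) (Li 2 t) (Li 2 (- t))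
    (Li 2 (2 * t / (1 + t))) (Li 2 ((1 + t) / 2)) (pi : R) (ln (1 + t) - ln 2).
  move=> A B C D E p L left right.
  have -> : E = D - A / 2 - (L ^+ 2 - p ^+ 2 / 6) / 2 by rewrite -right; field.
  have -> : A = 2 * C + 4 * D - 2 * B by rewrite -[RHS]addr0 -[X in _ + X]left; ring.
  by field; rewrite !gt_eqF.
- move=> t; rewrite in_itv/= => /andP[t0 t1].
  have v0 : 0 < 1 + t by rewrite addr_gt0.
  derive => //; move: (pi) (zeta R 3) => p z; by field; rewrite gt_eqF.
have z1 : (1 + 1 : R) != 0 by rewrite gt_eqF.
have c1 : Li 3 (4 * u / (1 + u) ^+ 2) @[u --> (1 : R)^'-] --> Li 3 (1 : R).
  have e : 4 * 1 / (1 + 1) ^+ 2 = 1 :> R by field.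
  rewrite -[X in _ --> Li 3 X]e.
  have [d hd] : exists d : R, is_derive (1 : R) (1 : R) (fun u => 4 * u / (1 + u) ^+ 2) d.
    by eexists; der_rules; rewrite ?expf_neq0.
  apply: (@cvg_Li_left _ _ _ _ hd) => //.
  + by rewrite e normr1.
  + by move=> t /kummer_args[/norm_lt1].
have c2 : Li 3 (2 * u / (1 + u)) @[u --> (1 : R)^'-] --> Li 3 (1 : R).
  have e : 2 * 1 / (1 + 1) = 1 :> R by field.
  rewrite -[X in _ --> Li 3 X]e.
  have [d hd] : exists d : R, is_derive (1 : R) (1 : R) (fun u => 2 * u / (1 + u)) d.
    by eexists; der_rules; rewrite ?expf_neq0.
  apply: (@cvg_Li_left _ _ _ _ hd) => //.
  + by rewrite e normr1.
  + by move=> t /kummer_args[_ /norm_lt1].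
have c3 : Li 3 ((1 + u) / 2) @[u --> (1 : R)^'-] --> Li 3 (1 : R).
  have e : (1 + 1) / 2 = 1 :> R by field.
  rewrite -[X in _ --> Li 3 X]e.
  have [d hd] : exists d : R, is_derive (1 : R) (1 : R) (fun u => (1 + u) / 2) d.
    by eexists; der_rules; rewrite ?expf_neq0.
  apply: (@cvg_Li_left _ _ _ _ hd) => //.
  + by rewrite e normr1.
  + by move=> t /kummer_args[_ _ /norm_lt1].
have c4 : Li 3 u @[u --> (1 : R)^'-] --> Li 3 (1 : R).
  have [d hd] : exists d : R, is_derive (1 : R) (1 : R) (fun u => u) d.
    by eexists; der_rules; rewrite ?expf_neq0.
  apply: (@cvg_Li_left _ _ _ _ hd) => //.
  + by rewrite normr1.
  + by move=> t /norm_lt1.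
have c5 : Li 3 (- u) @[u --> (1 : R)^'-] --> Li 3 (- 1 : R).
  exact: cvg_LiN_at_left1.
have cln : ln (1 + u) - ln 2 @[u --> (1 : R)^'-] --> ln (1 + 1 : R) - ln 2.
  apply: (@cvg_at_left_continuous R (fun u => ln (1 + u) - ln 2) 1).
  by eapply der_continuous; der_rules.
have dup : Li 3 (1 : R) + Li 3 (- 1) = 1 / 4 * Li 3 1.
  have := @Li_duplication R 3 1 isT; rewrite normr1 lexx expr1n => /(_ isT) ->.
  by move: (Li 3 _) => z; field.
have -> : (0 : R) = Li 3 1 + 2 * Li 3 1 - 2 * Li 3 (- 1) - 4 * Li 3 1 - 4 * Li 3 1
    - (2 / 3 * (ln (1 + 1) - ln 2) ^+ 3 - pi ^+ 2 / 3 * (ln (1 + 1) - ln 2)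
    - 7 / 2 * zeta R 3).
  rewrite -Li3_1 subrr; move: dup; move: (pi) (Li 3 _) (Li 3 _) => p z z' ?.
  by lra.
apply: cvgB.
  apply: cvgB; last exact: cvgMl_tmp.
  apply: cvgB; last exact: cvgMl_tmp.
  apply: cvgB; last exact: cvgMl_tmp.
  by apply: cvgD => //; exact: cvgMl_tmp.
apply: cvgB; last exact: cvg_cst.
apply: cvgB; last exact: cvgMl_tmp.
apply: cvgMl_tmp; exact: continuous_cvg (@exprn_continuous R 3 _) cln.
Unshelve. all: by end_near. Qed.

End KummerRelation.

(** * Iterated integrals against powers of the logarithm *)

Section IteratedIntegrals.
Context {R : realType}.
Local Notation T := (measurableTypeR R).
Local Notation mu := (@lebesgue_measure R).
Implicit Types (a n k m : nat) (h f : R -> \bar R) (x : R).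

(** Zero outside ]0, 1], so that the integrals over the cube are integrals over the
    whole space; the sign makes it nonnegative, so that Tonelli's theorem applies
    before any convergence is known. *)
Definition log_weight a (t : R) : R := \1_[set` `]0, 1] : interval R] t * (- ln t) ^+ a.

Lemma log_weightE a t : t \in `]0, 1] -> log_weight a t = (- ln t) ^+ a.
Proof. by move=> t01; rewrite /log_weight indicE mem_set// mul1r. Qed.

Lemma log_weight_out a t : t \notin `]0, 1] -> log_weight a t = 0.
Proof. by move=> t01; rewrite /log_weight indicE memNset ?mul0r//; exact/negP. Qed.

Lemma log_weight_ge0 a t : 0 <= log_weight a t.
Proof.
have [t01|t01] := boolP (t \in `]0, 1]); last by rewrite log_weight_out.
rewrite log_weightE// exprn_ge0// oppr_ge0 ln_le0//.
by move: t01; rewrite in_itv/= => /andP[].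
Qed.

Lemma measurable_log_weight a : measurable_fun setT (log_weight a).
Proof.
have m1 : measurable_fun setT (fun t : R => - ln t).
  apply: (measurableT_comp (@oppr_measurable R setT) (@measurable_ln R)).
apply: measurable_funM; last exact: measurable_funX.
by apply: measurable_indic; exact: measurable_itv.
Qed.

Definition nonneg_measurable (h : T -> \bar R) :=
  measurable_fun setT h /\ forall x, (0 <= h x)%E.

(** What integrating out one variable of the cube does to a function [h] of the
    sum of the variables; [x] is the sum of the others. *)
Definition log_integral a h x : \bar R :=
  (\int[mu]_t ((log_weight a t)%:E * h (x + t)%R))%E.

Lemma measurable_kernel a h : measurable_fun setT h ->
  measurable_fun setT (fun p : T * T => ((log_weight a p.2)%:E * h (p.1 + p.2)%R)%E).
Proof.
move=> mh; apply: emeasurable_funM.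
  apply/measurable_EFinP; apply: measurableT_comp; first exact: measurable_log_weight.
  exact: measurable_snd.
by apply: measurableT_comp => //; exact: measurable_funD.
Qed.

Lemma log_integral_nonneg a h :
  nonneg_measurable h -> nonneg_measurable (log_integral a h).
Proof.
move=> [mh h0].
have F0 : forall p : T * T, (0 <= (log_weight a p.2)%:E * h (p.1 + p.2)%R)%E.
  by move=> p; rewrite mule_ge0// lee_fin log_weight_ge0.
split.
  exact: (@measurable_fun_fubini_tonelli_F _ _ _ _ _ mu _ (measurable_kernel a mh) F0).
move=> x; apply: integral_ge0 => t _; exact: (F0 (x, t)).
Qed.

Lemma measurable_kernel_section a h x : measurable_fun setT h ->
  measurable_fun setT (fun t : T => ((log_weight a t)%:E * h (x + t)%R)%E).
Proof.
move=> mh; apply: emeasurable_funM.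
  by apply/measurable_EFinP; exact: measurable_log_weight.
by apply: measurableT_comp => //; exact: measurable_funD.
Qed.

Lemma log_integralC a b h : nonneg_measurable h ->
  log_integral a (log_integral b h) = log_integral b (log_integral a h).
Proof.
move=> [mh h0]; apply/funext => x; rewrite /log_integral.
pose F (p : T * T) := ((log_weight a p.1)%:E *
  ((log_weight b p.2)%:E * h (x + p.1 + p.2)%R))%E.
have F0 p : (0 <= F p)%E.
  by rewrite /F !mule_ge0// lee_fin log_weight_ge0.
have mF : measurable_fun setT F.
  apply: emeasurable_funM.
    apply/measurable_EFinP; apply: measurableT_comp; first exact: measurable_log_weight.
    exact: measurable_fst.
  apply: emeasurable_funM.
    apply/measurable_EFinP; apply: measurableT_comp; first exact: measurable_log_weight.
    exact: measurable_snd.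
  apply: measurableT_comp => //; apply: measurable_funD => //.
  exact: measurable_funD.
transitivity (\int[mu]_s \int[mu]_t F (s, t))%E.
  apply: eq_integral => s _; rewrite /F/= -ge0_integralZl//.
  - exact: measurable_kernel_section.
  - by move=> t _; rewrite mule_ge0// lee_fin log_weight_ge0.
  - by rewrite lee_fin log_weight_ge0.
rewrite (fubini_tonelli F mF F0).
apply: eq_integral => t _; rewrite /F/= -ge0_integralZl//.
- apply: eq_integral => s _.
  by rewrite muleCA addrAC.
- exact: measurable_kernel_section.
- by move=> s _; rewrite mule_ge0// lee_fin log_weight_ge0.
- by rewrite lee_fin log_weight_ge0.
Qed.

Lemma log_integralD a h f : nonneg_measurable h -> nonneg_measurable f ->
  log_integral a (fun x => h x + f x)%E = (fun x => log_integral a h x + log_integral a f x)%E.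
Proof.
move=> [mh h0] [mf f0]; apply/funext => x; rewrite /log_integral.
rewrite -ge0_integralD//.
- by apply: eq_integral => t _; rewrite muleDr// ge0_adde_def// inE.
- by move=> t _; rewrite mule_ge0// lee_fin log_weight_ge0.
- exact: measurable_kernel_section.
- by move=> t _; rewrite mule_ge0// lee_fin log_weight_ge0.
- exact: measurable_kernel_section.
Qed.

Lemma log_integralZ a (c : R) h : 0 <= c -> nonneg_measurable h ->
  log_integral a (fun x => c%:E * h x)%E = (fun x => c%:E * log_integral a h x)%E.
Proof.
move=> c0 [mh h0]; apply/funext => x; rewrite /log_integral -ge0_integralZl//.
- by apply: eq_integral => t _; rewrite muleCA.
- exact: measurable_kernel_section.
- by move=> t _; rewrite mule_ge0// lee_fin log_weight_ge0.
Qed.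

Definition tuple_integral k (g : k.-tuple T -> R) f x : \bar R :=
  (\int[lebesgue_tuple R k]_t ((g t)%:E * f (x + tsum t)%R))%E.

Lemma measurable_tsum k : measurable_fun setT (@tsum R k).
Proof. by apply: measurable_sum => i; exact: measurable_tnth. Qed.

Lemma tsum_cons k (s : T) (t : k.-tuple T) : tsum (tcons (s, t)) = s + tsum t.
Proof.
rewrite /tsum big_ord_recl tnth0; congr (_ + _).
by apply: eq_bigr => i _; rewrite tnthS.
Qed.

Lemma tuple_integral0 (g : 0.-tuple T -> R) f x :
  tuple_integral g f x = ((g [tuple])%:E * f x)%E.
Proof.
rewrite /tuple_integral /=.
transitivity (\int[\d_([tuple] : 0.-tuple T)]_t cst ((g [tuple])%:E * f x) t)%E.
  by apply: eq_integral => t _; rewrite (tuple0 t) /tsum big_ord0 addr0.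
by rewrite integral_dirac//= diracE mem_set// mul1e.
Qed.

Lemma tuple_integral_cons k a (g : k.-tuple T -> R) f x :
  measurable_fun setT g -> (forall t, 0 <= g t) -> nonneg_measurable f ->
  tuple_integral (fun t : k.+1.-tuple T => log_weight a (thead t) * g [tuple of behead t]) f x =
  log_integral a (tuple_integral g f) x.
Proof.
move=> mg g0 [mf f0].
pose F (t : k.+1.-tuple T) :=
  ((log_weight a (thead t) * g [tuple of behead t])%:E * f (x + tsum t)%R)%E.
have F0 t : (0 <= F t)%E by rewrite /F mule_ge0// lee_fin mulr_ge0// log_weight_ge0.
have mF : measurable_fun setT F.
  apply: emeasurable_funM.
    apply/measurable_EFinP; apply: measurable_funM.
      apply: measurableT_comp; first exact: measurable_log_weight.
      exact: measurable_tnth.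
    by apply: measurableT_comp => //; exact: measurable_behead.
  apply: measurableT_comp => //; apply: measurable_funD => //.
  exact: measurable_tsum.
have tconsK (s : T) (t : k.-tuple T) : [tuple of behead (tcons (s, t))] = t.
  exact: val_inj.
have FE (s : T) (t : k.-tuple T) :
    F (tcons (s, t)) = ((log_weight a s)%:E * ((g t)%:E * f (x + s + tsum t)%R))%E.
  by rewrite /F tsum_cons tconsK EFinM muleA addrA.
transitivity (\int[mu \x lebesgue_tuple R k]_p F (tcons p))%E.
  exact: (@ge0_integral_pushforward _ _ _ _ R (@tcons R k) (@measurable_tcons R k)
    (mu \x lebesgue_tuple R k)%E setT F measurableT mF (fun t _ => F0 t)).
rewrite fubini_tonelli1//; last by apply: measurableT_comp => //; exact: measurable_tcons.
apply: eq_integral => s _; rewrite /fubini_F /=.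
under eq_integral do rewrite FE.
rewrite ge0_integralZl//.
- apply: emeasurable_funM; first exact/measurable_EFinP.
  apply: measurableT_comp => //; apply: measurable_funD => //.
  exact: measurable_tsum.
- by move=> t _; rewrite mule_ge0// lee_fin.
- by rewrite lee_fin log_weight_ge0.
Qed.

End IteratedIntegrals.

Section MonomialSums.
Variable R : comNzRingType.

(** The sum over the exponent vectors of weight [m] is a coefficient of a
    product of polynomials, which makes it recursive in the number of variables. *)
Lemma monomial_sum_coef n k m (F : 'I_k -> nat -> R) :
  \sum_(nu : {ffun 'I_k -> 'I_n.+1} | (\sum_j nu j == m)%N) \prod_j F j (nu j) =
  (\prod_j \poly_(a < n.+1) F j a)`_m.
Proof.
under [in RHS]eq_bigr do rewrite poly_def.
rewrite bigA_distr_bigA coef_sum [LHS]big_mkcond; apply: eq_bigr => nu _.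
have -> : \prod_j (F j (nu j) *: 'X^(nu j)) =
    (\prod_j F j (nu j)) *: 'X^(\sum_j nu j)%N :> {poly R}.
  by rewrite scaler_prod -(big_morph _ (exprD 'X) (expr0 _)).
by rewrite coefZ coefXn eq_sym; case: eqP => _; rewrite ?mulr1 ?mulr0.
Qed.

Lemma monomial_sum_recl n k m (F : 'I_k.+1 -> nat -> R) : (m <= n)%N ->
  \sum_(nu : {ffun 'I_k.+1 -> 'I_n.+1} | (\sum_j nu j == m)%N) \prod_j F j (nu j) =
  \sum_(a < m.+1) F ord0 a *
    \sum_(nu : {ffun 'I_k -> 'I_n.+1} | (\sum_j nu j == m - a)%N)
      \prod_j F (lift ord0 j) (nu j).
Proof.
move=> mn; rewrite monomial_sum_coef big_ord_recl coefM; apply: eq_bigr => a _.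
rewrite (monomial_sum_coef _ _ (fun j => F (lift ord0 j))) coef_poly.
by rewrite (leq_trans (ltn_ord a)).
Qed.

End MonomialSums.

Section CubeIntegrals.
Context {R : realType}.
Local Notation T := (measurableTypeR R).
Local Notation mu := (@lebesgue_measure R).
Implicit Types (a n k m : nat) (h f : R -> \bar R) (x : R).

(** Up to the sign (-1) ^ m, the complete homogeneous polynomial of degree [m] in
    the logarithms of the coordinates.  The bound [n] on the exponents stays fixed
    when a variable is split off and [m] decreases. *)
Definition weight_sum n k m (t : k.-tuple T) : R :=
  \sum_(nu : {ffun 'I_k -> 'I_n.+1} | (\sum_j nu j == m)%N)
    \prod_j log_weight (nu j) (tnth t j).

Lemma weight_sum_ge0 n k m (t : k.-tuple T) : 0 <= weight_sum n m t.
Proof.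
by apply: sumr_ge0 => nu _; apply: prodr_ge0 => j _; exact: log_weight_ge0.
Qed.

Lemma measurable_weight_sum n k m : measurable_fun setT (@weight_sum n k m).
Proof.
have -> : @weight_sum n k m = fun t => \sum_(nu : {ffun 'I_k -> 'I_n.+1})
    if (\sum_j nu j == m)%N then \prod_j log_weight (nu j) (tnth t j) else 0.
  by apply/funext => t; rewrite /weight_sum big_mkcond.
apply: measurable_sum => nu; case: (\sum_j nu j == m)%N; last exact: measurable_cst.
apply: measurable_prod => j _; apply: measurableT_comp; last exact: measurable_tnth.
exact: measurable_log_weight.
Qed.

Lemma weight_sum0 n m (t : 0.-tuple T) : weight_sum n m t = (m == 0)%:R.
Proof.
rewrite /weight_sum (monomial_sum_coef _ _ (fun j a => log_weight a (tnth t j))).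
by rewrite big_ord0 coef1.
Qed.

Lemma weight_sum_recl n k m (t : k.+1.-tuple T) : (m <= n)%N ->
  weight_sum n m t =
  \sum_(a < m.+1) log_weight a (thead t) * weight_sum n (m - a) [tuple of behead t].
Proof.
move=> mn; rewrite /weight_sum.
rewrite (monomial_sum_recl (fun j a => log_weight a (tnth t j)) mn).
apply: eq_bigr => a _; congr (_ * _); apply: eq_bigr => nu _.
apply: eq_bigr => j _; rewrite tnth_behead; congr (log_weight _ (tnth t _)).
by apply/val_inj; rewrite /= inordK// ltnS ltn_ord.
Qed.

Lemma weight_integral_recl n k m f x : (m <= n)%N -> nonneg_measurable f ->
  tuple_integral (@weight_sum n k.+1 m) f x =
  (\sum_(0 <= a < m.+1) log_integral a (tuple_integral (@weight_sum n k (m - a)) f) x)%E.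
Proof.
move=> mn [mf f0]; rewrite big_mkord.
transitivity (\sum_(a < m.+1) tuple_integral (fun t : k.+1.-tuple T =>
    log_weight a (thead t) * weight_sum n (m - a) [tuple of behead t])%R f x)%E.
  rewrite /tuple_integral -ge0_integral_sum//.
  - apply: eq_integral => t _; rewrite weight_sum_recl// -sumEFin ge0_sume_distrl//.
    by move=> a _; rewrite lee_fin mulr_ge0 ?log_weight_ge0// weight_sum_ge0.
  - move=> a; apply: emeasurable_funM.
      apply/measurable_EFinP; apply: measurable_funM.
        apply: measurableT_comp; first exact: measurable_log_weight.
        exact: measurable_tnth.
      apply: measurableT_comp; first exact: measurable_weight_sum.
      exact: measurable_behead.
    apply: measurableT_comp => //; apply: measurable_funD => //.
    exact: measurable_tsum.
  - move=> a t _; rewrite mule_ge0// lee_fin mulr_ge0 ?log_weight_ge0//.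
    exact: weight_sum_ge0.
apply: eq_bigr => a _; apply: tuple_integral_cons => //.
- exact: measurable_weight_sum.
- exact: weight_sum_ge0.
Qed.

Lemma log_integral0 a x : log_integral a (fun=> 0%E) x = 0%E :> \bar R.
Proof. by rewrite /log_integral integral0_eq// => t _; rewrite mule0. Qed.

Lemma weight_integral_recl1 n k f x : (1 <= n)%N -> nonneg_measurable f ->
  tuple_integral (@weight_sum n k.+1 1) f x =
  (log_integral 0 (tuple_integral (@weight_sum n k 1) f) x +
   log_integral 1 (tuple_integral (@weight_sum n k 0) f) x)%E.
Proof.
move=> n1 nf; rewrite (weight_integral_recl _ _ n1 nf).
by rewrite big_nat_recl; last exact: leq0n; rewrite big_nat1.
Qed.

Lemma weight_integral_recl2 n k f x : (2 <= n)%N -> nonneg_measurable f ->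
  tuple_integral (@weight_sum n k.+1 2) f x =
  (log_integral 0 (tuple_integral (@weight_sum n k 2) f) x +
   (log_integral 1 (tuple_integral (@weight_sum n k 1) f) x +
    log_integral 2 (tuple_integral (@weight_sum n k 0) f) x))%E.
Proof.
move=> n2 nf; rewrite (weight_integral_recl _ _ n2 nf).
rewrite big_nat_recl; last exact: leq0n.
by rewrite big_nat_recl; last exact: leq0n; rewrite big_nat1.
Qed.

Opaque tuple_integral log_integral.

Lemma iter_log_integral_nonneg a k f :
  nonneg_measurable f -> nonneg_measurable (iter k (log_integral a) f).
Proof. by move=> nf; elim: k => //= k IH; exact: log_integral_nonneg. Qed.

Lemma iter_log_integralC a b k f : nonneg_measurable f ->
  iter k (log_integral a) (log_integral b f) = log_integral b (iter k (log_integral a) f).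
Proof.
move=> nf; elim: k => //= k ->; rewrite log_integralC//.
exact: iter_log_integral_nonneg.
Qed.

Lemma weight_integral0 n k f : nonneg_measurable f ->
  tuple_integral (@weight_sum n k 0) f = iter k (log_integral 0) f.
Proof.
move=> nf; elim: k => [|k IH]; apply/funext => x /=.
  by rewrite tuple_integral0 weight_sum0 mul1e.
by rewrite weight_integral_recl// big_nat1 subn0 IH.
Qed.

Lemma weight_integral1 n k f : (1 <= n)%N -> nonneg_measurable f ->
  tuple_integral (@weight_sum n k.+1 1) f =
  (fun x => (k.+1%:R)%:E * iter k (log_integral 0) (log_integral 1 f) x)%E.
Proof.
move=> n1 nf; elim: k => [|k IH]; apply/funext => x.
  rewrite (weight_integral_recl1 _ _ n1 nf).
  rewrite weight_integral0//= mul1e.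
  have -> : tuple_integral (@weight_sum n 0 1) f = fun=> 0%E.
    by apply/funext => y; rewrite tuple_integral0 weight_sum0 mul0e.
  by rewrite log_integral0 add0e.
rewrite (weight_integral_recl1 _ _ n1 nf).
rewrite weight_integral0// IH log_integralZ//; last first.
  by apply: iter_log_integral_nonneg; exact: log_integral_nonneg.
rewrite -iterS iter_log_integralC//= -[X in (_ + X)%E]mul1e -ge0_muleDl//.
by rewrite -EFinD natr1.
Qed.

(** The operators commute, so only the multiset of exponents matters: of the
    exponent vectors of weight 2, k + 2 have a single 2 and 'C(k + 2, 2) two 1s. *)
Lemma weight_integral2 n k f : (2 <= n)%N -> nonneg_measurable f ->
  tuple_integral (@weight_sum n k.+2 2) f =
  (fun x => (k.+2%:R)%:E * iter k.+1 (log_integral 0) (log_integral 2 f) x +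
    ('C(k.+2, 2)%:R)%:E * iter k (log_integral 0) (log_integral 1 (log_integral 1 f)) x)%E.
Proof.
move=> n2 nf.
have n1 : (1 <= n)%N by exact: ltnW.
have vanish m : (0 < m)%N -> tuple_integral (@weight_sum n 0 m) f = fun=> 0%E.
  move=> m0; apply/funext => y.
  by rewrite tuple_integral0 weight_sum0 gtn_eqF// mul0e.
have S_nf a : nonneg_measurable (log_integral a f) by exact: log_integral_nonneg.
have one : tuple_integral (@weight_sum n 1 2) f = log_integral 2 f.
  apply/funext => y; rewrite (weight_integral_recl2 _ _ n2 nf).
  by rewrite (vanish 2 isT) (vanish 1 isT) !log_integral0 !add0e weight_integral0.
have S11_nf : nonneg_measurable (log_integral 1 (log_integral 1 f)).
  exact: log_integral_nonneg.
elim: k => [|k IH]; apply/funext => x;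
    rewrite (weight_integral_recl2 _ _ n2 nf).
  rewrite one weight_integral1// !weight_integral0// log_integralZ//=.
  rewrite binn !mul1e (log_integralC 2 0)// addeCA addeC.
  by rewrite -[in LHS](mul1e (log_integral 0 _ x)) -ge0_muleDl// -EFinD.
rewrite IH weight_integral1// weight_integral0// log_integralD; first last.
- split.
    apply: emeasurable_funM => //.
    by case: (iter_log_integral_nonneg 0 k S11_nf).
  by move=> y; rewrite mule_ge0// ?lee_fin//; case: (iter_log_integral_nonneg 0 k S11_nf).
- split.
    apply: emeasurable_funM => //.
    by case: (iter_log_integral_nonneg 0 k.+1 (S_nf 2%N)).
  by move=> y; rewrite mule_ge0// ?lee_fin//; case: (iter_log_integral_nonneg 0 k.+1 (S_nf 2%N)).
have nf1 := iter_log_integral_nonneg 0 k.+1 (S_nf 1%N).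
have nf2 := iter_log_integral_nonneg 0 k.+1 (S_nf 2%N).
have nf11 := iter_log_integral_nonneg 0 k S11_nf.
rewrite (log_integralZ 0 (ler0n _ _) nf2) (log_integralZ 0 (ler0n _ _) nf11).
rewrite (log_integralZ 1 (ler0n _ _) nf1) -(iter_log_integralC 0 1 k.+1 (S_nf 1%N)).
rewrite -(iter_log_integralC 0 2 k.+2 nf).
rewrite !iterS -!iterS.
rewrite ![iter k.+2 _ _]iterS [iter k.+1 _ (log_integral 1 (log_integral 1 f))]iterS.
have [_ X0] := log_integral_nonneg 0 nf2; have [_ Y0] := log_integral_nonneg 0 nf11.
move: (X0 x) (Y0 x).
move: (log_integral 0 (iter k.+1 _ _) x) (log_integral 0 (iter k _ _) x) => X Y {}X0 {}Y0.
have -> : 'C(k.+3, 2) = (k.+2 + 'C(k.+2, 2))%N by rewrite (binS _ 1) bin1 addnC.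
have p (i : nat) : (0 <= (i%:R : R)%:E)%E by rewrite lee_fin ler0n.
rewrite natrD -(natr1 k.+2) !EFinD (ge0_muleDl _ (p k.+2) (p 1%N)).
rewrite (ge0_muleDl _ (p k.+2) (p _)).
by rewrite mul1e (addeC (_ * Y)%E X) addeACA [X in (_ + X)%E]addeC.
Qed.

End CubeIntegrals.

Section CubeReduction.
Context {R : realType}.
Local Notation T := (measurableTypeR R).
Implicit Types (a n k m : nat) (x : R).

(** The kernel 1 / x on the positive half-line, written so that measurability and
    positivity hold on the whole line. *)
Definition inv_kernel x : \bar R := (expR (- ln x))%:E.

Lemma inv_kernelE x : 0 < x -> inv_kernel x = (x^-1)%:E.
Proof. by move=> x0; rewrite /inv_kernel expRN lnK. Qed.

Lemma inv_kernel_nonneg : nonneg_measurable inv_kernel.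
Proof.
split; last by move=> x; rewrite lee_fin expR_ge0.
apply/measurable_EFinP; apply: measurableT_comp; first exact: measurable_expR.
exact: (measurableT_comp (@oppr_measurable R setT) (@measurable_ln R)).
Qed.

Lemma cube_cons k (t : k.+1.-tuple T) :
  cube R k.+1 t <-> (thead t \in `]0, 1]) /\ cube R k [tuple of behead t].
Proof.
split=> [h|[h0 h] i].
  split; first exact: h.
  by move=> i; rewrite tnth_behead.
case: (unliftP ord0 i) => [j ->|->]; last exact: h0.
have := h j; rewrite tnth_behead (_ : inord j.+1 = lift ord0 j)//.
by apply/val_inj; rewrite /= inordK// ltnS.
Qed.

Lemma tsum_gt0 k (t : k.+1.-tuple T) : cube R k.+1 t -> 0 < tsum t.
Proof.
move=> ct; rewrite /tsum big_ord_recl ltr_pwDl//.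
  by have := ct ord0; rewrite in_itv/= => /andP[].
by apply: sumr_ge0 => i _; have := ct (lift ord0 i); rewrite in_itv/= => /andP[/ltW].
Qed.

Lemma cube_integral k (a g : k.+1.-tuple T -> R) :
  (forall t, cube R k.+1 t -> a t = g t / tsum t) ->
  (forall t, ~ cube R k.+1 t -> g t = 0) ->
  (\int[lebesgue_tuple R k.+1]_(t in cube R k.+1) (a t)%:E =
   tuple_integral g inv_kernel 0)%E.
Proof.
move=> ag g0; rewrite integral_mkcond; apply: eq_integral => t _.
rewrite patchE add0r; case: ifPn => [/set_mem ct|/negP ct].
  by rewrite ag// inv_kernelE ?tsum_gt0// EFinM.
by rewrite g0 ?mul0e// => /mem_set.
Qed.

Lemma cube_integrable k (a g : k.+1.-tuple T -> R) (v : R) :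
  measurable_fun setT g -> (forall t, 0 <= g t) ->
  (forall t, cube R k.+1 t -> a t = g t / tsum t) ->
  (forall t, ~ cube R k.+1 t -> g t = 0) ->
  tuple_integral g inv_kernel 0 = v%:E ->
  (lebesgue_tuple R k.+1).-integrable (cube R k.+1) (EFin \o a) /\
  (\int[lebesgue_tuple R k.+1]_(t in cube R k.+1) a t)%R = v.
Proof.
move=> mg g_ge0 ag g0 gv.
have av : (\int[lebesgue_tuple R k.+1]_(t in cube R k.+1) (a t)%:E = v%:E)%E.
  by rewrite (cube_integral ag g0).
split; last by rewrite /Rintegral av.
apply/integrableP; split.
  apply/measurable_EFinP.
  apply: (@eq_measurable_fun _ _ _ _ _ (fun t => g t * expR (- ln (tsum t)))).
    move=> t /set_mem ct; rewrite ag// expRN lnK// posrE; exact: tsum_gt0.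
  apply: measurable_funTS; apply: measurable_funM => //.
  apply: measurableT_comp; first exact: measurable_expR.
  apply: (measurableT_comp (@oppr_measurable R setT)).
  by apply: measurableT_comp; [exact: measurable_ln|exact: measurable_tsum].
rewrite (_ : (\int[_]_(x in _) _)%E = v%:E) ?ltry// -av.
apply: eq_integral => t /set_mem ct /=; rewrite ger0_norm// ag//.
by rewrite divr_ge0// ltW// tsum_gt0.
Qed.

Lemma weight_sum_out n k m (t : k.-tuple T) : ~ cube R k t -> weight_sum n m t = 0.
Proof.
move=> ct; rewrite /weight_sum big1// => nu _.
have /existsNP[j /negP tj] : ~ forall j, tnth t j \in `]0, 1] by [].
by rewrite (bigD1 j)//= log_weight_out ?mul0r.
Qed.

Lemma weight_sum_cube n k m (t : k.-tuple T) : cube R k t ->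
  weight_sum n m t = (-1) ^+ m *
    \sum_(nu : {ffun 'I_k -> 'I_n.+1} | (\sum_j nu j == m)%N) \prod_j ln (tnth t j : R) ^+ nu j.
Proof.
move=> ct; rewrite /weight_sum mulr_sumr; apply: eq_bigr => nu /eqP <-.
rewrite expr_sum -big_split/=; apply: eq_bigr => j _.
by rewrite log_weightE// -exprNn.
Qed.

(** The sign (-1) ^ n makes the integrand nonnegative on the cube. *)
Lemma E_intE k n : E_int R k.+1 n = tuple_integral (@weight_sum R n k.+1 n) inv_kernel 0.
Proof.
pose c (t : k.+1.-tuple T) := complete_hom n (fun i => ln (tnth t i : R)) / tsum t.
have wc t : cube R k.+1 t -> (-1) ^+ n * c t = weight_sum n n t / tsum t.
  by move=> ct; rewrite (weight_sum_cube _ _ ct) mulrA.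
rewrite /E_int -(cube_integral wc (weight_sum_out n n)) -/c.
have [n_odd|n_even] := boolP (odd n); last first.
  rewrite -signr_odd (negbTE n_even) expr0 mul1e; apply: eq_integral => t _.
  by rewrite mul1r.
have neg : (\int[lebesgue_tuple R k.+1]_(t in cube R k.+1) (c t)%:E =
    - \int[lebesgue_tuple R k.+1]_(t in cube R k.+1) ((-1) ^+ n * c t)%:E)%E.
  rewrite -integral_ge0N.
    by apply: eq_integral => t _; rewrite -signr_odd n_odd expr1 mulN1r EFinN oppeK.
  move=> t ct; rewrite wc// lee_fin divr_ge0 ?weight_sum_ge0//.
  by rewrite ltW// tsum_gt0.
have e : (-1) ^+ n = -1 :> R by rewrite -signr_odd n_odd expr1.
by rewrite neg {1}e EFinN mulN1e oppeK.
Qed.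

Lemma weight_sum_zero n k (t : k.-tuple T) : cube R k t -> weight_sum n 0 t = 1.
Proof.
elim: k t => [|k IH] t ct; first by rewrite weight_sum0.
rewrite weight_sum_recl// big_ord1 subn0.
by case/cube_cons: ct => t0 /IH ->; rewrite log_weightE// expr0 mulr1.
Qed.

Lemma nth_thead k (t : k.+1.-tuple T) : nth (0 : R) t 0 = thead t.
Proof. by rewrite /thead (tnth_nth (0 : R)). Qed.

Lemma nth1_thead k (t : k.+2.-tuple T) : nth (0 : R) t 1 = thead [tuple of behead t].
Proof. by rewrite -nth_thead /= nth_behead. Qed.

Lemma A_integralE k v :
  log_integral 2 (iter k.+1 (log_integral 0) inv_kernel) 0 = v%:E ->
  (lebesgue_tuple R k.+2).-integrable (cube R k.+2) (EFin \o A_integrand R k.+2) /\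
  A_int R k.+2 = v.
Proof.
have nk := @inv_kernel_nonneg.
have mw := @measurable_weight_sum R 0 k.+1 0.
have w0 := @weight_sum_ge0 R 0 k.+1 0.
rewrite -(weight_integral0 0 k.+1 nk) -tuple_integral_cons// => Iv.
apply: cube_integrable Iv.
- apply: measurable_funM.
    by apply: measurableT_comp; [exact: measurable_log_weight|exact: measurable_tnth].
  by apply: measurableT_comp; [exact: mw|exact: measurable_behead].
- by move=> t; rewrite mulr_ge0 ?log_weight_ge0.
- move=> t /cube_cons[t0 ct]; rewrite weight_sum_zero// log_weightE// mulr1.
  by rewrite /A_integrand nth_thead sqrrN.
- move=> t ct; have [t0|t0] := boolP (thead t \in `]0, 1]).
    rewrite weight_sum_out ?mulr0// => ct'; apply: ct; exact/cube_cons.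
  by rewrite log_weight_out// mul0r.
Qed.

Lemma B_integralE k v :
  log_integral 1 (log_integral 1 (iter k (log_integral 0) inv_kernel)) 0 = v%:E ->
  (lebesgue_tuple R k.+2).-integrable (cube R k.+2) (EFin \o B_integrand R k.+2) /\
  B_int R k.+2 = v.
Proof.
have nk := @inv_kernel_nonneg.
have mw := @measurable_weight_sum R 0 k 0.
have w0 := @weight_sum_ge0 R 0 k 0.
pose g (t : k.+1.-tuple T) := log_weight 1 (thead t) * weight_sum 0 0 [tuple of behead t].
have mg : measurable_fun setT g.
  apply: measurable_funM.
    by apply: measurableT_comp; [exact: measurable_log_weight|exact: measurable_tnth].
  by apply: measurableT_comp; [exact: mw|exact: measurable_behead].
have g0 t : 0 <= g t by rewrite mulr_ge0 ?log_weight_ge0.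
have -> : log_integral 1 (iter k (log_integral 0) inv_kernel) = tuple_integral g inv_kernel.
  by apply/funext => x; rewrite tuple_integral_cons// weight_integral0.
rewrite -tuple_integral_cons// => Iv.
apply: cube_integrable Iv.
- apply: measurable_funM.
    by apply: measurableT_comp; [exact: measurable_log_weight|exact: measurable_tnth].
  by apply: measurableT_comp; [exact: mg|exact: measurable_behead].
- by move=> t; rewrite mulr_ge0 ?log_weight_ge0.
- move=> t /cube_cons[t0 /cube_cons[t1 ct]]; rewrite /g weight_sum_zero//.
  rewrite !log_weightE// mulr1 !expr1 mulrNN.
  by rewrite /B_integrand nth_thead nth1_thead.
- move=> t ct; have [t0|t0] := boolP (thead t \in `]0, 1]); last first.
    by rewrite log_weight_out// mul0r.
  rewrite /g; have [t1|t1] := boolP (thead [tuple of behead t] \in `]0, 1]); last first.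
    by rewrite (log_weight_out _ t1) mul0r mulr0.
  rewrite weight_sum_out ?mulr0// => ct'; apply: ct.
  by apply/cube_cons; split=> //; exact/cube_cons.
Qed.

End CubeReduction.

(** * Improper integrals from antiderivatives *)

Section Newton.
Context {R : realType}.
Local Notation mu := (@lebesgue_measure R).
Implicit Types (f g H : R -> R) (t x v : R).

(** The improper integral over ]0, 1], defined by antiderivatives: it is linear
    without integrability side conditions, so an integrand of constant sign may be
    cut into pieces whose Lebesgue integrals need not be studied. *)
Definition newton f v := exists H a,
  [/\ forall t, 0 < t -> is_derive t (1 : R) H (f t),
      H t @[t --> (0 : R)^'+] --> a & v = H 1 - a].

Lemma eq_newton f g v : (forall t, 0 < t -> f t = g t) -> newton f v -> newton g v.
Proof.
move=> fg [H [a [Hf Ha ->]]]; exists H, a; split=> // t t0.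
by rewrite -fg//; exact: Hf.
Qed.

Lemma newtonD f g v u : newton f v -> newton g u ->
  newton (fun t => f t + g t) (v + u).
Proof.
move=> [H [a [Hf Ha ->]]] [K [b [Kg Kb ->]]].
exists (fun t => H t + K t), (a + b); split; [|exact: cvgD|ring].
by move=> t t0; apply: der_add; [exact: Hf|exact: Kg].
Qed.

Lemma newtonZ c f v : newton f v -> newton (fun t => c * f t) (c * v).
Proof.
move=> [H [a [Hf Ha ->]]]; exists (fun t => c * H t), (c * a); split.
- by move=> t t0; apply: (der_eq (der_mul (der_cst c t) (Hf t t0))); ring.
- exact: cvgMl_tmp.
- by rewrite mulrBr.
Qed.

(** Monotone convergence along the intervals [1 / (n + 2), 1]. *)
Lemma newton_integral f v : newton f v -> (forall t, t \in `]0, 1] -> 0 <= f t) ->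
  (forall t, 0 < t -> {for t, continuous f}) ->
  (\int[mu]_(t in `]0%R, 1%R]) (f t)%:E = v%:E)%E.
Proof.
move=> [H [a [Hf Ha ->]]] f0 cf.
pose I n := [set` `[(n.+2%:R)^-1, 1 : R]] : set R.
have n0 n : 0 < n.+2%:R^-1 :> R by rewrite invr_gt0.
have n1 n : n.+2%:R^-1 < 1 :> R by rewrite invf_lt1// ltr1n.
have IE : [set` `]0, 1 : R]] = \bigcup_n I n.
  apply/seteqP; split=> t /=.
    rewrite in_itv/= => /andP[t0 t1].
    have [n _ /(_ n (leqnn n))/= nt] := near_infty_natSinv_lt (PosNum t0).
    exists n => //; rewrite /I/= in_itv/= t1 andbT.
    by rewrite (le_trans _ (ltW nt))// lef_pV2 ?posrE// ler_nat.
  move=> [n _]; rewrite /I/= !in_itv/= => /andP[nt ->]; rewrite andbT.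
  by rewrite (lt_le_trans (n0 n)).
have cI n : {within I n, continuous f}.
  apply: continuous_in_subspaceT => t /set_mem; rewrite /I/= in_itv/= => /andP[nt _].
  by apply: cf; rewrite (lt_le_trans (n0 n)).
rewrite [X in integral _ X _]IE.
have mono : (\int[mu]_(t in I n) (f t)%:E)%E @[n --> \oo] -->
    (\int[mu]_(t in \bigcup_n I n) (f t)%:E)%E.
  apply: ge0_nondecreasing_set_cvg_integral.
  - move=> n m nm; apply/subsetPset => t; rewrite /I/= !in_itv/= => /andP[nt ->].
    by rewrite andbT (le_trans _ nt)// lef_pV2 ?posrE// ler_nat !ltnS.
  - by move=> n; exact: measurable_itv.
  - move=> n; apply/measurable_EFinP; apply: subspace_continuous_measurable_fun => //.
    exact: measurable_itv.
  - move=> n t; rewrite /I/= in_itv/= => /andP[nt t1].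
    by rewrite lee_fin f0// in_itv/= t1 andbT (lt_le_trans (n0 n)).
have ftc n : (\int[mu]_(t in I n) (f t)%:E = (H 1 - H (n.+2%:R^-1))%:E)%E.
  rewrite EFinB; apply: (continuous_FTC2 (n1 n) (cI n)).
    split.
    - move=> t; rewrite in_itv/= => /andP[nt _].
      by have [] := Hf t (lt_trans (n0 n) nt).
    - by apply: cvg_at_right_filter; exact: der_continuous (Hf _ (n0 n)).
    - by apply: cvg_at_left_filter; exact: der_continuous (Hf _ ltr01).
  move=> t; rewrite in_itv/= => /andP[nt _].
  by rewrite derive1E; have [_ ->] := Hf t (lt_trans (n0 n) nt).
apply: (cvg_unique _ mono); first exact: ereal_hausdorff.
rewrite (_ : (fun n => _) = EFin \o (fun n => H 1 - H n.+2%:R^-1)); last first.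
  by apply/funext => n; rewrite ftc.
apply: cvg_EFin; first by apply: nearW.
apply: cvgB; first exact: cvg_cst.
apply: (cvg_comp _ _ _ Ha).
apply: cvg_to_at_right; last by near=> n.
apply: cvg_trans (cvg_comp _ _ (cvg_addnr 1) (@cvg_harmonic R)).
by apply: near_eq_cvg; apply: nearW => n /=; rewrite addn1.
Unshelve. all: by end_near. Qed.

End Newton.

Section LogIntegralValues.
Context {R : realType}.
Local Notation mu := (@lebesgue_measure R).
Implicit Types (f g F G : R -> R) (t x v : R) (n : nat) (h : R -> \bar R).

Lemma log_integral_newton a h x f v :
  (forall t, 0 < t -> h (x + t) = (f t)%:E) ->
  (forall t, t \in `]0, 1] -> 0 <= f t) ->
  (forall t, 0 < t -> {for t, continuous f}) ->
  newton (fun t => (- ln t) ^+ a * f t) v ->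
  log_integral a h x = v%:E.
Proof.
move=> hf f0 cf nv.
rewrite -(newton_integral nv).
- rewrite [RHS]integral_mkcond; apply: eq_integral => t _; rewrite patchE.
  case: ifPn => [/set_mem/= tI|/negP tI].
    rewrite log_weightE// hf ?EFinM//.
    by move: tI; rewrite in_itv/= => /andP[].
  by rewrite log_weight_out ?mul0e//; apply/negP => tI'; apply: tI; rewrite mem_set.
- move=> t tI; rewrite mulr_ge0 ?f0// -log_weightE//; exact: log_weight_ge0.
- move=> t t0.
  have h1 : {for t, continuous (fun t : R => (- ln t) ^+ a)}.
    by eapply der_continuous; der_rules.
  exact: (cvgM h1 (cf t t0)).
Qed.

Lemma cvg_lnX_LiN n s x : (2 <= s)%N -> 0 < x ->
  ln t ^+ n * Li s (- (t / x)) @[t --> (0 : R)^'+] --> (0 : R).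
Proof.
move=> s2 x0.
have [d hd] := @derivable_Li0 R s (ltnW s2).
apply: (@cvg_lnX_mul R n (fun t => Li s (- (t / x))) (d * - (1 / x))).
  apply: (@der_comp R (Li s) (fun t => - (t / x))).
    by rewrite mul0r oppr0.
  by derive; field; rewrite gt_eqF.
by rewrite mul0r oppr0 Li0// ltnW.
Qed.

Lemma near_right_le x : 0 < x -> \forall t \near (0 : R)^'+, 0 < t / x <= 1.
Proof.
move=> x0; near=> t.
have t0 : 0 < t by near: t; exact: nbhs_right_gt.
by rewrite divr_gt0//= ler_pdivrMr// mul1r; near: t; exact: nbhs_right_le.
Unshelve. all: by end_near. Qed.

Lemma cvg_lnX_Li2inv n x : 0 < x ->
  ln t ^+ n * Li2inv (x / t) @[t --> (0 : R)^'+] --> (0 : R).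
Proof.
move=> x0; apply: cvg_trans (cvg_lnX_LiN n (isT : (2 <= 2)%N) x0).
apply: near_eq_cvg; near=> t.
rewrite -Li2invE ?invf_div//; near: t; exact: near_right_le.
Unshelve. all: by end_near. Qed.

Lemma cvg_lnX_Li3inv n x : 0 < x ->
  ln t ^+ n * Li3inv (x / t) @[t --> (0 : R)^'+] --> (0 : R).
Proof.
move=> x0; apply: cvg_trans (cvg_lnX_LiN n (isT : (2 <= 3)%N) x0).
apply: near_eq_cvg; near=> t.
rewrite -Li3invE ?invf_div//; near: t; exact: near_right_le.
Unshelve. all: by end_near. Qed.

Lemma cvg_lnX_lnD n x : 0 < x ->
  ln t ^+ n * (ln (x + t) - ln x) @[t --> (0 : R)^'+] --> (0 : R).
Proof.
move=> x0.
apply: (@cvg_lnX_mul R n (fun t => ln (x + t) - ln x) ((0 + 1) / (x + 0) + 0)).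
  by derive => //; rewrite addr0.
by rewrite addr0 subrr.
Qed.

Lemma ln_1Ddiv x t : 0 < x -> 0 < t ->
  ln (1 + x / t) - ln (x / t) = ln (x + t) - ln x.
Proof.
move=> x0 t0; have xt : 0 < x + t by rewrite addr_gt0.
have -> : 1 + x / t = (x + t) / t by field; rewrite gt_eqF.
by rewrite !ln_div ?posrE//; ring.
Qed.

Lemma derive_Li2inv_div x t : 0 < x -> 0 < t ->
  is_derive t (1 : R) (fun t => Li2inv (x / t)) (- (ln (x + t) - ln x) / t).
Proof.
move=> x0 t0; have xt : 0 < x / t by rewrite divr_gt0.
have h := derive_Li2inv xt.
derive; first by rewrite gt_eqF.
by rewrite ln_1Ddiv//; field; rewrite !gt_eqF.
Qed.

Lemma derive_Li3inv_div x t : 0 < x -> 0 < t ->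
  is_derive t (1 : R) (fun t => Li3inv (x / t)) (Li2inv (x / t) / t).
Proof.
move=> x0 t0; have xt : 0 < x / t by rewrite divr_gt0.
have h := derive_Li3inv xt.
derive; first by rewrite gt_eqF.
by move: (Li2inv _) => L; field; rewrite !gt_eqF.
Qed.

Lemma newton_ln_div x : 0 < x -> newton (fun t => ln t / (x + t)) (Li2inv x).
Proof.
move=> x0.
exists (fun t => ln t * (ln (x + t) - ln x) + Li2inv (x / t)), (0 + 0); split.
- move=> t t0; have xt : 0 < x + t by rewrite addr_gt0.
  have h := derive_Li2inv_div x0 t0.
  derive => //.
  by field; rewrite !gt_eqF.
- apply: cvgD.
    by have := cvg_lnX_lnD 1 x0.
  have := cvg_lnX_Li2inv 0 x0; under eq_cvg do rewrite expr0 mul1r; exact.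
- by rewrite ln1 mul0r divr1; ring.
Qed.

Lemma newton_ln2_div x : 0 < x -> newton (fun t => ln t ^+ 2 / (x + t)) (- 2 * Li3inv x).
Proof.
move=> x0.
exists (fun t => ln t ^+ 2 * (ln (x + t) - ln x) + 2 * (ln t * Li2inv (x / t))
  - 2 * Li3inv (x / t)), (0 + 2 * 0 - 2 * 0); split.
- move=> t t0; have xt : 0 < x + t by rewrite addr_gt0.
  have h := derive_Li2inv_div x0 t0; have h3 := derive_Li3inv_div x0 t0.
  derive => //; move: (Li2inv _) (Li3inv _) => L M.
  by field; rewrite !gt_eqF.
- apply: cvgB.
    apply: cvgD; first exact: cvg_lnX_lnD.
    by apply: cvgMl_tmp; have := cvg_lnX_Li2inv 1 x0.
  apply: cvgMl_tmp.
  have := cvg_lnX_Li3inv 0 x0; under eq_cvg do rewrite expr0 mul1r; exact.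
- by rewrite ln1 expr0n/= !mul0r divr1; ring.
Qed.

Lemma inv_continuous_gt0 x t : 0 <= x -> 0 < t -> {for t, continuous (fun t : R => (x + t)^-1)}.
Proof.
move=> x0 t0; eapply der_continuous; der_rules.
by rewrite gt_eqF// ltr_wpDl.
Qed.

Lemma log_integral1_kernel x : 0 < x -> log_integral 1 inv_kernel x = (- Li2inv x)%:E.
Proof.
move=> x0; apply: (@log_integral_newton _ _ _ (fun t => (x + t)^-1)).
- by move=> t t0; rewrite inv_kernelE// addr_gt0.
- by move=> t; rewrite in_itv/= => /andP[t0 _]; rewrite invr_ge0 addr_ge0// ltW.
- by move=> t; apply: inv_continuous_gt0; exact: ltW.
rewrite -mulN1r; apply: eq_newton (newtonZ (-1) (newton_ln_div x0)) => t _.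
by rewrite expr1; ring.
Qed.

Lemma log_integral2_kernel x : 0 < x -> log_integral 2 inv_kernel x = (- 2 * Li3inv x)%:E.
Proof.
move=> x0; apply: (@log_integral_newton _ _ _ (fun t => (x + t)^-1)).
- by move=> t t0; rewrite inv_kernelE// addr_gt0.
- by move=> t; rewrite in_itv/= => /andP[t0 _]; rewrite invr_ge0 addr_ge0// ltW.
- by move=> t; apply: inv_continuous_gt0; exact: ltW.
apply: eq_newton (newton_ln2_div x0) => t _.
by rewrite sqrrN.
Qed.

End LogIntegralValues.

(** * Iterated unit integrals as finite differences *)

Section FiniteDifferences.
Context {R : realType}.
Implicit Types (f g F G : R -> R) (t x v : R) (n k : nat) (h : R -> \bar R).

Fixpoint fdiff n F x : R :=
  if n is m.+1 then fdiff m F (x + 1) - fdiff m F x else F x.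

Lemma fdiffE n F x :
  fdiff n F x = \sum_(0 <= j < n.+1) (-1) ^+ (n - j) * 'C(n, j)%:R * F (x + j%:R).
Proof.
elim: n x => [|n IH] x; first by rewrite big_nat1 bin0 expr0 !mul1r addr0.
rewrite /= !IH.
have -> : \sum_(0 <= j < n.+1) (-1) ^+ (n - j) * 'C(n, j)%:R * F (x + 1 + j%:R) =
    \sum_(0 <= j < n.+2) (-1) ^+ (n.+1 - j) * (if j is i.+1 then 'C(n, i)%:R else 0) *
       F (x + j%:R).
  rewrite [RHS]big_nat_recl//= mulr0 mul0r add0r; apply: eq_bigr => j _.
  by rewrite subSS -addrA (addrC 1) natr1.
have -> : \sum_(0 <= j < n.+1) (-1) ^+ (n - j) * 'C(n, j)%:R * F (x + j%:R) =
    - \sum_(0 <= j < n.+2) (-1) ^+ (n.+1 - j) * 'C(n, j)%:R * F (x + j%:R).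
  rewrite [in RHS]big_nat_recr//= bin_small// mulr0 mul0r addr0 -sumrN.
  apply: eq_big_nat => j /andP[_ jn]; rewrite subSn// exprS; ring.
rewrite opprK -big_split/=; apply: eq_bigr => -[|j] _.
  by rewrite !bin0 mulr0 mul0r add0r.
by rewrite binS natrD; ring.
Qed.

Lemma fdiffD n F G x : fdiff n (fun t => F t + G t) x = fdiff n F x + fdiff n G x.
Proof. by elim: n x => [|n IH] x //=; rewrite !IH; ring. Qed.

Lemma fdiffZ n c F x : fdiff n (fun t => c * F t) x = c * fdiff n F x.
Proof. by elim: n x => [|n IH] x //=; rewrite !IH; ring. Qed.

Lemma fdiff_shift n F x : fdiff n.+1 F x = fdiff n (fun t => F (t + 1) - F t) x.
Proof.
by elim: n x => [|n IH] x //; rewrite [LHS]/= -/(fdiff n.+1 F _) -/(fdiff n.+1 F x) !IH.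
Qed.

(** Each difference lowers the degree. *)
Lemma fdiff_poly n (p : {poly R}) x : (size p <= n)%N -> fdiff n (fun t => p.[t]) x = 0.
Proof.
elim: n p x => [|n IH] p x pn.
  by move: pn; rewrite leqn0 size_poly_eq0 => /eqP -> /=; rewrite horner0.
rewrite fdiff_shift.
have -> : (fun t => p.[t + 1] - p.[t]) = (fun t => (p \Po ('X + 1%:P) - p).[t]).
  by apply/funext => t; rewrite hornerD hornerN horner_comp !hornerE.
apply: IH; have [->|p0] := eqVneq p 0; first by rewrite comp_poly0 subrr size_poly0.
have sX : size ('X + 1%:P : {poly R}) = 2 by rewrite size_XaddC.
have sc : size (p \Po ('X + 1%:P)) = size p by rewrite size_comp_poly2.
have p_gt0 : (0 < size p)%N by rewrite lt0n size_poly_eq0.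
apply: (@leq_trans (size p).-1); last by rewrite -ltnS prednK.
apply/leq_sizeP => j; rewrite leq_eqVlt coefB => /predU1P[<-|pj]; last first.
  by rewrite prednK// in pj; rewrite !nth_default ?sc// subrr.
rewrite -[X in _ - X]/(lead_coef p) -{1}sc -[X in X - _]/(lead_coef (p \Po _)).
by rewrite lead_coef_comp ?sX// lead_coefXaddC expr1n mulr1 subrr.
Qed.

(** The intermediate derivatives are witnesses, which spares an operator of
    iterated derivation with its differentiability conditions. *)
Fixpoint iter_primitive n F G : Prop :=
  if n is m.+1 then
    exists2 F1, iter_primitive m F1 G & forall x, 0 < x -> is_derive x (1 : R) F (F1 x)
  else forall x, 0 < x -> F x = G x.

Lemma iter_primitive_continuous n F G : iter_primitive n F G ->
  (forall x, 0 < x -> {for x, continuous G}) ->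
  forall x, 0 < x -> {for x, continuous F}.
Proof.
case: n => [|n] /= FG cG x x0; last by have [F1 _ h] := FG; exact: der_continuous (h x x0).
have -> : {for x, continuous F} = (F t @[t --> x] --> F x) by [].
rewrite FG//; apply: cvg_trans (cG x x0); apply: near_eq_cvg.
near=> t; rewrite FG//; near: t; exact: lt_nbhsr.
Unshelve. all: by end_near. Qed.

Lemma derive_fdiff n F F1 : (forall x, 0 < x -> is_derive x (1 : R) F (F1 x)) ->
  forall x, 0 < x -> is_derive x (1 : R) (fdiff n F) (fdiff n F1 x).
Proof.
move=> h; elim: n => [|n IH] x x0 /=; first exact: h.
have h1 := IH _ (addr_gt0 x0 ltr01); have h0 := IH x x0.
by derive; ring.
Qed.

Lemma fdiff_continuous n F : (forall x, 0 < x -> {for x, continuous F}) ->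
  forall x, 0 < x -> {for x, continuous (fdiff n F)}.
Proof.
move=> h; elim: n => [|n IH] x x0 /=; first exact: h.
have h1 := IH _ (addr_gt0 x0 ltr01); have h0 := IH x x0.
apply: (@cvgB _ _ _ _ _ (fun t => fdiff n F (t + 1))) h0.
apply: (@continuous_comp _ _ _ (fun t : R => t + 1)) => //.
by eapply der_continuous; der_rules.
Qed.

Lemma fdiff_cvg_at_right0 n F : (forall x, 0 < x -> {for x, continuous F}) ->
  F t @[t --> (0 : R)^'+] --> F 0 -> fdiff n F t @[t --> (0 : R)^'+] --> fdiff n F 0.
Proof.
move=> cF F0; elim: n => [|n IH] //=.
apply: (@cvgB _ _ _ _ _ (fun t => fdiff n F (t + 1))) IH.
apply: (@cvg_at_right_continuous R (fun t => fdiff n F (t + 1))).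
apply: (@continuous_comp _ _ _ (fun t : R => t + 1)).
  by eapply der_continuous; der_rules.
by apply: fdiff_continuous => //; rewrite add0r.
Qed.

(** By the fundamental theorem of calculus, one unit integral turns F' into the
    difference F (x + 1) - F x. *)
Lemma iter_log_integral0 n F G h : nonneg_measurable h ->
  (forall x, 0 < x -> h x = (G x)%:E) ->
  (forall x, 0 < x -> {for x, continuous G}) ->
  iter_primitive n F G ->
  (forall x, 0 < x -> iter n (log_integral 0) h x = (fdiff n F x)%:E) /\
  ((0 < n)%N -> F t @[t --> (0 : R)^'+] --> F 0 ->
    iter n (log_integral 0) h 0 = (fdiff n F 0)%:E).
Proof.
move=> nh hG cG; elim: n F => [|n IH] F FG.
  by split=> // x x0; rewrite /= hG// FG.
have [F1 F1G hF] := FG; have [IHp _] := IH F1 F1G.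
have cF := iter_primitive_continuous FG cG.
have step x : 0 <= x -> fdiff n F t @[t --> x^'+] --> fdiff n F x ->
    iter n.+1 (log_integral 0) h x = (fdiff n.+1 F x)%:E.
  move=> x0 cx; rewrite iterS.
  apply: (@log_integral_newton _ _ _ _ (fun t => fdiff n F1 (x + t))).
  - by move=> t t0; rewrite IHp// ltr_wpDl.
  - move=> t; rewrite in_itv/= => /andP[t0 _]; rewrite -lee_fin -IHp ?ltr_wpDl//.
    by case: (iter_log_integral_nonneg 0 n nh).
  - move=> t t0; apply: (@continuous_comp _ _ _ (fun t => x + t)).
      by eapply der_continuous; der_rules.
    apply: fdiff_continuous; last by rewrite ltr_wpDl.
    exact: iter_primitive_continuous F1G cG.
  exists (fun t => fdiff n F (x + t)), (fdiff n F x); split=> //.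
  - move=> t t0; have xt : 0 < x + t by rewrite ltr_wpDl.
    have hd := derive_fdiff n hF xt.
    by derive; rewrite expr0; ring.
  - apply: (cvg_comp _ _ _ cx); apply: cvg_to_at_right.
      have : {for 0, continuous (fun t : R => x + t)} by eapply der_continuous; der_rules.
      by move=> /cvg_at_right_continuous; rewrite addr0.
    by near=> t; rewrite ltrDl; near: t; exact: nbhs_right_gt.
split=> [x x0|_ F0].
  apply: step; first exact: ltW.
  by apply: cvg_at_right_continuous; exact: fdiff_continuous.
by apply: step => //; exact: fdiff_cvg_at_right0.
Unshelve. all: by end_near. Qed.

End FiniteDifferences.

Section PolynomialRecursions.
Context {R : realType}.
Implicit Types (p B C : {poly R}) (n k : nat).

Lemma HarmS n : Harm R n.+1 = Harm R n + n.+1%:R^-1.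
Proof. by rewrite /Harm big_nat_recr. Qed.

Lemma Harm2S n : Harm2 R n.+1 = Harm2 R n + (n.+1%:R ^+ 2)^-1.
Proof. by rewrite /Harm2 big_nat_recr. Qed.

Lemma factS_unit n : n`!%:R != 0 :> R.
Proof. by rewrite pnatr_eq0 -lt0n fact_gt0. Qed.

Lemma derivXn_scale n : ('X^(n.+1))^`() = (n.+1%:R : R) *: 'X^n :> {poly R}.
Proof. by rewrite derivXn scaler_nat. Qed.

Lemma calC_deriv n :
  (calC n.+2)^`() = calC n.+1 + n.+1`!%:R^-1 *: 'X^n :> {poly R}.
Proof.
rewrite /calC /= derivZ derivXn_scale scalerA -scalerDl HarmS factS natrM.
congr (_ *: _); have := factS_unit n; set m := n`!%:R => m0.
by field; rewrite m0/= addrC natr1 pnatr_eq0.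
Qed.

Lemma calCminus_deriv n :
  (calCminus n.+2)^`() = calCminus n.+1 - (2 * Harm R n.+1 / n.+1`!%:R) *: 'X^n :> {poly R}.
Proof.
rewrite /calCminus /= derivN derivZ derivXn_scale scalerA -opprD -scalerDl.
congr (- (_ *: _)); rewrite HarmS Harm2S factS natrM.
have := factS_unit n; set m := n`!%:R => m0.
by field; rewrite m0/= addrC natr1 pnatr_eq0.
Qed.

Lemma calCplus_deriv n :
  (calCplus n.+2)^`() = calCplus n.+1 + (2 * Harm R n.+1 / n.+1`!%:R) *: 'X^n :> {poly R}.
Proof. by rewrite [calCplus n.+2]/= deriv_primitive_from. Qed.

Lemma calCplus_root n : (calCplus n.+1).[-1] = 0 :> R.
Proof. by case: n => [|n]; rewrite [calCplus _]/= ?horner0// horner_primitive_from. Qed.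

Lemma calB_root n : (calB n).[-1] = 0 :> R.
Proof.
rewrite /calB hornerN hornerZ horner_sum big_nat big1 ?mulr0 ?oppr0// => i /andP[i0 _].
by rewrite hornerZ horner_exp !hornerE addNr expr0n gtn_eqF// mulr0.
Qed.

(** The monomial is expanded in powers of X + 1, in which calB is given; the
    identity i 'C(n, i) = n 'C(n - 1, i - 1) then compares the coefficients. *)
Lemma calB_deriv n :
  (calB n.+2)^`() = calB n.+1 - n.+1`!%:R^-1 *: 'X^n :> {poly R}.
Proof.
rewrite /calB /= derivN derivZ -opprD; congr (- _).
rewrite (big_morph _ (@derivD R) (@deriv0 R)) big_add1/=.
have n1 := factS_unit n; have n2 := factS_unit n.+1.
have nz : n.+1%:R != 0 :> R by rewrite pnatr_eq0.
have binom : 'X^n = \sum_(0 <= i < n.+1) ((-1) ^+ (n - i) * 'C(n, i)%:R) *: ('X + 1) ^+ i :> {poly R}.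
  rewrite -[in LHS](addKr 1 'X) (addrC 1) exprDn big_mkord; apply: eq_bigr => i _.
  rewrite -mulr_natr -mul_polyC rmorphM/= rmorphXn rmorphN rmorph1 rmorph_nat.
  by rewrite mulrAC.
have e0 : cB n.+1 0 = 0 :> R by rewrite /cB !subn0 subn1/= subrr mulr0.
have -> : \sum_(1 <= i < n.+1) cB n.+1 i *: ('X + 1) ^+ i =
    \sum_(0 <= i < n.+1) cB n.+1 i *: ('X + 1) ^+ i :> {poly R}.
  by rewrite [RHS]big_ltn// e0 scale0r add0r.
rewrite binom !scaler_sumr -big_split/=; apply: eq_big_nat => i /andP[_ ni].
have d1 : ('X + 1%:P)^`() = 1 :> {poly R} by rewrite derivD derivX derivC addr0.
rewrite polyC1 in d1; rewrite derivZ deriv_exp d1 mul1r -(scaler_nat i.+1).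
rewrite !scalerA -scalerDl; congr (_ *: _).
have bin : (i.+1%:R * 'C(n.+1, i.+1)%:R : R) = n.+1%:R * 'C(n, i)%:R.
  by rewrite -!natrM mul_bin_diag.
rewrite /cB !subSS !subn0 !(subnAC _ _ 1) !subn1/= HarmS factS natrM.
move: bin; set m := n`!%:R => bin.
transitivity (((n.+1%:R : R) * m)^-1 * (-1) ^+ (n - i) *
  (i.+1%:R * 'C(n.+1, i.+1)%:R) * (Harm R n + n.+1%:R^-1 - Harm R (n - i))).
  by ring.
rewrite bin; move: (Harm R n) (Harm R (n - i)) n1 nz => h h' n1 nz.
by field; rewrite n1/= addrC natr1.
Qed.

Lemma size_from_deriv p n : (size p^`() <= n)%N -> (size p <= n.+1)%N.
Proof.
move=> pn; apply/leq_sizeP => -[//|j] nj.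
have /eqP : p^`()`_j = 0 by move/leq_sizeP: pn; apply.
by rewrite coef_deriv mulrn_eq0/= => /eqP.
Qed.

Lemma size_primitive p n : (size p <= n)%N -> (size (primitive p) <= n.+1)%N.
Proof. by move=> pn; rewrite (leq_trans (size_poly _ _)). Qed.

End PolynomialRecursions.

Section LogChains.
Context {R : realType}.
Implicit Types (p B C P : {poly R}) (n k : nat) (u G : R -> R) (x t : R).

(** The antiderivatives below are determined up to polynomials of small degree,
    which finite differences kill.  Divisibility of the coefficients of the two
    logarithms by 1 + x and x keeps the remainder polynomial, and the cancellation
    of their leading terms keeps its degree small. *)
Definition log_chain n u B C G := exists P,
  [/\ (size P <= n)%N, (size (B + C)%R <= n)%N, (size B <= n.+1)%N, (size C <= n.+1)%N
    & iter_primitive n (fun x => u x + B.[x] * ln (1 + x) + C.[x] * ln x + P.[x]) G].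

Lemma log_chain_step n u0 u B0 B C0 C p G :
  log_chain n u0 B0 C0 G -> (size p <= n.+1)%N ->
  (forall x, 0 < x -> is_derive x (1 : R) u (u0 x + p.[x] * (ln (1 + x) - ln x))) ->
  B^`() = B0 - p -> C^`() = C0 + p -> B.[-1] = 0 -> C.[0] = 0 ->
  log_chain n.+1 u B C G.
Proof.
move=> [P [sP sBC sB sC chain]] sp hu dB dC B1 C1.
have sB' : (size B <= n.+2)%N.
  by apply: size_from_deriv; rewrite dB (leq_trans (size_polyD _ _))// size_polyN geq_max sB.
have sC' : (size C <= n.+2)%N.
  by apply: size_from_deriv; rewrite dC (leq_trans (size_polyD _ _))// geq_max sC.
have sBC' : (size (B + C)%R <= n.+1)%N.
  by apply: size_from_deriv; rewrite derivD dB dC addrACA addNr addr0.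
have /factor_theorem[b Bb] : root B (-1) by apply/rootP.
have /factor_theorem[c Cc] : root C 0 by apply/rootP.
rewrite polyCN opprK in Bb; rewrite subr0 in Cc.
have size_quo (q : {poly R}) (a : R) : (size (q * ('X + a%:P))%R <= n.+2)%N -> (size q <= n.+1)%N.
  have [->|q0] := eqVneq q 0; first by rewrite size_poly0.
  by rewrite size_Mmonic ?monicXaddC// size_XaddC addn2.
have sb : (size b <= n.+1)%N by apply: (size_quo b 1); rewrite -Bb.
have sc : (size c <= n.+1)%N by apply: (size_quo c 0); rewrite polyC0 addr0 -Cc.
have sbc : (size (b + c)%R <= n)%N.
  apply/leq_sizeP => j; rewrite leq_eqVlt => /predU1P[<-|nj]; last first.
    by apply/leq_sizeP: nj; rewrite (leq_trans (size_polyD _ _))// geq_max sb.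
  have : (B + C)`_n.+1 = 0 by apply/leq_sizeP: (leqnn n.+1).
  by rewrite Bb Cc mulrDr mulr1 !coefD !coefMX/= [b`_n.+1]nth_default// addr0.
exists (primitive (P - (b + c))); split => //.
  by apply: size_primitive; rewrite (leq_trans (size_polyD _ _))// size_polyN geq_max sP.
exists (fun x => u0 x + B0.[x] * ln (1 + x) + C0.[x] * ln x + P.[x]) => // x x0.
have x1 : 0 < 1 + x by rewrite addr_gt0.
have hux := hu x x0.
have dP : (primitive (P - (b + c)))^`() = P - (b + c).
  have := deriv_primitive_from (0 : R) (P - (b + c)).
  by rewrite /primitive_from derivB derivC subr0.
derive => //; rewrite dP dB dC.
have -> : B.[x] = b.[x] * (1 + x) by rewrite Bb !hornerE addrC.
have -> : C.[x] = c.[x] * x by rewrite Cc !hornerE.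
rewrite !(hornerD, hornerN); by field; rewrite !gt_eqF.
Qed.

Lemma Xn_eval c n x : (c *: 'X^n : {poly R}).[x] = c * x ^+ n.
Proof. by rewrite hornerZ hornerXn. Qed.

Lemma size_ZXn c n : (size (c *: 'X^n : {poly R}) <= n.+1)%N.
Proof. by rewrite (leq_trans (size_scale_leq _ _))// size_polyXn. Qed.

(** The derivative of x ^ n Li2inv / n! is its predecessor plus a monomial times
    ln (1 + x) - ln x, and the monomial is absorbed by calB and calC. *)
Lemma log_chain_Li2 n :
  log_chain n (fun x => - (x ^+ n / n`!%:R * Li2inv x)) (- calB n.+1) (- calC n.+1)
    (fun x => - Li2inv x).
Proof.
elim: n => [|n IH].
  exists 0; rewrite /calB /calC !big_geq//= /Harm big_geq// mul0r scale0r scaler0 oppr0.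
  rewrite oppr0 addr0 size_poly0; split=> // x _.
  by rewrite !horner0 !mul0r !addr0 expr0 divr1 mul1r.
have nz : (n.+1%:R : R) != 0 by rewrite pnatr_eq0.
have f0 := @factS_unit R n; have f1 := @factS_unit R n.+1.
apply: (log_chain_step IH (p := - (n.+1`!%:R^-1 *: 'X^n))).
- by rewrite size_polyN size_ZXn.
- move=> x x0; have h := derive_Li2inv x0.
  derive; rewrite hornerN Xn_eval factS natrM exprS/=.
  move: (Li2inv x) (ln x) (ln (1 + x)) f0; set m := n`!%:R => L2 l l1 m0.
  by field; rewrite m0 (addrC 1) natr1 nz gt_eqF.
- by rewrite derivN calB_deriv opprD.
- by rewrite derivN calC_deriv opprD.
- by rewrite hornerN calB_root oppr0.
- by rewrite hornerN /calC /= Xn_eval expr0n/= mulr0 oppr0.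
Qed.

(** The harmonic number is chosen so that the derivative contains no monomial
    multiple of Li2inv beyond the predecessor. *)
Lemma log_chain_Li3 n :
  log_chain n (fun x => - (2 * x ^+ n / n`!%:R * (Li3inv x + Harm R n * Li2inv x)))
    (calCplus n.+1) (calCminus n.+1) (fun x => - 2 * Li3inv x).
Proof.
elim: n => [|n IH].
  exists 0; rewrite /calCplus /calCminus /Harm /Harm2 !big_geq//=.
  rewrite expr0n/= addr0 mul0r scale0r oppr0 addr0 size_poly0; split=> // x _.
  by rewrite !horner0 !mul0r !addr0 expr0 divr1 mulr1 mulNr.
have nz : (n.+1%:R : R) != 0 by rewrite pnatr_eq0.
have f0 := @factS_unit R n; have f1 := @factS_unit R n.+1.
apply: (log_chain_step IH (p := - ((2 * Harm R n.+1 / n.+1`!%:R) *: 'X^n))).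
- by rewrite size_polyN size_ZXn.
- move=> x x0; have h2 := derive_Li2inv x0; have h3 := derive_Li3inv x0.
  derive; rewrite hornerN Xn_eval HarmS factS natrM exprS/=.
  move: (Li3inv x) (Li2inv x) (Harm R n) (ln x) (ln (1 + x)) f0; set m := n`!%:R.
  move=> L3 L2 H l l1 m0.
  by field; rewrite m0 (addrC 1) natr1 nz gt_eqF.
- by rewrite calCplus_deriv opprK.
- by rewrite calCminus_deriv.
- exact: calCplus_root.
- by rewrite /calCminus hornerN Xn_eval expr0n/= mulr0 oppr0.
Qed.

End LogChains.

(** * The closed forms valid for every number of variables *)

Section ClosedForms.
Context {R : realType}.
Implicit Types (p B C P : {poly R}) (n k m j : nat) (u G F : R -> R) (x t : R).

Lemma cvg_mul_logit n : t * (ln t - ln (1 + t)) ^+ n @[t --> (0 : R)^'+] --> (0 : R).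
Proof.
have cs : t / (1 + t) @[t --> (0 : R)^'+] --> (0 : R)^'+.
  apply: cvg_to_at_right.
    have h : is_derive (0 : R) (1 : R) (fun t : R => t / (1 + t))
        (0 * (- (0 + 1) / (1 + 0) ^+ 2) + 1 / (1 + 0)).
      by derive => //=; rewrite addr0 oner_neq0.
    by have := cvg_at_right_continuous (der_continuous h); rewrite mul0r.
  near=> t.
  have t0 : 0 < t by near: t; exact: nbhs_right_gt.
  by rewrite divr_gt0// addr_gt0.
have c1 : 1 + t @[t --> (0 : R)^'+] --> (1 + 0 : R).
  apply: (@cvg_at_right_continuous R (fun t => 1 + t)).
  by eapply der_continuous; der_rules.
have : ln (t / (1 + t)) ^+ n * (t / (1 + t)) * (1 + t) @[t --> (0 : R)^'+]
    --> (0 * (1 + 0) : R).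
  by apply: cvgM => //; exact: (cvg_comp _ _ cs (cvg_lnX_mul_id n)).
rewrite mul0r.
apply: cvg_trans; apply: near_eq_cvg; near=> t.
have t0 : 0 < t by near: t; exact: nbhs_right_gt.
have t1 : 0 < 1 + t by rewrite addr_gt0.
rewrite /= ln_div ?posrE// -mulrA divfK ?gt_eqF//; exact: mulrC.
Unshelve. all: by end_near. Qed.

Lemma cvg_mul_Li2inv : t * Li2inv t @[t --> (0 : R)^'+] --> (0 : R).
Proof.
have c0 : t @[t --> (0 : R)^'+] --> (0 : R) by exact: cvg_at_right_filter.
have : - (t * Li 2 (1 + t)^-1) - t * (ln t - ln (1 + t)) ^+ 2 / 2 @[t --> (0 : R)^'+]
    --> (- (0 * Li 2 (1 : R)) - 0 / 2 : R).
  apply: cvgB.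
    by apply: cvgN; apply: cvgM => //; exact: cvg_Li_inv1D_at_right0.
  by apply: cvgMr_tmp; exact: cvg_mul_logit.
rewrite !mul0r oppr0 addr0; apply: cvg_trans; apply: near_eq_cvg; apply: nearW => t.
rewrite /Li2inv; move: (Li 2 _) => L; by field.
Qed.

Lemma cvg_mul_Li3inv : t * Li3inv t @[t --> (0 : R)^'+] --> (0 : R).
Proof.
have c0 : t @[t --> (0 : R)^'+] --> (0 : R) by exact: cvg_at_right_filter.
have cln : ln (1 + t) @[t --> (0 : R)^'+] --> (0 : R) by exact: cvg_ln1D_at_right0.
have : t * zeta R 3 + t * (ln t - ln (1 + t)) ^+ 3 / 6
    + pi ^+ 2 / 6 * (t * (ln t - ln (1 + t)) ^+ 1)
    + t * (ln t - ln (1 + t)) ^+ 2 * ln (1 + t) / 2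
    - t * Li 3 (t / (1 + t)) - t * Li 3 (1 + t)^-1 @[t --> (0 : R)^'+]
    --> (0 * zeta R 3 + 0 / 6 + pi ^+ 2 / 6 * 0 + 0 * 0 / 2
      - 0 * Li 3 (0 : R) - 0 * Li 3 (1 : R) : R).
  apply: cvgB; last by apply: cvgM => //; exact: cvg_Li_inv1D_at_right0.
  apply: cvgB; last by apply: cvgM => //; exact: cvg_Li_div1D_at_right0.
  apply: cvgD; last by apply: cvgMr_tmp; apply: cvgM => //; exact: cvg_mul_logit.
  apply: cvgD; last by apply: cvgMl_tmp; exact: cvg_mul_logit.
  apply: cvgD; last by apply: cvgMr_tmp; exact: cvg_mul_logit.
  by apply: cvgM => //; exact: cvg_cst.
rewrite !mul0r mulr0 !addr0 !subr0.
apply: cvg_trans; apply: near_eq_cvg; apply: nearW => t.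
rewrite /Li3inv expr1; move: (pi) (zeta R 3) (Li 3 _) (Li 3 _) => p z L M; by field.
Qed.

(** The differences of order [n] kill the remainder [P] of degree less than [n]. *)
Lemma log_chain_integral n u B C G (h : R -> \bar R) : (0 < n)%N -> nonneg_measurable h ->
  (forall x, 0 < x -> h x = (G x)%:E) ->
  (forall x, 0 < x -> {for x, continuous G}) ->
  log_chain n u B C G ->
  (forall x, 0 < x -> iter n (log_integral 0) h x =
    (fdiff n (fun x => u x + B.[x] * ln (1 + x) + C.[x] * ln x) x)%:E) /\
  (u t @[t --> (0 : R)^'+] --> u 0 -> C.[0] = 0 ->
   iter n (log_integral 0) h 0 =
    (fdiff n (fun x => u x + B.[x] * ln (1 + x) + C.[x] * ln x) 0)%:E).
Proof.
move=> n0 nh hG cG [P [sP _ _ _ chain]].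
have noP x : fdiff n (fun x => u x + B.[x] * ln (1 + x) + C.[x] * ln x + P.[x]) x =
    fdiff n (fun x => u x + B.[x] * ln (1 + x) + C.[x] * ln x) x.
  by rewrite fdiffD (fdiff_poly _ sP) addr0.
have [pos zero] := iter_log_integral0 nh hG cG chain.
split=> [x x0|cu C0]; first by rewrite pos// noP.
rewrite zero// ?noP//.
apply: cvgD; last first.
  exact: cvg_at_right_continuous (der_continuous (der_horner P 0)).
apply: cvgD.
  apply: cvgD => //; apply: cvgM.
    exact: cvg_at_right_continuous (der_continuous (der_horner B 0)).
  by rewrite addr0 ln1; exact: cvg_ln1D_at_right0.
rewrite C0 mul0r.
have := @cvg_lnX_mul R 1 (fun t => C.[t]) _ (der_horner C 0) C0.
by apply: cvg_trans; apply: near_eq_cvg; apply: nearW => t; rewrite expr1 mulrC.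
Qed.

(** The harmonic number makes the derivatives close up; as it multiplies x ^ n, it
    disappears from the differences of order n + 1. *)
Lemma inv_primitive n :
  iter_primitive n.+1 (fun x : R => x ^+ n / n`!%:R * (ln x - Harm R n)) (fun x => x^-1).
Proof.
elim: n => [|n IH].
  exists (fun x => x^-1) => //= x x0; rewrite /Harm big_geq//.
  derive => //; rewrite expr0 fact0 divr1; by field; rewrite gt_eqF.
exists (fun x : R => x ^+ n / n`!%:R * (ln x - Harm R n)) => // x x0.
have nz : (n.+1%:R : R) != 0 by rewrite pnatr_eq0.
have f0 := @factS_unit R n.
derive => //; rewrite HarmS factS natrM exprS/=.
move: (Harm R n) f0; set m := n`!%:R => H m0.
by field; rewrite m0 (addrC 1) natr1 nz gt_eqF.
Qed.

Lemma E_int0 k : E_int R k.+2 0 = ((k.+1`!%:R)^-1 *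
    \sum_(2 <= j < k.+3)
      (-1) ^+ (k.+2 + j) * j%:R ^+ k.+1 * 'C(k.+2, j)%:R * ln (j%:R : R))%:E.
Proof.
rewrite E_intE weight_integral0; last exact: inv_kernel_nonneg.
have hG x : 0 < x -> inv_kernel x = (x^-1)%:E by exact: inv_kernelE.
have cG x : 0 < x -> {for x, continuous (fun x : R => x^-1)}.
  by move=> x0; eapply der_continuous; der_rules; rewrite gt_eqF.
have [_ ->//] := iter_log_integral0 inv_kernel_nonneg hG cG (inv_primitive k.+1).
  congr (_%:E).
  have -> : (fun x : R => x ^+ k.+1 / k.+1`!%:R * (ln x - Harm R k.+1)) =
      (fun x : R => k.+1`!%:R^-1 * (x ^+ k.+1 * ln x) +
        ((- (Harm R k.+1 / k.+1`!%:R)) *: 'X^(k.+1) : {poly R}).[x]).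
    by apply/funext => x; rewrite Xn_eval; ring.
  rewrite fdiffD fdiff_poly ?size_ZXn// addr0 fdiffZ fdiffE; congr (_ * _).
  rewrite big_ltn// big_ltn//= !add0r expr0n mul0r mulr0 ln1 !mulr0 !add0r.
  apply: eq_big_nat => j /andP[_ jk].
  have -> : (-1) ^+ (k.+2 - j) = (-1) ^+ (k.+2 + j) :> R.
    by rewrite -signr_odd oddB// -oddD signr_odd.
  by rewrite add0r; ring.
rewrite expr0n/= mul0r mul0r.
have c0 : t @[t --> (0 : R)^'+] --> (0 : R) by exact: cvg_at_right_filter.
have : t ^+ k / k.+1`!%:R * (ln t ^+ 1 * t - Harm R k.+1 * t) @[t --> (0 : R)^'+]
    --> (0 ^+ k / k.+1`!%:R * (0 - Harm R k.+1 * 0) : R).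
  apply: cvgM.
    by apply: cvgMr_tmp; exact: continuous_cvg (@exprn_continuous R k _) c0.
  by apply: cvgB; [exact: cvg_lnX_mul_id|exact: cvgMl_tmp].
rewrite mulr0 subr0 mulr0; apply: cvg_trans; apply: near_eq_cvg; apply: nearW => t.
by rewrite expr1 exprS; ring.
Qed.

Lemma Li2inv_nat m : (0 < m)%N -> Li2inv (m%:R : R) = Li 2 (- (m%:R^-1)).
Proof.
move=> m0; rewrite -Li2invE ?invrK// invr_gt0 ltr0n m0/=.
by rewrite invf_le1 ?ltr0n// ler1n.
Qed.

Lemma Li3inv_nat m : (0 < m)%N -> Li3inv (m%:R : R) = Li 3 (- (m%:R^-1)).
Proof.
move=> m0; rewrite -Li3invE ?invrK// invr_gt0 ltr0n m0/=.
by rewrite invf_le1 ?ltr0n// ler1n.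
Qed.

Lemma Li2_N1 : Li 2 (- 1 : R) = - pi ^+ 2 / 12.
Proof.
have n1 : `|1 : R| <= 1 by rewrite normr1.
have := Li_duplication (isT : (2 <= 2)%N) n1; rewrite expr1n Li2_1.
by move: (pi) (Li 2 _) => p L h; lra.
Qed.

Lemma Li3_N1 : Li 3 (- 1 : R) = - 3 / 4 * zeta R 3.
Proof.
have n1 : `|1 : R| <= 1 by rewrite normr1.
have := Li_duplication (isT : (2 <= 3)%N) n1; rewrite expr1n Li3_1.
by move: (zeta R 3) (Li 3 _) => p L h; lra.
Qed.

Lemma Li2inv_1 : Li2inv (1 : R) = - pi ^+ 2 / 12.
Proof. by have := @Li2inv_nat 1 isT; rewrite invr1 Li2_N1. Qed.

Lemma Li3inv_1 : Li3inv (1 : R) = - 3 / 4 * zeta R 3.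
Proof. by have := @Li3inv_nat 1 isT; rewrite invr1 Li3_N1. Qed.

Lemma log_integral1_nonneg : nonneg_measurable (log_integral 1 (@inv_kernel R)).
Proof. exact: log_integral_nonneg inv_kernel_nonneg. Qed.

Definition log_moment1 n (x : R) := - (x ^+ n / n`!%:R * Li2inv x)
  + (- calB n.+1).[x] * ln (1 + x) + (- calC n.+1).[x] * ln x.

Lemma log_moment1_integral n : (0 < n)%N ->
  (forall x, 0 < x -> iter n (log_integral 0) (log_integral 1 inv_kernel) x =
    (fdiff n (log_moment1 n) x)%:E) /\
  iter n (log_integral 0) (log_integral 1 inv_kernel) 0 = (fdiff n (log_moment1 n) 0)%:E.
Proof.
move=> n0.
have hG x : 0 < x -> log_integral 1 inv_kernel x = (- Li2inv x)%:E.
  exact: log_integral1_kernel.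
have cG x : 0 < x -> {for x, continuous (fun x : R => - Li2inv x)}.
  by move=> x0; apply: der_continuous; exact: (der_opp (derive_Li2inv x0)).
have [pos zero] := log_chain_integral n0 log_integral1_nonneg hG cG (@log_chain_Li2 R n).
split=> //; apply: zero; last first.
  by rewrite hornerN /calC Xn_eval expr0n eqn0Ngt n0 mulr0 oppr0.
case: n n0 {pos} => // n _.
have c0 : t @[t --> (0 : R)^'+] --> (0 : R) by exact: cvg_at_right_filter.
have : - (t ^+ n / n.+1`!%:R * (t * Li2inv t)) @[t --> (0 : R)^'+]
    --> (- (0 ^+ n / n.+1`!%:R * 0) : R).
  apply: cvgN; apply: cvgM cvg_mul_Li2inv.
  by apply: cvgMr_tmp; exact: continuous_cvg (@exprn_continuous R n _) c0.
rewrite mulr0 expr0n/= !mul0r; apply: cvg_trans; apply: near_eq_cvg; apply: nearW => t.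
by rewrite exprS; move: (Li2inv t) => L; ring.
Qed.

Lemma signr_subn n j : (j <= n)%N -> (-1) ^+ (n.+1 - j) = - (-1) ^+ (n - j) :> R.
Proof. by move=> jn; rewrite subSn// exprS mulN1r. Qed.

(** ln m receives calC at j = m and calB at j = m - 1 from the difference formula;
    the dilogarithm at j = 1 is Li 2 (- 1) and yields pi ^ 2. *)
Lemma E_int1 n : E_int R n.+2 1 = ((-1) ^+ n.+2 * (n.+2%:R / (12 * n`!%:R)) * pi ^+ 2
    + \sum_(2 <= m < n.+3) Clog R n.+2 m * ln (m%:R : R)
    + \sum_(2 <= m < n.+2)
        (-1) ^+ (n.+2 - m) * (n.+2%:R * m%:R ^+ n.+1 / n.+1`!%:R)
        * 'C(n.+1, m)%:R * Li 2 (- (m%:R^-1) : R))%:E.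
Proof.
rewrite E_intE weight_integral1//; last exact: inv_kernel_nonneg.
have [_ ->//] := @log_moment1_integral n.+1 isT.
rewrite -EFinM; congr (_%:E); rewrite fdiffE.
pose sg j : R := (-1) ^+ (n.+1 - j) * 'C(n.+1, j)%:R.
have -> : \sum_(0 <= j < n.+2) (-1) ^+ (n.+1 - j) * 'C(n.+1, j)%:R * log_moment1 n.+1 (0 + j%:R)
  = \sum_(0 <= j < n.+2) - sg j * (j%:R ^+ n.+1 / n.+1`!%:R * Li2inv j%:R)
  + \sum_(0 <= j < n.+2) - sg j * ((calB n.+2).[j%:R] * ln j.+1%:R)
  + \sum_(0 <= j < n.+2) - sg j * ((calC n.+2).[j%:R] * ln j%:R).
  rewrite -!big_split/=; apply: eq_bigr => j _.
  rewrite /log_moment1 /sg add0r (hornerN (calB n.+2)) (hornerN (calC n.+2)) nat1r.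
  move: ((calB n.+2).[_]) ((calC n.+2).[_]) (Li2inv _) => b c L; by ring.
rewrite !mulrDr.
have -> : n.+2%:R * (\sum_(0 <= j < n.+2) - sg j * (j%:R ^+ n.+1 / n.+1`!%:R * Li2inv j%:R)) =
    (-1) ^+ n.+2 * (n.+2%:R / (12 * n`!%:R)) * pi ^+ 2 + \sum_(2 <= m < n.+2)
        (-1) ^+ (n.+2 - m) * (n.+2%:R * m%:R ^+ n.+1 / n.+1`!%:R)
        * 'C(n.+1, m)%:R * Li 2 (- (m%:R^-1) : R).
  rewrite big_ltn// big_ltn// expr0n/= !mul0r mulr0 add0r mulrDr; congr (_ + _).
    rewrite Li2inv_1 expr1n /sg bin1 subn1/=.
    rewrite factS natrM; have := @factS_unit R n; set m := n`!%:R => m0.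
    have nz : (n.+1%:R : R) != 0 by rewrite pnatr_eq0.
    rewrite !exprS; move: (pi : R) => p.
    by field; rewrite m0 (addrC 1) natr1 nz.
  rewrite mulr_sumr; apply: eq_big_nat => j /andP[j2 jn].
  rewrite /sg Li2inv_nat ?(leq_trans _ j2)// (@signr_subn n.+1 j jn).
  by move: (Li 2 _) => L; ring.
have -> : \sum_(2 <= m < n.+3) Clog R n.+2 m * ln (m%:R : R) =
    n.+2%:R * (\sum_(0 <= j < n.+2) - sg j * ((calB n.+2).[j%:R] * ln j.+1%:R)) +
    n.+2%:R * (\sum_(0 <= j < n.+2) - sg j * ((calC n.+2).[j%:R] * ln j%:R)).
  have -> : n.+2%:R * (\sum_(0 <= j < n.+2) - sg j * ((calB n.+2).[j%:R] * ln j.+1%:R)) =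
      \sum_(2 <= m < n.+3) - ((-1) ^+ (n.+2 - m) * (m%:R * 'C(n.+2, m)%:R) *
        (calB n.+2).[m%:R - 1] * ln m%:R).
    rewrite big_ltn// ln1 !mulr0 add0r [RHS]big_add1/= mulr_sumr.
    apply: eq_bigr => j _; rewrite subSS -natrM -mul_bin_diag natrM /sg.
    by rewrite -[j.+1%:R - 1]/(j.+1%:R - 1%:R) -natrB// subn1/=; ring.
  have -> : n.+2%:R * (\sum_(0 <= j < n.+2) - sg j * ((calC n.+2).[j%:R] * ln j%:R)) =
      \sum_(2 <= m < n.+3) (-1) ^+ (n.+2 - m) * ((n.+2 - m)%:R * 'C(n.+2, m)%:R) *
        (calC n.+2).[m%:R] * ln m%:R.
    rewrite big_ltn// big_ltn// ln0// ln1 !mulr0 !add0r.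
    rewrite [RHS]big_nat_recr//= subnn !(mul0r, mulr0) addr0 mulr_sumr.
    apply: eq_big_nat => j /andP[_ jn].
    by rewrite -natrM -mul_bin_down natrM /sg (@signr_subn n.+1 j jn); ring.
  rewrite -big_split/=; apply: eq_bigr => m _; rewrite /Clog; ring.
by ring.
Qed.

Lemma A_chain_cvg n : (0 < n)%N ->
  - (2 * t ^+ n / n`!%:R * (Li3inv t + Harm R n * Li2inv t)) @[t --> (0 : R)^'+] -->
  - (2 * 0 ^+ n / n`!%:R * (Li3inv 0 + Harm R n * Li2inv 0) : R).
Proof.
case: n => // n _.
have c0 : t @[t --> (0 : R)^'+] --> (0 : R) by exact: cvg_at_right_filter.
have : - (2 / n.+1`!%:R * t ^+ n * (t * Li3inv t + Harm R n.+1 * (t * Li2inv t)))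
    @[t --> (0 : R)^'+] --> (- (2 / n.+1`!%:R * 0 ^+ n * (0 + Harm R n.+1 * 0)) : R).
  apply: cvgN; apply: cvgM.
    by apply: cvgMl_tmp; exact: continuous_cvg (@exprn_continuous R n _) c0.
  apply: cvgD; first exact: cvg_mul_Li3inv.
  by apply: cvgMl_tmp; exact: cvg_mul_Li2inv.
rewrite mulr0 addr0 mulr0 [0 ^+ n.+1]expr0n/= mulr0 !mul0r.
apply: cvg_trans; apply: near_eq_cvg; apply: nearW => t.
by rewrite exprS; move: (Li2inv t) (Li3inv t) (Harm R n.+1) => L M H; ring.
Qed.

Definition A_value n : R :=
  fdiff n.+1 (fun x => - (2 * x ^+ n.+1 / n.+1`!%:R * (Li3inv x + Harm R n.+1 * Li2inv x))
    + (calCplus n.+2).[x] * ln (1 + x) + (calCminus n.+2).[x] * ln x) 0.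

Lemma A_iterated n :
  iter n.+1 (log_integral 0) (log_integral 2 inv_kernel) 0 = (A_value n)%:E.
Proof.
have hG x : 0 < x -> log_integral 2 inv_kernel x = (- 2 * Li3inv x)%:E.
  exact: log_integral2_kernel.
have cG x : 0 < x -> {for x, continuous (fun x : R => - 2 * Li3inv x)}.
  move=> x0; have h := derive_Li3inv x0.
  by eapply der_continuous; der_rules.
have n2 : nonneg_measurable (log_integral 2 (@inv_kernel R)).
  exact: log_integral_nonneg inv_kernel_nonneg.
have [_ zero] := log_chain_integral (isT : (0 < n.+1)%N) n2 hG cG (@log_chain_Li3 R n.+1).
apply: zero; first exact: A_chain_cvg.
by rewrite /calCminus hornerN Xn_eval expr0n/= mulr0 oppr0.
Qed.

(** The polylogarithms at j = 1, that is at - 1, yield zeta(3) and pi ^ 2. *)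
Lemma A_closed n : n.+2%:R * A_value n =
    (-1) ^+ n.+2 * (3 * n.+2%:R / (2 * n`!%:R)) * zeta R 3
    + (-1) ^+ n.+2 * (n.+2%:R * Harm R n.+1 / (6 * n`!%:R)) * pi ^+ 2
    + \sum_(2 <= m < n.+2)
        (-1) ^+ (n.+2 - m) * (2 * n.+2%:R * m%:R ^+ n.+1 / n.+1`!%:R)
        * 'C(n.+1, m)%:R
        * (Li 3 (- (m%:R^-1)) + Harm R n.+1 * Li 2 (- (m%:R^-1)))
    + logA R n.+2.
Proof.
rewrite /A_value fdiffE.
pose sg j : R := (-1) ^+ (n.+1 - j) * 'C(n.+1, j)%:R.
pose L x : R := Li3inv x + Harm R n.+1 * Li2inv x.
rewrite (eq_bigr (fun j => - sg j * (2 * j%:R ^+ n.+1 / n.+1`!%:R * L j%:R) +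
   sg j * ((calCplus n.+2).[j%:R] * ln j.+1%:R + (calCminus n.+2).[j%:R] * ln j%:R))); last first.
  move=> j _; rewrite /sg /L add0r nat1r.
  move: ((calCplus n.+2).[_]) ((calCminus n.+2).[_]) (Li2inv _) (Li3inv _) (Harm R n.+1).
  by move=> b c L2 L3 H; ring.
rewrite big_split/= mulrDr; congr (_ + _); last first.
  rewrite /logA; congr (_ * _); rewrite big_ltn// ln1 ln0// !mulr0 addr0 mulr0 add0r.
  by apply: eq_bigr => j _; rewrite /sg subn1.
rewrite big_ltn// big_ltn// expr0n/= mulr0 !mul0r mulr0 add0r mulrDr; congr (_ + _).
  rewrite /L Li2inv_1 Li3inv_1 expr1n /sg bin1 subn1/= factS natrM.
  have := @factS_unit R n; set m := n`!%:R => m0.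
  have nz : (n.+1%:R : R) != 0 by rewrite pnatr_eq0.
  rewrite !exprS; move: (pi : R) (zeta R 3) (Harm R n.+1) => p z H.
  by field; rewrite m0 (addrC 1) natr1 nz.
rewrite mulr_sumr; apply: eq_big_nat => j /andP[j2 jn].
rewrite /sg /L Li2inv_nat ?Li3inv_nat ?(leq_trans _ j2)// (@signr_subn n.+1 j jn).
by move: (Li 2 _) (Li 3 _) (Harm R n.+1) => A B H; ring.
Qed.

End ClosedForms.

(** * Convergence of the integrals with two logarithms *)

Section Finiteness.
Context {R : realType}.
Local Notation mu := (@lebesgue_measure R).
Local Notation T := (measurableTypeR R).
Implicit Types (h : T -> \bar R) (x y t : R) (a k : nat).

Lemma le_log_integral a h (h' : T -> \bar R) x y : nonneg_measurable h -> nonneg_measurable h' ->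
  (forall t, 0 < t -> (h (x + t)%R <= h' (y + t)%R)%E) ->
  (log_integral a h x <= log_integral a h' y)%E.
Proof.
move=> [mh h0] [mf f0] hf; apply: ge0_le_integral => //.
- by move=> t _; rewrite mule_ge0// lee_fin log_weight_ge0.
- exact: measurable_kernel_section.
- exact: measurable_kernel_section.
move=> t _; have [|t01] := boolP (t \in `]0, 1]); last by rewrite log_weight_out// !mul0e.
by rewrite in_itv/= => /andP[t0 _]; rewrite lee_wpmul2l ?lee_fin ?log_weight_ge0// hf.
Qed.

Lemma log_integral1_antitone x y : 0 < x <= y ->
  (log_integral 1 (@inv_kernel R) y <= log_integral 1 inv_kernel x)%E.
Proof.
move=> /andP[x0 xy]; have nk := @inv_kernel_nonneg R; apply: le_log_integral => // t t0.
have xt : 0 < x + t by rewrite addr_gt0.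
have yt : 0 < y + t by rewrite addr_gt0// (lt_le_trans x0).
by rewrite !inv_kernelE// lee_fin lef_pV2 ?posrE// lerD2r.
Qed.

Lemma log_integral0_cst x (c : R) : 0 <= c -> log_integral 0 (fun=> c%:E) x = c%:E.
Proof.
move=> c0.
rewrite (@log_integral_newton R 0 (fun=> c%:E) x (fun=> c) c)//.
  by move=> t t0; exact: cst_continuous.
exists (fun t => c * t), 0; split.
- by move=> t t0; derive; rewrite expr0; ring.
- have : c * t @[t --> (0 : R)^'+] --> (c * 0 : R).
    by apply: cvgMl_tmp; exact: cvg_at_right_filter.
  by rewrite mulr0.
- by rewrite mulr1 subr0.
Qed.

(** Averaging a nonincreasing function over [x, x + 1] does not increase it. *)
Lemma iter_log_integral0_le k x : 0 < x ->
  (iter k (log_integral 0) (log_integral 1 (@inv_kernel R)) x <= log_integral 1 inv_kernel x)%E.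
Proof.
have ng := log_integral_nonneg 1 (@inv_kernel_nonneg R).
elim: k x => [//|k IH] x x0; rewrite iterS.
apply: (@le_trans _ _ (log_integral 0 (log_integral 1 inv_kernel) x)).
  apply: le_log_integral; [exact: iter_log_integral_nonneg|exact: ng|].
  by move=> t t0; apply: IH; rewrite addr_gt0.
have gx := log_integral1_kernel x0.
have c0 : 0 <= - Li2inv x by rewrite -lee_fin -gx; exact: ng.2.
rewrite gx -[leRHS](log_integral0_cst x c0).
apply: le_log_integral => //.
move=> t t0; rewrite -gx; apply: log_integral1_antitone.
by rewrite x0 lerDl ltW.
Qed.

(** Moving the unit integrals between the two logarithmic ones makes the preceding
    bound apply. *)
Lemma B_integral_bound k :
  (log_integral 1 (log_integral 1 (iter k (log_integral 0) (@inv_kernel R))) 0 <=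
   log_integral 1 (log_integral 1 inv_kernel) 0)%E.
Proof.
have nk := @inv_kernel_nonneg R.
rewrite -(iter_log_integralC 0 1 k nk); apply: le_log_integral.
- by apply: iter_log_integral_nonneg; exact: log_integral_nonneg.
- exact: log_integral_nonneg.
- by move=> t t0; rewrite add0r; exact: iter_log_integral0_le.
Qed.

Lemma newton_B_integral k f v :
  (forall t, 0 < t -> iter k (log_integral 0) (log_integral 1 inv_kernel) t = (f t)%:E) ->
  (forall t, 0 < t -> {for t, continuous f}) ->
  newton (fun t => - ln t * f t) v ->
  log_integral 1 (log_integral 1 (iter k (log_integral 0) (@inv_kernel R))) 0 = v%:E.
Proof.
move=> fE cf nv; have nk := @inv_kernel_nonneg R.
rewrite -(iter_log_integralC 0 1 k nk).
apply: (log_integral_newton (f := f)) => //.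
- by move=> t t0; rewrite add0r fE.
- move=> t; rewrite in_itv/= => /andP[t0 _]; rewrite -lee_fin -fE//.
  by have [_] := iter_log_integral_nonneg 0 k (log_integral_nonneg 1 nk).
Qed.

End Finiteness.

(** * Elementary integrals with one or two logarithms *)

Section NewtonTable.
Context {R : realType}.
Implicit Types (f g P Q p q : R -> R) (t x : R) (i j : R) (m n : nat).

Lemma newton_by_parts P Q p q f u v :
  (forall t, 0 < t -> is_derive t (1 : R) P (p t)) ->
  (forall t, 0 < t -> is_derive t (1 : R) Q (q t)) ->
  P t * Q t @[t --> (0 : R)^'+] --> (0 : R) ->
  newton (fun t => P t * q t) v ->
  (forall t, 0 < t -> f t = p t * Q t) -> u = P 1 * Q 1 - v -> newton f u.
Proof.
move=> Pp Qq PQ0 nv fE ->.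
have nPQ : newton (fun t => p t * Q t + P t * q t) (P 1 * Q 1).
  exists (fun t => P t * Q t), 0; split=> //; last by rewrite subr0.
  by move=> t t0; apply: (der_eq (der_mul (Pp t t0) (Qq t t0))); ring.
rewrite -mulN1r; apply: eq_newton (newtonD nPQ (newtonZ (-1) nv)) => t t0.
by rewrite fE//; ring.
Qed.

Lemma cvg_id_at_right0 : t @[t --> (0 : R)^'+] --> (0 : R).
Proof. exact: cvg_at_right_filter. Qed.

Lemma cvg_XnS_at_right0 n : t ^+ n.+1 @[t --> (0 : R)^'+] --> (0 : R).
Proof.
have : t ^+ n.+1 @[t --> (0 : R)^'+] --> ((0 : R) ^+ n.+1).
  exact: continuous_cvg (@exprn_continuous R n.+1 0) cvg_id_at_right0.
by rewrite expr0n.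
Qed.

Lemma cvg_ln_XnS k n : ln t ^+ k * t ^+ n.+1 @[t --> (0 : R)^'+] --> (0 : R).
Proof.
apply: (@cvg_lnX_mul R k (fun t => t ^+ n.+1) (n.+1%:R * 0 ^+ n * 1)).
  by derive.
by rewrite expr0n.
Qed.

Lemma cvg_ln_XnS_lnD k n i : 0 < i ->
  ln t ^+ k * (t ^+ n.+1 * ln (t + i)) @[t --> (0 : R)^'+] --> (0 : R).
Proof.
move=> i0.
apply: (@cvg_lnX_mul R k (fun t => t ^+ n.+1 * ln (t + i))
  (0 ^+ n.+1 * ((1 + 0) / (0 + i)) + n.+1%:R * 0 ^+ n * 1 * ln (0 + i))).
  by derive => //; rewrite add0r.
by rewrite expr0n mul0r.
Qed.

Lemma derive_XnS_div m t : is_derive t (1 : R) (fun t => t ^+ m.+1 / m.+1%:R) (t ^+ m).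
Proof.
have m0 : (m.+1%:R : R) != 0 by rewrite pnatr_eq0.
by derive; rewrite /=; move: (m.+1%:R : R) m0 => c m0; field.
Qed.

Lemma cvg_proportional f g c :
  (forall t, g t = c * f t) -> f t @[t --> (0 : R)^'+] --> (0 : R) ->
  g t @[t --> (0 : R)^'+] --> (0 : R).
Proof.
move=> gE f0; have : c * f t @[t --> (0 : R)^'+] --> (c * 0 : R) by exact: cvgMl_tmp.
by rewrite mulr0; under eq_cvg do rewrite -gE.
Qed.

Lemma newton_Xn m : newton (fun t => t ^+ m) (m.+1%:R^-1).
Proof.
exists (fun t => t ^+ m.+1 / m.+1%:R), (0 / m.+1%:R); split.
- by move=> t _; exact: derive_XnS_div.
- by apply: cvgMr_tmp; exact: cvg_XnS_at_right0.
- by rewrite expr1n mul0r subr0 div1r.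
Qed.

Lemma newton_Xn_ln m : newton (fun t => t ^+ m * ln t) (- (m.+1%:R ^- 2)).
Proof.
have nz : (m.+1%:R : R) != 0 by rewrite pnatr_eq0.
have dP t : 0 < t -> is_derive t (1 : R) (fun t => t ^+ m.+1 / m.+1%:R) (t ^+ m).
  by move=> _; exact: derive_XnS_div.
have dQ t : 0 < t -> is_derive t (1 : R) (@ln R) (t^-1) by exact: is_derive1_ln.
apply: (newton_by_parts dP dQ (v := m.+1%:R^-1 * m.+1%:R^-1)) => //; first last.
- by rewrite ln1 mulr0 sub0r -invfM.
- apply: eq_newton (newtonZ m.+1%:R^-1 (newton_Xn m)) => t t0.
  by rewrite exprS; move: (m.+1%:R : R) nz => c nz; field; rewrite nz gt_eqF.
- by apply: (@cvg_proportional _ _ m.+1%:R^-1 _ (cvg_ln_XnS 1 m)) => t; rewrite expr1; ring.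
Qed.

Lemma newton_Xn_ln2 m : newton (fun t => t ^+ m * ln t ^+ 2) (2 / m.+1%:R ^+ 3).
Proof.
have nz : (m.+1%:R : R) != 0 by rewrite pnatr_eq0.
have dP t : 0 < t -> is_derive t (1 : R) (fun t => t ^+ m.+1 / m.+1%:R) (t ^+ m).
  by move=> _; exact: derive_XnS_div.
have dQ t : 0 < t -> is_derive t (1 : R) (fun t : R => ln t ^+ 2) (2 * ln t / t).
  by move=> t0; derive => //; rewrite /=; field; rewrite gt_eqF.
apply: (newton_by_parts dP dQ (v := 2 / m.+1%:R * (- (m.+1%:R ^- 2)))) => //; first last.
- by rewrite ln1 expr0n/= mulr0; move: (m.+1%:R : R) nz => c nz; field.
- apply: eq_newton (newtonZ (2 / m.+1%:R) (newton_Xn_ln m)) => t t0.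
  by rewrite exprS; move: (m.+1%:R : R) nz => c nz; field; rewrite nz gt_eqF.
- by apply: (@cvg_proportional _ _ m.+1%:R^-1 _ (cvg_ln_XnS 2 m)) => t; ring.
Qed.

(** Polynomial division by t + i. *)
Fixpoint rat_value m i : R :=
  if m is n.+1 then n.+1%:R^-1 - i * rat_value n i else ln (1 + i) - ln i.

Lemma newton_rat m i : 0 < i -> newton (fun t => t ^+ m / (t + i)) (rat_value m i).
Proof.
move=> i0; elim: m => [|m IH].
  exists (fun t => ln (t + i)), (ln i); split=> //=.
  - move=> t t0; derive; first by rewrite addr_gt0.
    by rewrite expr0; ring.
  - have h : is_derive (0 : R) (1 : R) (fun t => ln (t + i)) ((1 + 0) / (0 + i)).
      by derive => //; rewrite add0r.
    by have := cvg_at_right_continuous (der_continuous h); rewrite add0r.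
rewrite [rat_value _ _]/= -mulNr.
apply: eq_newton (newtonD (newton_Xn m) (newtonZ (- i) IH)) => t t0.
by rewrite exprS; field; rewrite gt_eqF// addr_gt0.
Qed.

Fixpoint ln_rat_value m i : R :=
  if m is n.+1 then - (n.+1%:R ^- 2) - i * ln_rat_value n i else Li2inv i.

Lemma newton_ln_rat m i : 0 < i ->
  newton (fun t => t ^+ m * ln t / (t + i)) (ln_rat_value m i).
Proof.
move=> i0; elim: m => [|m IH].
  by apply: eq_newton (newton_ln_div i0) => t _; rewrite expr0 mul1r addrC.
rewrite [ln_rat_value _ _]/= -[- (i * _)]mulNr.
apply: eq_newton (newtonD (newton_Xn_ln m) (newtonZ (- i) IH)) => t t0.
by rewrite exprS; field; rewrite gt_eqF// addr_gt0.
Qed.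

Definition lnD_value m i : R := (ln (1 + i) - rat_value m.+1 i) / m.+1%:R.

Lemma derive_lnD i t : 0 < i -> 0 < t -> is_derive t (1 : R) (fun t => ln (t + i)) ((t + i)^-1).
Proof.
by move=> i0 t0; derive; [rewrite addr_gt0|rewrite addr0 div1r].
Qed.

(** At i = 0 the divergent [rat_value 0 0] occurs with the factor 0 only. *)
Lemma newton_lnD m i : 0 <= i -> newton (fun t => t ^+ m * ln (t + i)) (lnD_value m i).
Proof.
rewrite le_eqVlt => /predU1P[<-|i0].
  rewrite /lnD_value/= addr0 ln1 mul0r subr0 sub0r mulNr -invfM.
  by apply: eq_newton (newton_Xn_ln m) => t _; rewrite addr0.
have nz : (m.+1%:R : R) != 0 by rewrite pnatr_eq0.
have dP t : 0 < t -> is_derive t (1 : R) (fun t => t ^+ m.+1 / m.+1%:R) (t ^+ m).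
  by move=> _; exact: derive_XnS_div.
have dQ t : 0 < t -> is_derive t (1 : R) (fun t => ln (t + i)) ((t + i)^-1).
  exact: derive_lnD.
apply: (newton_by_parts dP dQ (v := m.+1%:R^-1 * rat_value m.+1 i)) => //; first last.
- by rewrite /lnD_value expr1n mulrBl div1r mulrC [in RHS](mulrC _ (rat_value _ _)).
- apply: eq_newton (newtonZ m.+1%:R^-1 (newton_rat m.+1 i0)) => t t0.
  by ring.
- by apply: (@cvg_proportional _ _ m.+1%:R^-1 _ (cvg_ln_XnS_lnD 0 m i0)) => t; rewrite expr0; ring.
Qed.

Definition ln_lnD_value m i : R := - (lnD_value m i + ln_rat_value m.+1 i) / m.+1%:R.

Lemma newton_ln_lnD m i : 0 <= i ->
  newton (fun t => t ^+ m * (ln t * ln (t + i))) (ln_lnD_value m i).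
Proof.
have nz : (m.+1%:R : R) != 0 by rewrite pnatr_eq0.
rewrite le_eqVlt => /predU1P[<-|i0].
  have -> : ln_lnD_value m 0 = 2 / m.+1%:R ^+ 3.
    rewrite /ln_lnD_value /lnD_value/= addr0 ln1 !mul0r.
    by move: (m.+1%:R : R) nz => c nz; field.
  by apply: eq_newton (newton_Xn_ln2 m) => t _; rewrite addr0 expr2.
have dP t : 0 < t -> is_derive t (1 : R) (fun t => t ^+ m.+1 / m.+1%:R) (t ^+ m).
  by move=> _; exact: derive_XnS_div.
have dQ t : 0 < t ->
    is_derive t (1 : R) (fun t => ln t * ln (t + i)) (ln t / (t + i) + ln (t + i) / t).
  move=> t0; have ti : 0 < t + i by rewrite addr_gt0.
  by derive => //; field; rewrite !gt_eqF.
apply: (newton_by_parts dP dQ (v := m.+1%:R^-1 * (lnD_value m i + ln_rat_value m.+1 i))) => //;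
    first last.
- by rewrite /ln_lnD_value ln1 mul0r mulr0 sub0r mulNr mulrC.
- apply: eq_newton (newtonZ m.+1%:R^-1 (newtonD (newton_lnD m (ltW i0)) (newton_ln_rat m.+1 i0))) => t t0.
  rewrite exprS; move: (m.+1%:R : R) nz => c nz.
  by field; rewrite nz !gt_eqF// addr_gt0.
- by apply: (@cvg_proportional _ _ m.+1%:R^-1 _ (cvg_ln_XnS_lnD 1 m i0)) => t; rewrite expr1; ring.
Qed.

End NewtonTable.

(** * Integrals with a dilogarithm *)

Section NewtonDlog.
Context {R : realType}.
Implicit Types (f g P Q p q : R -> R) (t x w : R) (i j : R) (m n : nat).

Fixpoint dlog_value m j : R :=
  if m is n.+1 then lnD_value n (j + 1) - lnD_value n j - j * dlog_value n j
  else Li2inv (j + 1) - Li2inv j.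

(** The recursion is t = (t + j) - j; at m = 0 the antiderivative is
    Li2inv (t + j), which diverges at 0+ when j = 0. *)
Lemma newton_dlog m j : 0 < j ->
  newton (fun t => t ^+ m * ((ln (t + (j + 1)) - ln (t + j)) / (t + j))) (dlog_value m j).
Proof.
move=> j0; elim: m => [|m IH].
  exists (fun t => Li2inv (t + j)), (Li2inv j); split.
  - move=> t t0; have tj : 0 < t + j by rewrite addr_gt0.
    have h := derive_Li2inv tj.
    by derive; rewrite addr0 mulr1 expr0 mul1r (addrC 1) -addrA.
  - have h0 : is_derive (0 + j) (1 : R) Li2inv ((ln (1 + (0 + j)) - ln (0 + j)) / (0 + j)).
      by apply: derive_Li2inv; rewrite add0r.
    have h : is_derive (0 : R) (1 : R) (fun t => Li2inv (t + j))
        ((ln (1 + (0 + j)) - ln (0 + j)) / (0 + j) * (1 + 0)) by derive.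
    by have := cvg_at_right_continuous (der_continuous h); rewrite add0r.
  - by rewrite [1 + j]addrC.
rewrite [dlog_value _ _]/= -[- (j * _)]mulNr -[- lnD_value _ _]mulN1r.
have j1 : 0 <= j + 1 by rewrite addr_ge0// ltW.
apply: eq_newton (newtonD (newtonD (newton_lnD m j1) (newtonZ (-1) (newton_lnD m (ltW j0))))
  (newtonZ (- j) IH)) => t t0.
by rewrite exprS; field; rewrite gt_eqF// addr_gt0.
Qed.

(** At j = 0 the factor j removes the divergent integral of index 0. *)
Lemma newton_dlogS m j : 0 <= j ->
  newton (fun t => t ^+ m.+1 * ((ln (t + (j + 1)) - ln (t + j)) / (t + j)))
    (dlog_value m.+1 j).
Proof.
rewrite le_eqVlt => /predU1P[<-|]; last exact: newton_dlog.
rewrite [dlog_value _ _]/= mul0r subr0 -mulN1r.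
have j1 : (0 : R) <= 0 + 1 by rewrite add0r.
apply: eq_newton (newtonD (newton_lnD m j1) (newtonZ (-1) (newton_lnD m (lexx 0)))) => t t0.
by rewrite !addr0 exprS; field; rewrite gt_eqF.
Qed.

(** An antiderivative of ln w ^ 2 / (1 - w). *)
Definition ln2_div1B w : R := - (ln w ^+ 2 * ln (1 - w)) - 2 * (ln w * Li 2 w) + 2 * Li 3 w.

Lemma derive_ln2_div1B w : 0 < w < 1 -> is_derive w (1 : R) ln2_div1B (ln w ^+ 2 / (1 - w)).
Proof.
move=> /andP[w0 w1]; have w1' : 0 < 1 - w by rewrite subr_gt0.
rewrite /ln2_div1B; derive => //.
- by rewrite gt_eqF.
- by rewrite ger0_norm// ltW.
- by rewrite gt_eqF.
- by rewrite ger0_norm// ltW.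
by move: (Li 2 w) (Li 3 w) => L M; field; rewrite !gt_eqF.
Qed.

Lemma cvg_ln2_div1B : ln2_div1B w @[w --> (0 : R)^'+] --> (0 : R).
Proof.
have li n s : (2 <= s)%N -> ln t ^+ n * Li s t @[t --> (0 : R)^'+] --> (0 : R).
  move=> s2; have [d hd] := @derivable_Li0 R s (ltnW s2).
  by apply: (@cvg_lnX_mul R n (Li s) d) => //; apply: Li0; exact: ltnW.
have l1 : ln t ^+ 2 * ln (1 - t) @[t --> (0 : R)^'+] --> (0 : R).
  apply: (@cvg_lnX_mul R 2 (fun t => ln (1 - t)) ((0 + - 1) / (1 - 0))).
    by derive; rewrite subr0.
  by rewrite subr0 ln1.
have two f : f t @[t --> (0 : R)^'+] --> (0 : R) -> 2 * f t @[t --> (0 : R)^'+] --> (0 : R).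
  exact: cvg_proportional.
have : ln2_div1B w @[w --> (0 : R)^'+] --> (- 0 - 0 + 0 : R); last first.
  by rewrite oppr0 !addr0.
apply: cvgD; first by apply: cvgB; [exact: cvgN|exact: two (li 1 2 isT)].
by have := two _ (li 0 3 isT); under eq_cvg do rewrite expr0 mul1r.
Qed.

(** An antiderivative of ln w ^ 2 / (j + w). *)
Definition ln2_divD j w : R :=
  ln w ^+ 2 * (ln (j + w) - ln j) + 2 * (ln w * Li2inv (j / w)) - 2 * Li3inv (j / w).

Lemma derive_ln2_divD j w : 0 < j -> 0 < w ->
  is_derive w (1 : R) (ln2_divD j) (ln w ^+ 2 / (j + w)).
Proof.
move=> j0 w0; have jw : 0 < j + w by rewrite addr_gt0.
have h := derive_Li2inv_div j0 w0; have h3 := derive_Li3inv_div j0 w0.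
rewrite /ln2_divD; derive => //; move: (Li2inv _) (Li3inv _) => L M.
by field; rewrite !gt_eqF.
Qed.

Lemma cvg_ln2_divD j : 0 < j -> ln2_divD j w @[w --> (0 : R)^'+] --> (0 : R).
Proof.
move=> j0.
have two f : f t @[t --> (0 : R)^'+] --> (0 : R) -> 2 * f t @[t --> (0 : R)^'+] --> (0 : R).
  exact: cvg_proportional.
have : ln2_divD j w @[w --> (0 : R)^'+] --> (0 + 0 - 0 : R); last by rewrite subr0 addr0.
apply: cvgB; first by apply: cvgD; [exact: cvg_lnX_lnD|exact: two (cvg_lnX_Li2inv 1 j0)].
by have := two _ (cvg_lnX_Li3inv 0 j0); under eq_cvg do rewrite expr0 mul1r.
Qed.

Definition ln_dlog_value0 j : R :=
  ((ln (j + 2) ^+ 3 - 2 * ln (j + 1) ^+ 3 + ln j ^+ 3) / 3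
   - 2 * ln2_div1B (j + 2)^-1 + 2 * ln2_div1B (j + 1)^-1 - ln2_divD j (j + 2)^-1) / 2.

Fixpoint ln_dlog_value m j : R :=
  if m is n.+1 then ln_lnD_value n (j + 1) - ln_lnD_value n j - j * ln_dlog_value n j
  else ln_dlog_value0 j.

Lemma cvg_div_at_right f j : 0 < j -> f w @[w --> (0 : R)^'+] --> (0 : R) ->
  f (t / (t + j)) @[t --> (0 : R)^'+] --> (0 : R).
Proof.
move=> j0 f0; apply: (cvg_comp _ _ _ f0); apply: cvg_to_at_right.
  have h : is_derive (0 : R) (1 : R) (fun t => t / (t + j))
      ((1 * (0 + j) - 0 * (1 + 0)) / (0 + j) ^+ 2).
    by derive; rewrite ?add0r ?gt_eqF//; field; rewrite gt_eqF.
  by have := cvg_at_right_continuous (der_continuous h); rewrite mul0r.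
near=> t; have t0 : 0 < t by near: t; exact: nbhs_right_gt.
by rewrite divr_gt0// addr_gt0.
Unshelve. all: by end_near. Qed.

(** With a, b, c the logarithms of t, t + j and t + j + 1,
    2 a (c - b) = c ^ 2 - b ^ 2 - (a - c) ^ 2 + (a - b) ^ 2;
    divided by t + j and split into partial fractions, the squares become
    derivatives of cubes of logarithms and of [ln2_div1B] and [ln2_divD] at
    1 / (t + j + 1), t / (t + j) and t / (t + j + 1). *)
Lemma newton_ln_dlog0 j : 0 < j ->
  newton (fun t => ln t * ((ln (t + (j + 1)) - ln (t + j)) / (t + j))) (ln_dlog_value0 j).
Proof.
move=> j0; have j1 : 0 < j + 1 by rewrite addr_gt0.
pose F t := (ln (t + (j + 1)) ^+ 3 / 3 - ln (t + j) ^+ 3 / 3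
  - ln2_div1B (t + (j + 1))^-1 - ln2_div1B (t / (t + (j + 1)))
  - ln2_divD j (t / (t + (j + 1))) + ln2_div1B (t / (t + j))) / 2.
exists F, ((ln (j + 1) ^+ 3 / 3 - ln j ^+ 3 / 3 - ln2_div1B (j + 1)^-1 - 0 - 0 + 0) / 2); split.
- move=> t t0.
  have tj : 0 < t + j by rewrite addr_gt0.
  have tj1 : 0 < t + (j + 1) by rewrite addr_gt0.
  have r1 : 0 < (t + (j + 1))^-1 < 1 by rewrite invr_gt0 tj1 invf_lt1//; lra.
  have r2 : 0 < t / (t + (j + 1)) < 1 by rewrite divr_gt0// ltr_pdivrMr//; lra.
  have r3 : 0 < t / (t + j) < 1 by rewrite divr_gt0// ltr_pdivrMr//; lra.
  have h1 := derive_ln2_div1B r1.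
  have h2 := derive_ln2_div1B r2.
  have h3 := derive_ln2_div1B r3.
  have h4 := derive_ln2_divD j0 (proj1 (andP r2)).
  rewrite /F; derive; rewrite ?gt_eqF//.
  rewrite !ln_div ?posrE// lnV ?posrE//.
  move: (ln t) (ln (t + j)) (ln (t + (j + 1))) => a b c.
  field; apply/and5P; split; rewrite gt_eqF//; [lra| |lra].
  by rewrite addr_gt0// mulr_gt0.
- apply: cvgMr_tmp.
  have j1' : 0 < 0 + (j + 1) by rewrite add0r.
  have j0' : 0 < 0 + j by rewrite add0r.
  have r1 : 0 < (0 + (j + 1))^-1 < 1 by rewrite invr_gt0 j1' invf_lt1//; lra.
  have h1 := derive_ln2_div1B r1.
  pose g t := ln (t + (j + 1)) ^+ 3 / 3 - ln (t + j) ^+ 3 / 3 - ln2_div1B (t + (j + 1))^-1.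
  have cg : {for 0, continuous g}.
    by eapply der_continuous; rewrite /g; der_rules; rewrite ?gt_eqF.
  have := cvg_at_right_continuous cg; rewrite {2}/g !add0r => g0.
  apply: cvgD; last exact: cvg_div_at_right cvg_ln2_div1B.
  apply: cvgB; last exact: cvg_div_at_right (cvg_ln2_divD j0).
  by apply: cvgB; [|exact: cvg_div_at_right cvg_ln2_div1B].
- rewrite /F /ln_dlog_value0 !div1r (_ : 1 + (j + 1) = j + 2); last by ring.
  by rewrite (addrC 1 j); field.
Qed.

Lemma newton_ln_dlog m j : 0 < j ->
  newton (fun t => t ^+ m * (ln t * ((ln (t + (j + 1)) - ln (t + j)) / (t + j))))
    (ln_dlog_value m j).
Proof.
move=> j0; elim: m => [|m IH].
  by apply: eq_newton (newton_ln_dlog0 j0) => t t0; rewrite expr0 mul1r.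
rewrite [ln_dlog_value _ _]/= -[- (j * _)]mulNr -[- ln_lnD_value _ _]mulN1r.
have j1 : 0 <= j + 1 by rewrite addr_ge0// ltW.
apply: eq_newton (newtonD (newtonD (newton_ln_lnD m j1)
  (newtonZ (-1) (newton_ln_lnD m (ltW j0)))) (newtonZ (- j) IH)) => t t0.
by rewrite exprS; field; rewrite gt_eqF// addr_gt0.
Qed.

Lemma newton_ln_dlogS m j : 0 <= j ->
  newton (fun t => t ^+ m.+1 * (ln t * ((ln (t + (j + 1)) - ln (t + j)) / (t + j))))
    (ln_dlog_value m.+1 j).
Proof.
rewrite le_eqVlt => /predU1P[<-|]; last exact: newton_ln_dlog.
rewrite [ln_dlog_value _ _]/= mul0r subr0 -mulN1r.
have j1 : (0 : R) <= 0 + 1 by rewrite add0r.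
apply: eq_newton (newtonD (newton_ln_lnD m j1) (newtonZ (-1) (newton_ln_lnD m (lexx 0)))) => t t0.
by rewrite !addr0 exprS; field; rewrite gt_eqF.
Qed.

Definition ln_Li2inv_value m j : R :=
  - (Li2inv (1 + j) / m.+1%:R ^+ 2) - ln_dlog_value m.+1 j / m.+1%:R
  + dlog_value m.+1 j / m.+1%:R ^+ 2.

Lemma cvg_ln_XnS_Li2inv k m j : 0 <= j ->
  ln t ^+ k * (t ^+ m.+1 * Li2inv (t + j)) @[t --> (0 : R)^'+] --> (0 : R).
Proof.
rewrite le_eqVlt => /predU1P[<-|j0]; last first.
  have h0 : is_derive (0 + j) (1 : R) Li2inv ((ln (1 + (0 + j)) - ln (0 + j)) / (0 + j)).
    by apply: derive_Li2inv; rewrite add0r.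
  apply: (@cvg_lnX_mul R k (fun t => t ^+ m.+1 * Li2inv (t + j))
    (0 ^+ m.+1 * ((ln (1 + (0 + j)) - ln (0 + j)) / (0 + j) * (1 + 0))
     + m.+1%:R * 0 ^+ m * 1 * Li2inv (0 + j))).
    by derive.
  by rewrite expr0n mul0r.
have lt n := @cvg_ln_XnS R n m.
have l1 := @cvg_ln1D_at_right0 R.
have Li1 := @cvg_Li_inv1D_at_right0 R 2 isT.
have : - (ln t ^+ k * t ^+ m.+1 * Li 2 (1 + t)^-1)
    - (ln t ^+ k.+2 * t ^+ m.+1 - ln t ^+ k.+1 * t ^+ m.+1 * ln (1 + t) * 2
       + ln t ^+ k * t ^+ m.+1 * ln (1 + t) * ln (1 + t)) / 2 @[t --> (0 : R)^'+]
    --> (- (0 * Li 2 (1 : R)) - (0 - 0 * 0 * 2 + 0 * 0 * 0) / 2 : R).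
  apply: cvgB; first by apply: cvgN; exact: cvgM.
  apply: cvgMr_tmp; apply: cvgD; last by do 2?[apply: cvgM].
  by apply: cvgB => //; apply: cvgMr_tmp; exact: cvgM.
rewrite !(mul0r, oppr0, subr0, addr0).
apply: cvg_trans; apply: near_eq_cvg; apply: nearW => t.
by rewrite /Li2inv addr0 !exprS; move: (Li 2 _) => L; field.
Qed.

(** By parts: the derivative of Li2inv (t + j) is the difference quotient of the
    preceding integrals. *)
Lemma newton_ln_Li2inv m j : 0 <= j ->
  newton (fun t => t ^+ m * (ln t * Li2inv (t + j))) (ln_Li2inv_value m j).
Proof.
move=> j0; have nz : (m.+1%:R : R) != 0 by rewrite pnatr_eq0.
pose P t := t ^+ m.+1 * ln t / m.+1%:R - t ^+ m.+1 / m.+1%:R ^+ 2.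
pose D t := (ln (t + (j + 1)) - ln (t + j)) / (t + j).
have dP t : 0 < t -> is_derive t (1 : R) P (t ^+ m * ln t).
  move=> t0; rewrite /P; derive => //; rewrite /= exprS.
  move: (m.+1%:R : R) nz => c nz; field; rewrite nz gt_eqF//.
have dQ t : 0 < t -> is_derive t (1 : R) (fun t => Li2inv (t + j)) (D t).
  move=> t0; have tj : 0 < t + j by rewrite ltr_wpDr.
  have h := derive_Li2inv tj.
  by rewrite /D; derive; rewrite addr0 mulr1 (addrC 1) -addrA.
apply: (newton_by_parts dP dQ
    (v := m.+1%:R^-1 * ln_dlog_value m.+1 j + - (m.+1%:R ^- 2) * dlog_value m.+1 j)).
- have -> : (fun t => P t * Li2inv (t + j)) = (fun t =>
      m.+1%:R^-1 * (ln t ^+ 1 * (t ^+ m.+1 * Li2inv (t + j)))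
      - m.+1%:R ^- 2 * (ln t ^+ 0 * (t ^+ m.+1 * Li2inv (t + j)))).
    by apply/funext => t; rewrite /P; ring.
  rewrite -[X in _ --> X](subr0 0); apply: cvgB.
    exact: cvg_proportional (cvg_ln_XnS_Li2inv 1 m j0).
  exact: cvg_proportional (cvg_ln_XnS_Li2inv 0 m j0).
- apply: eq_newton (newtonD (newtonZ m.+1%:R^-1 (newton_ln_dlogS m j0))
    (newtonZ (- (m.+1%:R ^- 2)) (newton_dlogS m j0))) => t t0.
  by rewrite /P /D; ring.
- by move=> t t0; ring.
- rewrite /ln_Li2inv_value /P ln1 expr1n.
  move: (Li2inv _) (ln_dlog_value _ _) (dlog_value _ _) (m.+1%:R : R) nz => a b c d nz.
  by field.
Qed.
End NewtonDlog.

(** * Special values of the dilogarithm and trilogarithm *)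

(** The numerators and denominators of the arguments z = 1/2, 1/3, 2/3, 1/4, 3/4,
    1/9, 8/9 and of 1 - z have no prime factor but 2 and 3.  Landen's relation, the
    duplication formula and Kummer's equation express all values at these points
    through those at - 1 / 2 and - 1 / 3. *)

Section SpecialValues.
Context {R : realType}.
Local Notation D2 := (Li 2 (- 2^-1) : R).
Local Notation T2 := (Li 3 (- 2^-1) : R).
Local Notation D3 := (Li 2 (- 3^-1) : R).
Local Notation T3 := (Li 3 (- 3^-1) : R).
Local Notation l2 := (ln 2 : R).
Local Notation l3 := (ln 3 : R).
Local Notation p := (pi : R).
Local Notation z3 := (zeta R 3).

Lemma ln4 : ln (4 : R) = 2 * l2.
Proof.
have -> : (4 : R) = 2 ^+ 2 by ring.
by rewrite lnXn ?mulr_natl.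
Qed.

Lemma ln8 : ln (8 : R) = 3 * l2.
Proof.
have -> : (8 : R) = 2 ^+ 3 by ring.
by rewrite lnXn ?mulr_natl.
Qed.

Lemma ln9 : ln (9 : R) = 2 * l3.
Proof.
have -> : (9 : R) = 3 ^+ 2 by ring.
by rewrite lnXn ?mulr_natl.
Qed.

Lemma Li2inv_2 : Li2inv (2 : R) = D2. Proof. exact: (@Li2inv_nat R 2). Qed.
Lemma Li2inv_3 : Li2inv (3 : R) = D3. Proof. exact: (@Li2inv_nat R 3). Qed.
Lemma Li3inv_2 : Li3inv (2 : R) = T2. Proof. exact: (@Li3inv_nat R 2). Qed.
Lemma Li3inv_3 : Li3inv (3 : R) = T3. Proof. exact: (@Li3inv_nat R 3). Qed.

Lemma Li2_half : Li 2 (2^-1 : R) = p ^+ 2 / 12 - l2 ^+ 2 / 2.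
Proof.
have := @Li2inv_1 R; rewrite /Li2inv ln1 (_ : 1 + 1 = 2 :> R)//.
by move: (pi) (Li 2 _) (ln 2) => q L l h; lra.
Qed.

Lemma Li2_third : Li 2 (3^-1 : R) = - D2 - (l3 - l2) ^+ 2 / 2.
Proof.
have := Li2inv_2; rewrite /Li2inv (_ : 1 + 2 = 3 :> R); last by ring.
by move: (Li 2 _) (Li 2 _) (ln 2) (ln 3) => q L l m h; lra.
Qed.

Lemma Li2_quarter : Li 2 (4^-1 : R) = p ^+ 2 / 6 - l2 ^+ 2 + 2 * D2.
Proof.
have n1 : `|2^-1 : R| <= 1 by rewrite ger0_norm ?invr_ge0// invf_le1//; lra.
have := Li_duplication (isT : (2 <= 2)%N) n1; rewrite Li2_half.
rewrite (_ : 2^-1 ^+ 2 = 4^-1 :> R); last by field.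
by move: (pi) (Li 2 _) (Li 2 _) (ln 2) => q L L' l h; lra.
Qed.

(** Landen's relation and duplication both reach the dilogarithm at 1 / 4. *)
Lemma Li2_Nthird : D3 = - 2 * D2 - p ^+ 2 / 6 + l2 ^+ 2 - (2 * l2 - l3) ^+ 2 / 2.
Proof.
rewrite -Li2inv_3 /Li2inv (_ : 1 + 3 = 4 :> R); last by ring.
by rewrite Li2_quarter ln4; move: (pi) (Li 2 _) => q L; field.
Qed.

Lemma Li2inv_8 : Li2inv (8 : R) = 2 * D2 + (l3 - l2) ^+ 2 - 2 * D3 - (2 * l3 - 3 * l2) ^+ 2 / 2.
Proof.
have n1 : `|3^-1 : R| <= 1 by rewrite ger0_norm ?invr_ge0// invf_le1//; lra.
have := Li_duplication (isT : (2 <= 2)%N) n1; rewrite Li2_third.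
rewrite (_ : 3^-1 ^+ 2 = 9^-1 :> R); last by field.
rewrite /Li2inv (_ : 1 + 8 = 9 :> R); last by ring.
rewrite ln8 ln9.
by move: (Li 2 (- 2^-1)) (Li 2 (- 3^-1)) (Li 2 9^-1) (ln 2) (ln 3) => L L' M l m h; lra.
Qed.

Lemma Li3_half : Li 3 (2^-1 : R) = 7 / 8 * z3 + l2 ^+ 3 / 6 - p ^+ 2 * l2 / 12.
Proof.
have := @Li3inv_1 R; rewrite /Li3inv ln1 (_ : 1 + 1 = 2 :> R)// div1r.
by move: (pi) (Li 3 _) (ln 2) (zeta R 3) => q L l z h; lra.
Qed.

Lemma Li3_quarter : Li 3 (4^-1 : R) = 4 * Li 3 2^-1 + 4 * T2.
Proof.
have n1 : `|2^-1 : R| <= 1 by rewrite ger0_norm ?invr_ge0// invf_le1//; lra.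
have := Li_duplication (isT : (2 <= 3)%N) n1.
rewrite (_ : 2^-1 ^+ 2 = 4^-1 :> R); last by field.
by move: (Li 3 _) (Li 3 _) (Li 3 _) => q L L' h; lra.
Qed.

Lemma Li3_ninth : Li 3 (9^-1 : R) = 4 * Li 3 3^-1 + 4 * T3.
Proof.
have n1 : `|3^-1 : R| <= 1 by rewrite ger0_norm ?invr_ge0// invf_le1//; lra.
have := Li_duplication (isT : (2 <= 3)%N) n1.
rewrite (_ : 3^-1 ^+ 2 = 9^-1 :> R); last by field.
by move: (Li 3 _) (Li 3 _) (Li 3 _) => q L L' h; lra.
Qed.

Lemma Li3_three_quarters : Li 3 (3 / 4 : R) = z3 + (l3 - 2 * l2) ^+ 3 / 6
  + p ^+ 2 / 6 * (l3 - 2 * l2) + (l3 - 2 * l2) ^+ 2 * l2 - Li 3 4^-1 - T3.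
Proof.
have := Li3inv_3; rewrite /Li3inv (_ : 1 + 3 = 4 :> R); last by ring.
rewrite ln4; move: (pi) (Li 3 _) (Li 3 _) (Li 3 _) (ln 2) (ln 3) (zeta R 3).
by move=> q L L' L'' l m z <-; field.
Qed.

Lemma Li3_two_thirds : Li 3 (2 / 3 : R) = z3 + (l2 - l3) ^+ 3 / 6
  + p ^+ 2 / 6 * (l2 - l3) + (l2 - l3) ^+ 2 * l3 / 2 - Li 3 3^-1 - T2.
Proof.
have := Li3inv_2; rewrite /Li3inv (_ : 1 + 2 = 3 :> R); last by ring.
move: (pi) (Li 3 _) (Li 3 _) (Li 3 _) (ln 2) (ln 3) (zeta R 3).
by move=> q L L' L'' l m z <-; field.
Qed.

Lemma ln_nat_div m n : (0 < m)%N -> (0 < n)%N -> ln (m%:R / n%:R : R) = ln m%:R - ln n%:R.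
Proof. by move=> m0 n0; rewrite ln_div// posrE ltr0n. Qed.

(** Kummer's equation at u = 1 / 3. *)
Lemma Li3_third : Li 3 (3^-1 : R) =
  (2 / 3 * (l2 - l3) ^+ 3 - p ^+ 2 / 3 * (l2 - l3) - 7 / 2 * z3
   - Li 3 (3 / 4) + 2 * T3 + 4 * Li 3 2^-1
   + 4 * (z3 + (l2 - l3) ^+ 3 / 6 + p ^+ 2 / 6 * (l2 - l3) + (l2 - l3) ^+ 2 * l3 / 2 - T2)) / 6.
Proof.
have u01 : 0 < (3^-1 : R) < 1 by rewrite invr_gt0 invf_lt1//; lra.
have := kummer_Li3 u01.
rewrite (_ : 4 / 3 / (1 + 3^-1) ^+ 2 = 3 / 4); last by field.
rewrite (_ : 2 / 3 / (1 + 3^-1) = 2^-1); last by field.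
rewrite (_ : (1 + 3^-1) / 2 = 2 / 3); last by field.
rewrite (_ : 1 + 3^-1 = 4 / 3); last by field.
rewrite ln_nat_div// ln4 Li3_two_thirds.
rewrite (_ : 2 * l2 - l3 - l2 = l2 - l3); last by ring.
move: (pi) (Li 3 (3 / 4)) (Li 3 3^-1) (Li 3 2^-1) T2 T3 (ln 2) (ln 3) (zeta R 3).
by move=> q L L' L'' t2 t3 l m z h; lra.
Qed.

(** Kummer's equation at u = 1 / 2. *)
Lemma Li3_eight_ninths : Li 3 (8 / 9 : R) =
  2 / 3 * (l3 - 2 * l2) ^+ 3 - p ^+ 2 / 3 * (l3 - 2 * l2) - 7 / 2 * z3
  - 2 * Li 3 2^-1 + 2 * T2 + 4 * Li 3 (2 / 3) + 4 * Li 3 (3 / 4).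
Proof.
have u01 : 0 < (2^-1 : R) < 1 by rewrite invr_gt0 invf_lt1//; lra.
have := kummer_Li3 u01.
rewrite (_ : 4 / 2 / (1 + 2^-1) ^+ 2 = 8 / 9); last by field.
rewrite (_ : 2 / 2 / (1 + 2^-1) = 2 / 3); last by field.
rewrite (_ : (1 + 2^-1) / 2 = 3 / 4); last by field.
rewrite (_ : 1 + 2^-1 = 3 / 2); last by field.
rewrite ln_nat_div//.
rewrite (_ : l3 - l2 - l2 = l3 - 2 * l2); last by ring.
move: (pi) (Li 3 (8 / 9)) (Li 3 (3 / 4)) (Li 3 2^-1) (Li 3 (2 / 3)) T2 (ln 2) (ln 3) (zeta R 3).
by move=> q L L' L'' t2 t3 l m z h; lra.
Qed.

Lemma Li3inv_8 : Li3inv (8 : R) = z3 + (3 * l2 - 2 * l3) ^+ 3 / 6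
  + p ^+ 2 / 6 * (3 * l2 - 2 * l3) + (3 * l2 - 2 * l3) ^+ 2 * l3 - Li 3 (8 / 9) - Li 3 9^-1.
Proof.
rewrite /Li3inv (_ : 1 + 8 = 9 :> R); last by ring.
by rewrite ln8 ln9; move: (pi) (Li 3 _) (Li 3 _) (zeta R 3) => q L L' z; field.
Qed.

Lemma ln_dlog_value0_1 : ln_dlog_value0 (1 : R) = - (5 / 12) * z3.
Proof.
rewrite /ln_dlog_value0 /ln2_div1B /ln2_divD.
have e3 : 1 + 2 = 3 :> R by ring.
have e2 : 1 + 1 = 2 :> R by ring.
have h2 : 1 - 2^-1 = 2^-1 :> R by field.
have h3 : 1 - 3^-1 = 2 / 3 :> R by field.
have q3 : 1 + 3^-1 = 4 / 3 :> R by field.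
have d3 : 1 / 3^-1 = 3 :> R by field.
rewrite e3 e2 h2 h3 q3 d3 !lnV ?posrE// !ln_nat_div// ln4 ln1 Li2inv_3 Li3inv_3.
rewrite Li3_third Li3_three_quarters Li3_quarter Li3_half Li2_Nthird Li2_third Li2_half.
move: (pi) T2 T3 D2 (ln 2) (ln 3) (zeta R 3) => q t2 t3 d2 l m z.
by field.
Qed.

Lemma ln_dlog_value0_2 : ln_dlog_value0 (2 : R) = 10 * T2 + T3 + 89 / 12 * z3
  + (4 * l2 - 2 * l3) * D2 + 2 / 3 * l2 ^+ 3 - l2 ^+ 2 * l3 + l2 * l3 ^+ 2 - l3 ^+ 3 / 6
  - p ^+ 2 / 6 * (2 * l2 + l3).
Proof.
rewrite /ln_dlog_value0 /ln2_div1B /ln2_divD.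
have e4 : 2 + 2 = 4 :> R by ring.
have e3 : 2 + 1 = 3 :> R by ring.
have h3 : 1 - 3^-1 = 2 / 3 :> R by field.
have h4 : 1 - 4^-1 = 3 / 4 :> R by field.
have q4 : 2 + 4^-1 = 9 / 4 :> R by field.
have d4 : 2 / 4^-1 = 8 :> R by field.
rewrite e4 e3 h3 h4 q4 d4 !lnV ?posrE// !ln_nat_div// ln9 ln4 Li2inv_8 Li3inv_8.
rewrite Li3_eight_ninths Li3_ninth Li3_two_thirds.
rewrite Li3_third Li3_three_quarters Li3_quarter Li3_half Li2_Nthird Li2_quarter Li2_third.
move: (pi) T2 T3 D2 (ln 2) (ln 3) (zeta R 3) => q t2 t3 d2 l m z.
by field.
Qed.

End SpecialValues.

(** * The integrals with two logarithms in at most four variables *)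

Section BValues.
Context {R : realType}.
Implicit Types (f g : R -> R) (t x : R) (j : R) (m n k : nat).

Lemma log_moment1_1E x : log_moment1 1 x = - (x * Li2inv x) + (x + 1) * ln (x + 1) - x * ln x.
Proof.
rewrite /log_moment1 /calB /calC big_nat1 /cB /Harm big_nat1 big_geq//= !hornerE/=.
rewrite !(binn, factS, fact0, subnn) (addrC 1 x) expr0 expr1.
by move: (Li2inv x) (ln x) (ln _) => a b c; field.
Qed.

Lemma log_moment1_2E x : log_moment1 2 x = - (x ^+ 2 / 2 * Li2inv x)
  + (- (x + 1) / 2 + 3 / 4 * (x + 1) ^+ 2) * ln (x + 1) - 3 / 4 * x ^+ 2 * ln x.
Proof.
rewrite /log_moment1 /calB /calC /cB /Harm !(@big_nat_recr _ _ _ 2 1)//= !big_nat1 big_geq//= !hornerE/=.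
rewrite (_ : 2`! = 2)%N// (_ : 3 - 1 - 1 = 1)%N// bin1 (addrC 1 x) expr1.
by move: (Li2inv x) (ln x) (ln _) => a b c; field.
Qed.

(** The powers of t + j in [log_moment1] are expanded in powers of t. *)
Definition moment1_value j : R := ln_Li2inv_value 1 j + j * ln_Li2inv_value 0 j
  - (ln_lnD_value 1 (j + 1) + (j + 1) * ln_lnD_value 0 (j + 1))
  + (ln_lnD_value 1 j + j * ln_lnD_value 0 j).

Lemma newton_moment1 j : 0 <= j ->
  newton (fun t => - ln t * log_moment1 1 (t + j)) (moment1_value j).
Proof.
move=> j0; have j1 : 0 <= j + 1 by rewrite addr_ge0.
have N m := newton_ln_Li2inv m j0; have M m := newton_ln_lnD m j0.
have M1 m := newton_ln_lnD m j1.
rewrite /moment1_value -[- (ln_lnD_value 1 _ + _)]mulN1r.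
apply: eq_newton (newtonD (newtonD (newtonD (N 1%N) (newtonZ j (N 0%N)))
  (newtonZ (-1) (newtonD (M1 1%N) (newtonZ (j + 1) (M1 0%N)))))
  (newtonD (M 1%N) (newtonZ j (M 0%N)))) => t t0.
rewrite log_moment1_1E -[t + j + 1]addrA; move: (Li2inv _) => L; ring.
Qed.

Definition moment2_value j : R :=
  1 / 2 * (ln_Li2inv_value 2 j + 2 * j * ln_Li2inv_value 1 j + j ^+ 2 * ln_Li2inv_value 0 j)
  + (1 / 2 * (ln_lnD_value 1 (j + 1) + (j + 1) * ln_lnD_value 0 (j + 1))
     + - (3 / 4) * (ln_lnD_value 2 (j + 1) + 2 * (j + 1) * ln_lnD_value 1 (j + 1)
         + (j + 1) ^+ 2 * ln_lnD_value 0 (j + 1)))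
  + 3 / 4 * (ln_lnD_value 2 j + 2 * j * ln_lnD_value 1 j + j ^+ 2 * ln_lnD_value 0 j).

Lemma newton_moment2 j : 0 <= j ->
  newton (fun t => - ln t * log_moment1 2 (t + j)) (moment2_value j).
Proof.
move=> j0; have j1 : 0 <= j + 1 by rewrite addr_ge0.
have N m := newton_ln_Li2inv m j0; have M m := newton_ln_lnD m j0.
have M1 m := newton_ln_lnD m j1.
rewrite /moment2_value.
have quad (F : nat -> R -> R) (v : nat -> R) i : (forall m, newton (F m) (v m)) ->
    newton (fun t => F 2 t + 2 * i * F 1 t + i ^+ 2 * F 0 t)
      (v 2 + 2 * i * v 1 + i ^+ 2 * v 0).
  by move=> Fv; apply: newtonD; [apply: newtonD => //|]; exact: newtonZ.
apply: eq_newton (newtonD (newtonD (newtonZ (1 / 2) (quad _ _ j N))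
  (newtonD (newtonZ (1 / 2) (newtonD (M1 1%N) (newtonZ (j + 1) (M1 0%N))))
     (newtonZ (- (3 / 4)) (quad _ _ (j + 1) M1))))
  (newtonZ (3 / 4) (quad _ _ j M))) => t t0.
by rewrite log_moment1_2E -[t + j + 1]addrA; move: (Li2inv _) => L; field.
Qed.

Lemma log_moment1_continuous n t : 0 < t -> {for t, continuous (log_moment1 n)}.
Proof.
move=> t0; have h := derive_Li2inv t0; rewrite /log_moment1.
eapply der_continuous; der_rules => //; first by rewrite addr_gt0.
Qed.

Let e11 : 1 + 1 = 2 :> R. Proof. by ring. Qed.
Let e12 : 1 + 2 = 3 :> R. Proof. by ring. Qed.
Let e13 : 1 + 3 = 4 :> R. Proof. by ring. Qed.
Let e21 : 2 + 1 = 3 :> R. Proof. by ring. Qed.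

Lemma B2_integral :
  log_integral 1 (log_integral 1 (@inv_kernel R)) 0 = (ln_Li2inv_value 0 (0 : R))%:E.
Proof.
apply: (newton_B_integral (k := 0) (f := fun t => - Li2inv t)).
- exact: log_integral1_kernel.
- by move=> t t0; apply: der_continuous (der_opp (derive_Li2inv t0)).
by apply: eq_newton (newton_ln_Li2inv 0 (lexx 0)) => t t0; rewrite addr0 expr0; ring.
Qed.

Lemma B2_value : B_int R 2 = pi ^+ 2 / 6 + 4 * ln 2.
Proof.
rewrite (B_integralE (k := 0) B2_integral).2.
rewrite /ln_Li2inv_value/= /ln_lnD_value /lnD_value/= !(addr0, add0r, mul0r, subr0).
rewrite e11 ln1 Li2inv_1.
by move: (pi) (ln 2) => p l; field.
Qed.

Lemma B3_value : 3 * B_int R 3 = - (5 / 8) * zeta R 3 - 1 / 2 * pi ^+ 2 - 33 * ln 2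
        + 99 / 4 * ln 3 - 12 * Li 2 (- (1 / 2)).
Proof.
rewrite (_ : B_int R 3 = moment1_value 1 - moment1_value 0); last first.
  apply: (B_integralE (k := 1) _).2.
  apply: (newton_B_integral (k := 1) (f := fdiff 1 (log_moment1 1))).
  - by move=> t t0; apply: (log_moment1_integral _).1.
  - by move=> t; apply: fdiff_continuous => x; exact: log_moment1_continuous.
  rewrite -[- moment1_value _]mulN1r.
  apply: eq_newton (newtonD (newton_moment1 ler01) (newtonZ (-1) (newton_moment1 (lexx 0)))) => t t0.
  by rewrite /= addr0; ring.
rewrite /moment1_value/ln_Li2inv_value/= /ln_lnD_value /lnD_value/=.
rewrite !(addr0, add0r, mul0r, subr0).
rewrite !(e11, e12, e13, e21, ln1, Li2inv_1, Li2inv_2, ln_dlog_value0_1) div1r.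
 by move: (pi) (ln 2) (ln 3) (zeta R 3) (Li 2 _) => p l m z L; field.
Qed.

Lemma B4_value : 6 * B_int R 4 = 361 / 6 * zeta R 3 + 2 / 3 * pi ^+ 2 + 3232 / 9 * ln 2
        - 222 * ln 3 + 80 * Li 3 (- (1 / 2)) + 8 * Li 3 (- (1 / 3))
        + (56 + 64 / 3 * ln 2 - 32 / 3 * ln 3) * Li 2 (- (1 / 2))
        + (- 60 - 16 / 3 * ln 2 + 8 / 3 * ln 3) * Li 2 (- (1 / 3))
        - 32 / 9 * pi ^+ 2 * ln 2 - 8 / 9 * pi ^+ 2 * ln 3
        + 16 / 3 * ln 2 ^+ 2 * ln 3.
Proof.
rewrite (_ : B_int R 4 = moment2_value 2 - 2 * moment2_value 1 + moment2_value 0); last first.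
  apply: (B_integralE (k := 2) _).2.
  apply: (newton_B_integral (k := 2) (f := fdiff 2 (log_moment1 2))).
  - by move=> t t0; apply: (log_moment1_integral _).1.
  - by move=> t; apply: fdiff_continuous => x; exact: log_moment1_continuous.
  rewrite -mulNr.
  apply: eq_newton (newtonD (newtonD (newton_moment2 (ler0n R 2))
    (newtonZ (- 2) (newton_moment2 ler01))) (newton_moment2 (lexx 0))) => t t0.
  by rewrite /= addr0 (_ : t + 1 + 1 = t + 2); ring.

rewrite /moment2_value/ln_Li2inv_value/= /ln_lnD_value /lnD_value/=.
rewrite !(addr0, add0r, mul0r, subr0).
rewrite !(e11, e12, e13, e21, ln1, Li2inv_1, Li2inv_2, Li2inv_3, ln_dlog_value0_1, ln_dlog_value0_2, ln4, div1r, Li2_Nthird).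
by move: (pi) (ln 2) (ln 3) (zeta R 3) (Li 2 _) (Li 3 _) (Li 3 _) => p l m z L L' L''; field.
Qed.

End BValues.

(** For two variables the integral has been computed, and it bounds the others. *)
Lemma B_integral_fine (R : realType) k :
  log_integral 1 (log_integral 1 (iter k (log_integral 0) (@inv_kernel R))) 0 =
  (fine (log_integral 1 (log_integral 1 (iter k (log_integral 0) (@inv_kernel R))) 0))%:E.
Proof.
have nk := @inv_kernel_nonneg R.
have b_finite : log_integral 1 (log_integral 1 (@inv_kernel R)) 0 = (ln_Li2inv_value 0 (0 : R))%:E.
  exact: B2_integral.
rewrite fineK// ge0_fin_numE.
  by rewrite (le_lt_trans (B_integral_bound k))// b_finite ltry.
have n1 := log_integral_nonneg 1 (iter_log_integral_nonneg 0 k nk).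
exact: (log_integral_nonneg 1 n1).2.
Qed.

Lemma A_integral_value (R : realType) k :
  log_integral 2 (iter k.+1 (log_integral 0) (@inv_kernel R)) 0 = (A_value k)%:E.
Proof.
by rewrite -(iter_log_integralC 0 2 k.+1 (@inv_kernel_nonneg R)) A_iterated.
Qed.

Lemma E_int2 (R : realType) k :
  E_int R k.+2 2 = (k.+2%:R * A_int R k.+2 + 'C(k.+2, 2)%:R * B_int R k.+2)%:E.
Proof.
have nk := @inv_kernel_nonneg R.
rewrite E_intE weight_integral2// (A_integralE (A_integral_value R k)).2 (B_integralE (B_integral_fine R k)).2.
rewrite A_iterated (iter_log_integralC 0 1 k (log_integral_nonneg 1 nk)).
by rewrite (iter_log_integralC 0 1 k nk) B_integral_fine -!EFinM -EFinD.
Qed.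

Theorem theorem2 (R : realType) (k : nat) (hk : (2 <= k)%N) :
  (* (i) *)
  E_int R k 0 = ((k.-1`!%:R)^-1 *
    \sum_(2 <= j < k.+1)
      (-1) ^+ (k + j) * j%:R ^+ k.-1 * 'C(k, j)%:R * ln (j%:R : R))%:E
  /\
  (* (ii) *)
  E_int R k 1 = ((-1) ^+ k * (k%:R / (12 * (k - 2)`!%:R)) * pi ^+ 2
    + \sum_(2 <= m < k.+1) Clog R k m * ln (m%:R : R)
    + \sum_(2 <= m < k)
        (-1) ^+ (k - m) * (k%:R * m%:R ^+ k.-1 / k.-1`!%:R)
        * 'C(k.-1, m)%:R * Li 2 (- (m%:R^-1) : R))%:E
  /\
  (* (iii) *)
  [/\ (lebesgue_tuple R k).-integrable (cube R k) (EFin \o A_integrand R k),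
      (lebesgue_tuple R k).-integrable (cube R k) (EFin \o B_integrand R k),
      E_int R k 2 = (k%:R * A_int R k + 'C(k, 2)%:R * B_int R k)%:E
    & k%:R * A_int R k =
        (-1) ^+ k * (3 * k%:R / (2 * (k - 2)`!%:R)) * zeta R 3
        + (-1) ^+ k * (k%:R * Harm R k.-1 / (6 * (k - 2)`!%:R)) * pi ^+ 2
        + \sum_(2 <= m < k)
            (-1) ^+ (k - m) * (2 * k%:R * m%:R ^+ k.-1 / k.-1`!%:R)
            * 'C(k.-1, m)%:R
            * (Li 3 (- (m%:R^-1)) + Harm R k.-1 * Li 2 (- (m%:R^-1)))
        + logA R k]
  /\
  [/\ B_int R 2 = pi ^+ 2 / 6 + 4 * ln 2,
      3 * B_int R 3 = - (5 / 8) * zeta R 3 - 1 / 2 * pi ^+ 2 - 33 * ln 2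
        + 99 / 4 * ln 3 - 12 * Li 2 (- (1 / 2))
    & 6 * B_int R 4 = 361 / 6 * zeta R 3 + 2 / 3 * pi ^+ 2 + 3232 / 9 * ln 2
        - 222 * ln 3 + 80 * Li 3 (- (1 / 2)) + 8 * Li 3 (- (1 / 3))
        + (56 + 64 / 3 * ln 2 - 32 / 3 * ln 3) * Li 2 (- (1 / 2))
        + (- 60 - 16 / 3 * ln 2 + 8 / 3 * ln 3) * Li 2 (- (1 / 3))
        - 32 / 9 * pi ^+ 2 * ln 2 - 8 / 9 * pi ^+ 2 * ln 3
        + 16 / 3 * ln 2 ^+ 2 * ln 3].
Proof.
case: k hk => [//|[//|k]] _.
have [iA vA] := A_integralE (A_integral_value R k).
have [iB _] := B_integralE (B_integral_fine R k).
split; first exact: E_int0.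
split; first by rewrite subn2 E_int1.
split; last by split; [exact: B2_value|exact: B3_value|exact: B4_value].
split=> //; first exact: E_int2.
by rewrite vA subn2 A_closed.
Qed.
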